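(* Let $\alpha\in\mathbb{R}$ and $\kappa\in\{0,1,-1\}$. The following assertions are equivalent: (a) the control system $(\mathcal{A}_\kappa^\alpha,\iota_\kappa^\alpha)$ on $\mathcal{G}_\kappa$ is controllable; (b) $\alpha^2\neq\kappa$; (c) for every $\ell\in\mathcal{G}_\kappa$, the fiber of $\mathcal{A}_\kappa^\alpha$ over $\ell$ is a substantial submanifold of $T_\ell\mathcal{G}_\kappa$. Moreover, in the Euclidean case ($\kappa=0$), the image of a $0$-admissible curve consists of parallel straight lines; and in the spherical case ($\kappa=1$), if $\alpha=\pm1$, the image of an $\alpha$-admissible curve consists of great circles in a (single) Hopf fibration.
   Context: Space forms: $M_0=\mathbb{R}^3$, $M_1=S^3$ (unit sphere of $\mathbb{R}^4$), $M_{-1}=H^3$ (hyperbolic space of curvature $-1$), each oriented; for orthonormal $u,v\in T_pM_\kappa$, $u\times v$ is the unit vector making $\{u,v,u\times v\}$ a positively oriented orthonormal basis of $T_pM_\kappa$. $\gamma_v$ denotes the geodesic with initial velocity $v$. $\mathcal{G}_\kappa$ is the set of all complete oriented geodesics of $M_\kappa$: classes $[\sigma]$ of unit speed geodesics $\sigma:\mathbb{R}\to M_\kappa$, where $\sigma_1\sim\sigma_2$ iff $\sigma_1(t)=\sigma_2(t+t_o)$ for all $t$ and some $t_o\in\mathbb{R}$. The identity component $G_\kappa$ of the isometry group of $M_\kappa$ acts transitively on it by $g\cdot[\sigma]=[g\circ\sigma]$, and $\mathcal{G}_\kappa$ has the resulting smooth structure of homogeneous space (dimension 4). $\alpha$-helicoidal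 curves: given $\ell=[\sigma]\in\mathcal{G}_\kappa$ with $\sigma(0)=p$ and a unit vector $A\in T_pM_\kappa$ orthogonal to $\ell$, put $B=A\times\sigma'(0)$, let $V_t,B_t$ be the parallel vector fields along $\gamma_A$ with initial values $\sigma'(0)$ and $B$, and define $\phi^\alpha_{\ell,p,A}(s,t)=\gamma_{\cos(\alpha t)V_t+\sin(\alpha t)B_t}(s)$ and $\Gamma^\alpha_{\ell,p,A}:\mathbb{R}\to\mathcal{G}_\kappa$, $\Gamma^\alpha_{\ell,p,A}(t)=[s\mapsto\phi^\alpha_{\ell,p,A}(s,t)]$. Let $\mathcal{A}_\kappa^\alpha\subset T\mathcal{G}_\kappa$ be the set of all initial velocities $(\Gamma^\alpha_{\ell,p,A})'(0)$, over all such $\ell,p,A$, and $\iota_\kappa^\alpha:\mathcal{A}_\kappa^\alpha\to T\mathcal{G}_\kappa$ the inclusion; it is a fiber subbundle of $T\mathcal{G}_\kappa$ over $\mathcal{G}_\kappa$. A control system on a smooth manifold $N$ is a fiber subbundle $\iota:\mathcal{A}\to TN$ of $TN$. A smooth curve $\gamma:(a,b)\to N$ is admissible if $\gamma'(t)\in\iota(\mathcal{A})$ for all $t$. The system is controllable if every pair of points of $N$ can be joined by a piecewise admissible curve. Admissible curves of $(\mathcal{A}_\kappa^\alpha,\iota_\kappa^\alpha)$ are called $\alpha$-admissible. A submanifold of a vector space is substantial if it is not included in any proper affine subspace. The Hopf fibrations of $S^3$ are the fibrations by oriented great circles that are congruent, by an isometry of $S^3$ (not necessarily orientation preserving), to the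 fibration whose fibers are the intersections of $S^3$ with complex lines, identifying $\mathbb{R}^4\equiv\mathbb{C}^2$. *)

(* Defs.v *)
From HB Require Import structures.
From mathcomp Require Import all_boot all_order all_algebra.
From mathcomp Require Import all_classical all_reals all_analysis.

Set Implicit Arguments.
Unset Strict Implicit.
Unset Printing Implicit Defensive.

Import Order.TTheory GRing.Theory Num.Theory.
Import numFieldNormedType.Exports.

Local Open Scope classical_set_scope.
Local Open Scope ring_scope.

(* The three space forms are taken as hypersurfaces of R^4 = 'cV_4, all with
   the equation x_0^2 + kappa (x_1^2 + x_2^2 + x_3^2) = 1:
     kappa =  0 : the affine hyperplane x_0 = 1, a copy of R^3;
     kappa =  1 : the unit sphere;
     kappa = -1 : the upper sheet of the hyperboloid.
   The Riemannian metric is the restriction to tangent vectors of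
   kappa u_0 v_0 + u_1 v_1 + u_2 v_2 + u_3 v_3 (when kappa = 0, tangent vectors
   have u_0 = 0). *)

Definition level_form (R : realType) (kappa : R) (x y : 'cV[R]_4) : R :=
  x 0 0 * y 0 0 + kappa * \sum_(i < 4 | i != 0) x i 0 * y i 0.

Definition metric (R : realType) (kappa : R) (u v : 'cV[R]_4) : R :=
  kappa * (u 0 0 * v 0 0) + \sum_(i < 4 | i != 0) u i 0 * v i 0.

Definition space_form (R : realType) (kappa : R) : set 'cV[R]_4 :=
  [set x | level_form kappa x x = 1 /\ (kappa != 1 -> 0 < x 0 0)].

Definition tangent (R : realType) (kappa : R) (x : 'cV[R]_4) : set 'cV[R]_4 :=
  [set v | level_form kappa x v = 0].

(* A basis u, v, w of the tangent space at p is positively oriented iff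
   det (p, u, v, w) > 0. *)
Definition is_cross (R : realType) (kappa : R) (p u v w : 'cV[R]_4) : Prop :=
  [/\ tangent kappa p w,
      metric kappa w w = 1,
      metric kappa w u = 0,
      metric kappa w v = 0
    & 0 < \det (\matrix_(i < 4, j < 4) (nth 0 [:: p; u; v; w] j) i 0)].

Definition smooth_at (R : realType) (V : normedModType R) (f : R -> V) (t : R)
  : Prop :=
  forall n : nat, derivable (derive1n n f) t 1.

(* The covariant derivative of a field along a curve of M_kappa is the
   tangential component of its derivative in R^4, so it vanishes iff that
   derivative is orthogonal to the tangent space. *)
Definition parallel_field (R : realType) (kappa : R)
    (gamma V : R -> 'cV[R]_4) : Prop :=
  [/\ forall t, smooth_at V t,
      forall t, tangent kappa (gamma t) (V t)
    & forall t u, tangent kappa (gamma t) u -> metric kappa (derive1 V t) u = 0].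

Definition unit_geodesic (R : realType) (kappa : R) (sigma : R -> 'cV[R]_4)
  : Prop :=
  [/\ forall t, smooth_at sigma t,
      forall t, space_form kappa (sigma t),
      forall t, metric kappa (derive1 sigma t) (derive1 sigma t) = 1
    & parallel_field kappa sigma (derive1 sigma)].

Definition geod_class (R : realType) (kappa : R) (sigma : R -> 'cV[R]_4)
  : set (R -> 'cV[R]_4) :=
  [set tau | unit_geodesic kappa tau /\
             exists t0 : R, forall t, sigma t = tau (t + t0)].

Definition oriented_geodesics (R : realType) (kappa : R)
  : set (set (R -> 'cV[R]_4)) :=
  [set l | exists2 sigma, unit_geodesic kappa sigma
                        & l = geod_class kappa sigma].

(* Isometries of M_kappa in their usual presentation as 4 x 4 matrices: O(4),
   the Lorentz matrices preserving the upper sheet, and the affine isometries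
   of the hyperplane x_0 = 1. *)
Definition isometries (R : realType) (kappa : R) : set 'M[R]_4 :=
  [set g | (fun x : 'cV[R]_4 => g *m x) @` space_form kappa = space_form kappa
        /\ forall p u v, space_form kappa p -> tangent kappa p u ->
             tangent kappa p v ->
             metric kappa (g *m u) (g *m v) = metric kappa u v].

Definition isometries0 (R : realType) (kappa : R) : set 'M[R]_4 :=
  connected_component (isometries kappa) (1%:M : 'M[R]_4).

Definition act (R : realType) (g : 'M[R]_4) (l : set (R -> 'cV[R]_4))
  : set (R -> 'cV[R]_4) :=
  (fun (sigma : R -> 'cV[R]_4) (t : R) => g *m sigma t) @` l.

Definition isotropy (R : realType) (kappa : R) (l : set (R -> 'cV[R]_4))
  : set 'M[R]_4 :=
  [set g | isometries0 kappa g /\ act g l = l].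

(* The Lie algebra of a matrix group H, as its tangent space at the identity. *)
Definition lie_algebra (R : realType) (H : set 'M[R]_4) : set 'M[R]_4 :=
  [set X | exists h : R -> 'M[R]_4,
    [/\ h 0 = 1%:M,
        \forall s \near (0 : R), smooth_at h s,
        \forall s \near (0 : R), H (h s)
      & derive1 h 0 = X]].

(* Smooth structure of the homogeneous space of oriented geodesics.  Write g for
   the Lie algebra of the identity component G and g_l for that of the isotropy
   group of l.  The tangent space at l is g / g_l, the class of X being the
   value at l of the fundamental vector field of X; classes are represented as
   cosets.  As the orbit map g |-> g . l is a submersion, a curve c is smooth
   at t iff near t it is g(s) . c(t) with g smooth in G and g(t) = 1, and then
   c'(t) is the class of g'(t). *)
Definition tangent_class (R : realType) (kappa : R) (l : set (R -> 'cV[R]_4))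
    (X : 'M[R]_4) : set 'M[R]_4 :=
  [set Y | lie_algebra (isotropy kappa l) (Y - X)].

Definition tangent_geod (R : realType) (kappa : R) (l : set (R -> 'cV[R]_4))
  : set (set 'M[R]_4) :=
  [set tangent_class kappa l X | X in lie_algebra (isometries0 kappa)].

Definition local_lift (R : realType) (kappa : R)
    (c : R -> set (R -> 'cV[R]_4)) (t : R) (g : R -> 'M[R]_4) : Prop :=
  [/\ g t = 1%:M,
      \forall s \near t, smooth_at g s
    & \forall s \near t, isometries0 kappa (g s) /\ c s = act (g s) (c t)].

Definition velocity (R : realType) (kappa : R)
    (c : R -> set (R -> 'cV[R]_4)) (t : R) (u : set 'M[R]_4) : Prop :=
  exists2 g, local_lift kappa c t g & u = tangent_class kappa (c t) (derive1 g t).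

Definition smooth_curve (R : realType) (kappa : R) (a b : \bar R)
    (c : R -> set (R -> 'cV[R]_4)) : Prop :=
  forall t : R, (a < t%:E < b)%E ->
    oriented_geodesics kappa (c t) /\ exists g, local_lift kappa c t g.

Definition helicoidal (R : realType) (kappa alpha : R)
    (l : set (R -> 'cV[R]_4)) (p A : 'cV[R]_4)
    (Gamma : R -> set (R -> 'cV[R]_4)) : Prop :=
  exists (sigma gamma V B : R -> 'cV[R]_4) (phi : R -> R -> 'cV[R]_4),
  [/\ [/\ unit_geodesic kappa sigma, l = geod_class kappa sigma & sigma 0 = p],
      [/\ tangent kappa p A, metric kappa A A = 1
        & metric kappa A (derive1 sigma 0) = 0],
      [/\ unit_geodesic kappa gamma, gamma 0 = p & derive1 gamma 0 = A],
      [/\ parallel_field kappa gamma V, V 0 = derive1 sigma 0,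
          parallel_field kappa gamma B
        & is_cross kappa p A (derive1 sigma 0) (B 0)]
    & forall t : R,
      [/\ unit_geodesic kappa (phi^~ t),
          phi 0 t = gamma t,
          derive1 (phi^~ t) 0 = cos (alpha * t) *: V t + sin (alpha * t) *: B t
        & Gamma t = geod_class kappa (phi^~ t)]].

Definition control_fiber (R : realType) (kappa alpha : R)
    (l : set (R -> 'cV[R]_4)) : set (set 'M[R]_4) :=
  [set u | exists p A Gamma,
    helicoidal kappa alpha l p A Gamma /\ velocity kappa Gamma 0 u].

Definition admissible (R : realType) (kappa alpha : R) (a b : \bar R)
    (c : R -> set (R -> 'cV[R]_4)) : Prop :=
  smooth_curve kappa a b c /\
  forall t : R, (a < t%:E < b)%E ->
    exists2 u, velocity kappa c t u & control_fiber kappa alpha (c t) u.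

(* Each closed piece is the restriction of an admissible curve defined on a
   larger open interval. *)
Definition piecewise_admissible (R : realType) (kappa alpha a b : R)
    (c : R -> set (R -> 'cV[R]_4)) : Prop :=
  exists (n : nat) (x : nat -> R),
  [/\ x 0%N = a,
      x n = b,
      forall i, (i < n)%N -> x i < x i.+1
    & forall i, (i < n)%N ->
        exists (a' b' : \bar R) (c' : R -> set (R -> 'cV[R]_4)),
        [/\ (a' < (x i)%:E)%E, ((x i.+1)%:E < b')%E,
            admissible kappa alpha a' b' c'
          & forall s, x i <= s <= x i.+1 -> c s = c' s]].

Definition controllable (R : realType) (kappa alpha : R) : Prop :=
  forall l1 l2, oriented_geodesics kappa l1 -> oriented_geodesics kappa l2 ->
    exists (a b : R) (c : R -> set (R -> 'cV[R]_4)),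
    [/\ a < b, piecewise_admissible kappa alpha a b c, c a = l1 & c b = l2].

Definition affine_subspace (R : realType) (kappa : R)
    (l : set (R -> 'cV[R]_4)) (W : set (set 'M[R]_4)) : Prop :=
  [/\ W !=set0,
      W `<=` tangent_geod kappa l
    & forall (X Y : 'M[R]_4) (r : R),
        lie_algebra (isometries0 kappa) X -> lie_algebra (isometries0 kappa) Y ->
        W (tangent_class kappa l X) -> W (tangent_class kappa l Y) ->
        W (tangent_class kappa l ((1 - r) *: X + r *: Y))].

Definition substantial (R : realType) (kappa : R)
    (l : set (R -> 'cV[R]_4)) (S : set (set 'M[R]_4)) : Prop :=
  S `<=` tangent_geod kappa l /\
  ~ (exists W, [/\ affine_subspace kappa l W, W <> tangent_geod kappa l
                 & S `<=` W]).

(* Parallelism of unoriented lines of R^3; a line is parallel to itself. *)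
Definition parallel_lines (R : realType) (l1 l2 : set (R -> 'cV[R]_4)) : Prop :=
  forall sigma tau, l1 sigma -> l2 tau ->
    exists r : R, derive1 tau 0 = r *: derive1 sigma 0.

(* Multiplication by i under R^4 = C^2, z = (x_0 + i x_1, x_2 + i x_3). *)
Definition mul_i (R : realType) (x : 'cV[R]_4) : 'cV[R]_4 :=
  \col_(i < 4) nth 0 [:: - x 1 0; x 0 0; - x 3 0; x 2 0] i.

Definition complex_line (R : realType) (L : set 'cV[R]_4) : Prop :=
  exists2 v : 'cV[R]_4, v != 0
    & L = [set x | exists a b : R, x = a *: v + b *: mul_i v].

(* The fibers are oriented by multiplication by i; the opposite orientation
   comes from the isometry (z, w) |-> (conj z, conj w). *)
Definition standard_hopf (R : realType) : set (set (R -> 'cV[R]_4)) :=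
  [set l | exists sigma L,
    [/\ unit_geodesic 1 sigma, l = geod_class 1 sigma, complex_line L,
        range sigma = space_form 1 `&` L
      & derive1 sigma 0 = mul_i (sigma 0)]].

Definition hopf_fibration (R : realType) (F : set (set (R -> 'cV[R]_4)))
  : Prop :=
  exists2 g : 'M[R]_4, isometries 1 g & F = act g @` (@standard_hopf R).

(* Main.v *)
(* The geodesic through p with velocity v is determined by p ^ v = p v^T - v p^T, and the
   class of X in g / g_l by X (p ^ v) + (p ^ v) X^T; for an alpha-helicoidal curve this
   derivative is A ^ v + alpha p ^ B.  If alpha^2 = kappa, the three coordinates
   P_{0i} - alpha P_{jk}, (i, j, k) cyclic, vanish on it, so they are constant along
   admissible curves.  They are the direction of the line when kappa = 0, and the
   (anti-)self-dual part of p ^ v, i.e. the complex structure of a Hopf fibration, when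
   kappa = 1.  If alpha^2 <> kappa, moving p along l and rotating A about l yields
   velocities spanning the tangent space.
   For controllability, two helicoidal arcs leaving a geodesic symmetrically, along
   well-chosen perpendicular directions and for a well-chosen time, end on geodesics which
   meet at a point under any given small angle.  Hence all the geodesics through a point
   can be joined, and then all geodesics. *)
Require Import Defs.
From HB Require Import structures.
From mathcomp Require Import all_boot all_order all_algebra.
From mathcomp Require Import all_classical all_reals all_analysis.
From mathcomp Require Import ring lra.

Set Implicit Arguments.
Unset Strict Implicit.
Unset Printing Implicit Defensive.

Import Order.TTheory GRing.Theory Num.Theory.
Import numFieldNormedType.Exports.

Local Open Scope classical_set_scope.
Local Open Scope ring_scope.

(** * Derivatives and smoothness of matrix-valued curves *)

(** The overview speaks of geodesics; the computations are done with frames. A matrix [F] with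
    columns p, A, v, B stands for the geodesic of (p, v) with a chosen perpendicular A. Isometries
    multiply [F] on the left; an alpha-helicoidal arc is right multiplication by the one-parameter
    group [screw k t (alpha * t)], and another choice of p and A on the same geodesic is right
    multiplication by [stab]. Reachability and spanning thus become polynomial identities between
    explicit 4 x 4 matrices, common to the three curvatures once [kcos] and [ksin] replace cos and
    sin. Pairs (c, s) with c^2 + kappa s^2 = 1 often stand for parameters, so that [ring] can
    conclude. Two obstacles shape the rest. Velocities are cosets of matrices, so they are compared
    through the derivative of the Plücker matrix, which the isotropy algebra annihilates. And
    neither the identity component nor its Lie algebra comes with equations: smooth paths provide
    elements of the component, and the Lie algebra is found by differentiating the conditions that
    define an isometry. *)

Lemma is_derive_mxP (R : realType) m n (M : R -> 'M[R]_(m.+1, n.+1)) (D : 'M[R]_(m.+1, n.+1))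
    (t : R) :
  is_derive t 1 M D <-> forall i j, is_derive t 1 (fun x => M x i j) (D i j).
Proof.
split=> [[dM <-] i j|dM].
  split; first by move/derivable_mxP : dM; exact.
  by rewrite (derive_mx dM) mxE.
have dM' : derivable M t 1 by apply/derivable_mxP => i j; case: (dM i j).
split=> //; rewrite derive_mx //; apply/matrixP => i j; rewrite mxE.
by case: (dM i j).
Qed.

Lemma is_derive_mulmx (R : realType) m n p (M : R -> 'M[R]_(m.+1, n.+1))
    (N : R -> 'M[R]_(n.+1, p.+1)) DM DN (t : R) :
  is_derive t 1 M DM -> is_derive t 1 N DN ->
  is_derive t 1 (fun x => M x *m N x) (DM *m N t + M t *m DN).
Proof.
move=> /is_derive_mxP dM /is_derive_mxP dN; apply/is_derive_mxP => i j.
have -> : (fun x => (M x *m N x) i j) =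
    \sum_(k < n.+1) ((fun x => M x i k) * (fun x => N x k j)).
  by apply/funext => x; rewrite mxE fct_sumE.
apply: (@is_derive_eq _ _ _ _ _ _ _ _ (is_derive_sum (fun k => is_deriveM (dM i k) (dN k j)))).
rewrite !mxE -big_split /=; apply: eq_bigr => k _.
by rewrite addrC; congr (_ + _); rewrite mulrC.
Qed.

Lemma is_derive_trmx (R : realType) m n (M : R -> 'M[R]_(m.+1, n.+1)) D (t : R) :
  is_derive t 1 M D -> is_derive t 1 (fun x => (M x)^T) D^T.
Proof.
move=> /is_derive_mxP dM; apply/is_derive_mxP => i j; rewrite mxE.
by under eq_fun do rewrite mxE; exact: dM.
Qed.


Lemma is_deriveM_fun (R : realType) (f g : R -> R) (df dg t : R) :
  is_derive t 1 f df -> is_derive t 1 g dg ->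
  is_derive t 1 (fun x => f x * g x) (df * g t + f t * dg).
Proof.
move=> hf hg; apply: (@is_derive_eq _ _ _ _ _ _ _ _ (is_deriveM hf hg)).
by rewrite addrC; congr (_ + _); rewrite mulrC.
Qed.

Lemma is_deriveD_fun (R : realType) (V : normedModType R) (f g : R -> V) (df dg : V) (t : R) :
  is_derive t 1 f df -> is_derive t 1 g dg ->
  is_derive t 1 (fun x => f x + g x) (df + dg).
Proof. by move=> hf hg; exact: is_deriveD. Qed.

Lemma is_deriveN_fun (R : realType) (V : normedModType R) (f : R -> V) (df : V) (t : R) :
  is_derive t 1 f df -> is_derive t 1 (fun x => - f x) (- df).
Proof. by move=> hf; exact: is_deriveN. Qed.

Lemma is_derive_scalemx (R : realType) m n (f : R -> R) (M : R -> 'M[R]_(m.+1, n.+1))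
    df DM (t : R) :
  is_derive t 1 f df -> is_derive t 1 M DM ->
  is_derive t 1 (fun x => f x *: M x) (df *: M t + f t *: DM).
Proof.
move=> hf /is_derive_mxP hM; apply/is_derive_mxP => i j.
rewrite !mxE (_ : (fun x => _) = (fun x => f x * M x i j)); last first.
  by apply/funext => x; rewrite mxE.
exact: is_deriveM_fun.
Qed.

Lemma is_derive1_fun_affine (R : realType) (f : R -> R) (a b df t : R) :
  is_derive (a * t + b) 1 f df -> is_derive t 1 (fun x => f (a * x + b)) (df * a).
Proof.
move=> hf; apply: (@is_derive1_comp _ f (fun x => a * x + b)) => //.
have h : is_derive t 1 (fun x : R => x) (1 : R) by exact: is_derive_id.
have h1 := is_deriveM_fun (is_derive_cst a t 1) h.
have h2 := is_deriveD h1 (is_derive_cst b t 1).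
by apply: (@is_derive_eq _ _ _ _ _ _ _ _ h2); rewrite mul0r add0r mulr1 addr0.
Qed.

(** Global version of [smooth_at], with the derivatives peeled off from the inside: the formulas for
    the derivative of a sum or a product are then equalities of functions and can be differentiated
    again. [Ck n] asks for [n.+1] derivatives, as does [derivable (derive1n n f)]. *)
Fixpoint Ck (R : realType) (V : normedModType R) (n : nat) (f : R -> V) : Prop :=
  (forall t, derivable f t 1) /\ (if n is m.+1 then Ck m (derive1 f) else True).

Definition smooth (R : realType) (V : normedModType R) (f : R -> V) : Prop :=
  forall n, Ck n f.

Lemma derive1n_derive1 (R : realType) (V : normedModType R) (f : R -> V) n :
  derive1n n.+1 f = derive1n n (derive1 f).
Proof. by rewrite /derive1n iterSr. Qed.

Lemma smooth_smooth_at (R : realType) (V : normedModType R) (f : R -> V) (t : R) :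
  smooth f -> smooth_at f t.
Proof.
move=> hf n; move: (hf n); elim: n f {hf} => [|n ih] f [h1 h2].
  exact: h1.
by rewrite derive1n_derive1; apply: ih.
Qed.

Lemma Ck_le (R : realType) (V : normedModType R) n (f : R -> V) : Ck n.+1 f -> Ck n f.
Proof. by elim: n f => [|n ih] f /= [h1 h2]; split => //; apply: ih. Qed.

Lemma is_derive_derive1 (R : realType) (V : normedModType R) (f : R -> V) (t : R) :
  derivable f t 1 -> is_derive t 1 f (derive1 f t).
Proof. by move=> h; split=> //; rewrite derive1E. Qed.

Lemma is_derive_derive1_eq (R : realType) (V : normedModType R) (f : R -> V) (t : R) (d : V) :
  is_derive t 1 f d -> derive1 f t = d.
Proof. by move=> h; rewrite derive1E derive_val. Qed.

(** Coinduction: membership in [P] is an invariant that supplies every further derivative. It is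
    applied to the span of [kcos] and [ksin], and to the curves [geo]. *)
Lemma smooth_family (R : realType) (V : normedModType R) (P : set (R -> V)) :
  (forall f, P f -> exists2 f', P f' & forall t : R, is_derive t 1 f (f' t)) ->
  forall f, P f -> smooth f.
Proof.
move=> hP f Pf n; elim: n f Pf => [|n ih] f /hP [f' Pf' df] /=.
  by split=> // t; apply: ex_derive.
split=> [t|]; first exact: ex_derive.
by rewrite (_ : derive1 f = f')// ?funeqE => [|t]; [exact: ih|exact: is_derive_derive1_eq].
Qed.

Lemma Ck_D (R : realType) (V : normedModType R) n (f g : R -> V) :
  Ck n f -> Ck n g -> Ck n (fun t => f t + g t).
Proof.
elim: n f g => [|n ih] f g /= [f1 f2] [g1 g2].
  by split=> // t; apply: derivableD.
split=> [t|]; first exact: derivableD.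
have -> : derive1 (fun t => f t + g t) = (fun t => derive1 f t + derive1 g t).
  apply/funext => t; apply: is_derive_derive1_eq.
  by apply: is_deriveD; apply: is_derive_derive1.
exact: ih.
Qed.

Lemma Ck_M (R : realType) n (f g : R -> R) :
  Ck n f -> Ck n g -> Ck n (fun t => f t * g t).
Proof.
elim: n f g => [|n ih] f g.
  move=> [f1 _] [g1 _]; split=> [t|]; last exact: I.
  by apply: ex_derive; apply: is_deriveM_fun; apply: is_derive_derive1.
move=> hf hg; have [[f1 f2] [g1 g2]] := (hf, hg); split=> [t|].
  by apply: ex_derive; apply: is_deriveM_fun; apply: is_derive_derive1.
have -> : derive1 (fun t => f t * g t) = (fun t => derive1 f t * g t + f t * derive1 g t).
  apply/funext => t; apply: is_derive_derive1_eq.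
  by apply: is_deriveM_fun; apply: is_derive_derive1.
by apply: Ck_D; apply: ih => //; exact: Ck_le.
Qed.

Lemma Ck_cst (R : realType) (V : normedModType R) n (v : V) : Ck n (fun _ : R => v).
Proof.
elim: n v => [|n ih] v /=; first by split => // t; exact: derivable_cst.
split=> [t|]; first exact: derivable_cst.
rewrite (_ : derive1 _ = fun _ => 0) //; apply/funext => t.
exact: derive1_cst.
Qed.

Lemma Ck_affine (R : realType) n (f : R -> R) (a b : R) :
  Ck n f -> Ck n (fun t => f (a * t + b)).
Proof.
elim: n f => [|n ih] f /= [f1 f2].
  split=> [t|]; last exact: I.
  by apply: ex_derive; apply: is_derive1_fun_affine; apply: is_derive_derive1.
split=> [t|].
  by apply: ex_derive; apply: is_derive1_fun_affine; apply: is_derive_derive1.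
have -> : derive1 (fun t => f (a * t + b)) = (fun t => derive1 f (a * t + b) * a).
  apply/funext => t; apply: is_derive_derive1_eq.
  by apply: is_derive1_fun_affine; apply: is_derive_derive1.
by apply: Ck_M; [exact: ih|exact: Ck_cst].
Qed.

Lemma Ck_mxP (R : realType) m n k (M : R -> 'M[R]_(m.+1, n.+1)) :
  Ck k M <-> forall i j, Ck k (fun t => M t i j).
Proof.
elim: k M => [|k ih] M /=.
  split=> [[h _] i j|h].
    by split=> // t; move/derivable_mxP: (h t); exact.
  by split=> // t; apply/derivable_mxP => i j; case: (h i j).
have dE : (forall t, derivable M t 1) ->
    forall i j, derive1 (fun t => M t i j) = (fun t => derive1 M t i j).
  move=> h i j; apply/funext => t; apply: is_derive_derive1_eq.
  by move: i j; apply/is_derive_mxP; exact: is_derive_derive1.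
split=> [[h hk] i j|h].
  split; first by move=> t; move/derivable_mxP: (h t); exact.
  by rewrite dE//; move/ih: hk; exact.
have hd t : derivable M t 1 by apply/derivable_mxP => i j; case: (h i j).
by split=> //; apply/ih => i j; rewrite -dE//; case: (h i j).
Qed.

Lemma smooth_mxP (R : realType) m n (M : R -> 'M[R]_(m.+1, n.+1)) :
  smooth M <-> forall i j, smooth (fun t => M t i j).
Proof.
split=> [h i j k|h k]; first by move/Ck_mxP: (h k); exact.
by apply/Ck_mxP => i j; exact: h.
Qed.

Lemma smooth_cst (R : realType) (V : normedModType R) (v : V) : smooth (fun _ : R => v).
Proof. by move=> n; exact: Ck_cst. Qed.

Lemma smoothD (R : realType) (V : normedModType R) (f g : R -> V) :
  smooth f -> smooth g -> smooth (fun t => f t + g t).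
Proof. by move=> hf hg n; exact: Ck_D. Qed.

Lemma smoothM (R : realType) (f g : R -> R) :
  smooth f -> smooth g -> smooth (fun t => f t * g t).
Proof. by move=> hf hg n; exact: Ck_M. Qed.

Lemma smooth_affine (R : realType) (f : R -> R) (a b : R) :
  smooth f -> smooth (fun t => f (a * t + b)).
Proof. by move=> hf n; exact: Ck_affine. Qed.

Lemma smooth_mulmx (R : realType) m n p (M : R -> 'M[R]_(m.+1, n.+1))
    (N : R -> 'M[R]_(n.+1, p.+1)) :
  smooth M -> smooth N -> smooth (fun t => M t *m N t).
Proof.
move=> /smooth_mxP hM /smooth_mxP hN; apply/smooth_mxP => i j.
under eq_fun do rewrite mxE.
elim: (index_enum _) => [|k s ih].
  by under eq_fun do rewrite big_nil; exact: smooth_cst.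
by under eq_fun do rewrite big_cons; apply: smoothD => //; exact: smoothM.
Qed.

(** * Generalised trigonometric functions *)

Definition curvature (R : realType) (kappa : R) : Prop :=
  [\/ kappa = 0, kappa = 1 | kappa = -1].

(** The solution of f'' = - kappa f with initial data (1, 0); [ksin] is the one with data (0, 1).
    The last branch is cosh, resp. sinh, and stands for kappa = -1 only, which is why their
    properties are stated under [curvature]. *)
Definition kcos (R : realType) (kappa t : R) : R :=
  if kappa == 0 then 1 else if kappa == 1 then cos t
  else (expR t + expR (- t)) / 2.

Definition ksin (R : realType) (kappa t : R) : R :=
  if kappa == 0 then t else if kappa == 1 then sin t
  else (expR t - expR (- t)) / 2.

Lemma curvatureN1 (R : realType) :
  ((-1 : R) == 0 = false) * ((-1 : R) == 1 = false).
Proof.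
split; first by rewrite oppr_eq0 oner_eq0.
by apply/negbTE; rewrite lt_eqF//; lra.
Qed.

Lemma kcos0E (R : realType) : kcos (0 : R) = fun _ => 1.
Proof. by apply/funext => t; rewrite /kcos eqxx. Qed.
Lemma ksin0E (R : realType) : ksin (0 : R) = fun t => t.
Proof. by apply/funext => t; rewrite /ksin eqxx. Qed.
Lemma kcos1E (R : realType) : kcos (1 : R) = @cos R.
Proof. by apply/funext => t; rewrite /kcos oner_eq0 eqxx. Qed.
Lemma ksin1E (R : realType) : ksin (1 : R) = @sin R.
Proof. by apply/funext => t; rewrite /ksin oner_eq0 eqxx. Qed.
Lemma kcosN1E (R : realType) :
  kcos (-1 : R) = fun t => (expR t + expR (- t)) / 2.
Proof. by apply/funext => t; rewrite /kcos !curvatureN1. Qed.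
Lemma ksinN1E (R : realType) :
  ksin (-1 : R) = fun t => (expR t - expR (- t)) / 2.
Proof. by apply/funext => t; rewrite /ksin !curvatureN1. Qed.

Definition kE := (kcos0E, ksin0E, kcos1E, ksin1E, kcosN1E, ksinN1E).

Lemma kcos_0 (R : realType) (kappa : R) : curvature kappa -> kcos kappa 0 = 1.
Proof. by case=> ->; rewrite !kE ?cos0// oppr0 expR0; lra. Qed.

Lemma ksin_0 (R : realType) (kappa : R) : curvature kappa -> ksin kappa 0 = 0.
Proof. by case=> ->; rewrite !kE ?sin0// oppr0 expR0; lra. Qed.

Lemma is_derive_kcos (R : realType) (kappa t : R) : curvature kappa ->
  is_derive t 1 (kcos kappa) (- kappa * ksin kappa t).
Proof.
have e (s : R) : is_derive s 1 expR (expR s) by exact: is_derive_expR.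
have eN : is_derive t 1 (fun s : R => expR (- s)) (- expR (- t)).
  have := is_derive1_fun_affine (a := -1) (b := 0) (e (-1 * t + 0)).
  under eq_fun do rewrite addr0 mulN1r.
  by move=> h; apply: (@is_derive_eq _ _ _ _ _ _ _ _ h); rewrite addr0 mulN1r mulrN1.
case=> ->; rewrite !kE.
- by rewrite oppr0 mul0r; exact: is_derive_cst.
- by rewrite mulN1r; exact: is_derive_cos.
- have h := is_deriveM_fun (is_deriveD_fun (e t) eN) (is_derive_cst (2^-1 : R) t 1).
  apply: (@is_derive_eq _ _ _ _ _ _ _ _ h).
  by rewrite /cst mulr0 addr0 ?mulN1r ?opprK ?mul1r.
Qed.

Lemma is_derive_ksin (R : realType) (kappa t : R) : curvature kappa ->
  is_derive t 1 (ksin kappa) (kcos kappa t).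
Proof.
have e (s : R) : is_derive s 1 expR (expR s) by exact: is_derive_expR.
have eN : is_derive t 1 (fun s : R => - expR (- s)) (expR (- t)).
  have := is_deriveN (is_derive1_fun_affine (a := -1) (b := 0) (e (-1 * t + 0))).
  move=> h; have : is_derive t 1 (fun s : R => - expR (-1 * s + 0)) (- (expR (-1 * t + 0) * -1)).
    exact: h.
  under eq_fun do rewrite addr0 mulN1r.
  by move=> {}h; apply: (@is_derive_eq _ _ _ _ _ _ _ _ h); rewrite addr0 mulN1r mulrN1 opprK.
case=> ->; rewrite !kE.
- exact: is_derive_id.
- exact: is_derive_sin.
- have h := is_deriveM_fun (is_deriveD_fun (e t) eN) (is_derive_cst (2^-1 : R) t 1).
  apply: (@is_derive_eq _ _ _ _ _ _ _ _ h).
  by rewrite /cst mulr0 addr0 ?mulN1r ?opprK ?mul1r.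
Qed.

Lemma kcos2Dksin2 (R : realType) (kappa t : R) : curvature kappa ->
  kcos kappa t ^+ 2 + kappa * ksin kappa t ^+ 2 = 1.
Proof.
case=> ->; rewrite !kE; first by ring.
- by rewrite mul1r cos2Dsin2.
- have : expR t * expR (- t) = 1 by rewrite -expRD subrr expR0.
  by move=> h; apply: etrans h; field.
Qed.

Lemma kcosD (R : realType) (kappa s t : R) : curvature kappa ->
  kcos kappa (s + t) =
    kcos kappa s * kcos kappa t - kappa * (ksin kappa s * ksin kappa t).
Proof.
case=> ->; rewrite !kE; first by ring.
- by rewrite cosD mul1r.
- by rewrite opprD !expRD; field.
Qed.

Lemma ksinD (R : realType) (kappa s t : R) : curvature kappa ->
  ksin kappa (s + t) = ksin kappa s * kcos kappa t + kcos kappa s * ksin kappa t.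
Proof.
case=> ->; rewrite !kE; first by ring.
- by rewrite sinD.
- by rewrite opprD !expRD; field.
Qed.

Lemma kcosN (R : realType) (kappa t : R) : curvature kappa -> kcos kappa (- t) = kcos kappa t.
Proof. by case=> ->; rewrite !kE ?cosN// opprK addrC. Qed.

Lemma ksinN (R : realType) (kappa t : R) : curvature kappa -> ksin kappa (- t) = - ksin kappa t.
Proof. by case=> ->; rewrite !kE ?sinN// opprK -mulNr opprB. Qed.

Lemma kcos_gt0 (R : realType) (kappa t : R) : curvature kappa -> kappa != 1 -> 0 < kcos kappa t.
Proof.
case=> ->; rewrite ?eqxx// => _; rewrite !kE ?ltr01//.
by rewrite divr_gt0// addr_gt0// expR_gt0.
Qed.

(** The hypothesis on c selects the line c = 1 or one branch of the hyperbola. On the circle the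
    sign of s decides between [acos c] and its opposite; on the hyperbola (c + s)(c - s) = 1 gives a
    = ln (c + s). *)
Lemma kcs_surj (R : realType) (kappa c s : R) : curvature kappa ->
  c ^+ 2 + kappa * s ^+ 2 = 1 -> (kappa != 1 -> 0 < c) ->
  exists a, kcos kappa a = c /\ ksin kappa a = s.
Proof.
case=> ->; rewrite !kE ?eqxx ?oner_eq0 ?curvatureN1.
- rewrite mul0r addr0 => c1; rewrite eq_sym oner_eq0 => /(_ isT) c0.
  exists s; split=> //; apply/eqP; rewrite eq_sym -subr_eq0.
  have /eqP : (c - 1) * (c + 1) = 0 by rewrite -subr_sqr c1; ring.
  by rewrite mulf_eq0 => /orP[//|/eqP h]; exfalso; lra.
- rewrite mul1r => cs _.
  have c1 : -1 <= c <= 1.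
    by have := sqr_ge0 s; nra.
  have sE : Num.sqrt (1 - c ^+ 2) = `|s| by rewrite -cs addrC addKr sqrtr_sqr.
  have [s0|s0] := leP 0 s.
    exists (acos c); rewrite sin_acos// acosK ?in_itv//= sE ger0_norm//.
  exists (- acos c); rewrite cosN sinN sin_acos// acosK ?in_itv//= sE ltr0_norm// opprK//.
- move=> cs /(_ isT) c0; exists (ln (c + s)).
  have cs1 : (c + s) * (c - s) = 1 by rewrite -cs; ring.
  have cs0 : 0 < c + s by nra.
  have -> : expR (- ln (c + s)) = c - s.
    by rewrite expRN lnK ?posrE//; apply: (mulfI (lt0r_neq0 cs0)); rewrite cs1 divff// gt_eqF.
  by rewrite lnK ?posrE//; split; field.
Qed.

Lemma smooth_kcs (R : realType) (kappa : R) : curvature kappa ->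
  smooth (kcos kappa) /\ smooth (ksin kappa).
Proof.
move=> hk.
pose P : set (R -> R) := [set f | exists a b, f = fun t => a * kcos kappa t + b * ksin kappa t].
have hP f : P f -> smooth f.
  apply: smooth_family f => f [a [b ->]].
  exists (fun t => b * kcos kappa t + (- kappa * a) * ksin kappa t).
    by exists b, (- kappa * a).
  move=> t; have h := is_deriveD_fun (is_deriveM_fun (is_derive_cst a t 1) (is_derive_kcos t hk))
    (is_deriveM_fun (is_derive_cst b t 1) (is_derive_ksin t hk)).
  by apply: (@is_derive_eq _ _ _ _ _ _ _ _ h); rewrite /cst; ring.
split; apply: hP.
  by exists 1, 0; apply/funext => t; ring.
by exists 0, 1; apply/funext => t; ring.
Qed.

Lemma curvature1 (R : realType) : curvature (1 : R).
Proof. by apply: Or32. Qed.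

Lemma smooth_cos (R : realType) : smooth (@cos R).
Proof. by rewrite -kcos1E; case: (smooth_kcs (@curvature1 R)). Qed.

Lemma smooth_sin (R : realType) : smooth (@sin R).
Proof. by rewrite -ksin1E; case: (smooth_kcs (@curvature1 R)). Qed.

(** * Isometries of the space forms *)

Lemma I4P (i : 'I_4) : [\/ i = 0, i = 1, i = 2 | i = 3].
Proof.
by case: i => -[|[|[|[|//]]]] hi; [apply: Or41|apply: Or42|apply: Or43|apply: Or44]; apply: val_inj.
Qed.

Lemma sum4 (V : nmodType) (f : 'I_4 -> V) : \sum_(i < 4) f i = f 0 + f 1 + f 2 + f 3.
Proof.
rewrite !big_ord_recl big_ord0 addr0 !addrA.
by congr (_ + _ + _ + _); congr f; apply: val_inj.
Qed.

Lemma sum4_neq0 (V : nmodType) (f : 'I_4 -> V) : \sum_(i < 4 | i != 0) f i = f 1 + f 2 + f 3.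
Proof. by rewrite big_mkcond sum4 /= add0r. Qed.

Lemma ord4E : ((0 : 'I_4) = 0%N :> nat) * ((1 : 'I_4) = 1%N :> nat) *
  ((2 : 'I_4) = 2%N :> nat) * ((3 : 'I_4) = 3%N :> nat).
Proof. by []. Qed.

Definition col4 (R : realType) (a b c d : R) : 'cV[R]_4 :=
  \col_(i < 4) nth 0 [:: a; b; c; d] i.

Definition mx4 (R : realType) (a00 a01 a02 a03 a10 a11 a12 a13 a20 a21 a22 a23 a30 a31 a32 a33 : R)
    : 'M[R]_4 :=
  \matrix_(i < 4, j < 4) nth 0 (nth [::] [:: [:: a00; a01; a02; a03];
    [:: a10; a11; a12; a13];
    [:: a20; a21; a22; a23];
    [:: a30; a31; a32; a33]] i) j.

Lemma colP4 (R : realType) (u v : 'cV[R]_4) : u 0 0 = v 0 0 -> u 1 0 = v 1 0 ->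
  u 2 0 = v 2 0 -> u 3 0 = v 3 0 -> u = v.
Proof. by move=> *; apply/colP => i; case: (I4P i) => ->. Qed.

Lemma mx4P (R : realType) (M N : 'M[R]_4) :
  (forall j, [/\ M 0 j = N 0 j, M 1 j = N 1 j, M 2 j = N 2 j & M 3 j = N 3 j]) -> M = N.
Proof. by move=> h; apply/matrixP => i j; case: (h j) => *; case: (I4P i) => ->. Qed.

Ltac mx4tac := let j := fresh "j" in apply: mx4P => j; case: (I4P j) => ->; split;
  rewrite !(mxE, sum4, ord4E) /=.

Lemma mx4_mul (R : realType)
    (a00 a01 a02 a03 a10 a11 a12 a13 a20 a21 a22 a23 a30 a31 a32 a33
     b00 b01 b02 b03 b10 b11 b12 b13 b20 b21 b22 b23 b30 b31 b32 b33 : R) :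
  mx4 a00 a01 a02 a03 a10 a11 a12 a13 a20 a21 a22 a23 a30 a31 a32 a33 *m
  mx4 b00 b01 b02 b03 b10 b11 b12 b13 b20 b21 b22 b23 b30 b31 b32 b33 =
  mx4
      (a00 * b00 + a01 * b10 + a02 * b20 + a03 * b30) (a00 * b01 + a01 * b11 + a02 * b21 + a03 * b31)
      (a00 * b02 + a01 * b12 + a02 * b22 + a03 * b32) (a00 * b03 + a01 * b13 + a02 * b23 + a03 * b33)
      (a10 * b00 + a11 * b10 + a12 * b20 + a13 * b30) (a10 * b01 + a11 * b11 + a12 * b21 + a13 * b31)
      (a10 * b02 + a11 * b12 + a12 * b22 + a13 * b32) (a10 * b03 + a11 * b13 + a12 * b23 + a13 * b33)
      (a20 * b00 + a21 * b10 + a22 * b20 + a23 * b30) (a20 * b01 + a21 * b11 + a22 * b21 + a23 * b31)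
      (a20 * b02 + a21 * b12 + a22 * b22 + a23 * b32) (a20 * b03 + a21 * b13 + a22 * b23 + a23 * b33)
      (a30 * b00 + a31 * b10 + a32 * b20 + a33 * b30) (a30 * b01 + a31 * b11 + a32 * b21 + a33 * b31)
      (a30 * b02 + a31 * b12 + a32 * b22 + a33 * b32) (a30 * b03 + a31 * b13 + a32 * b23 + a33 * b33).
Proof. by mx4tac. Qed.

Lemma mx4_tr (R : realType) (a00 a01 a02 a03 a10 a11 a12 a13 a20 a21 a22 a23 a30 a31 a32 a33 : R) :
  (mx4 a00 a01 a02 a03 a10 a11 a12 a13 a20 a21 a22 a23 a30 a31 a32 a33)^T =
  mx4 a00 a10 a20 a30 a01 a11 a21 a31 a02 a12 a22 a32 a03 a13 a23 a33.
Proof. by mx4tac. Qed.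

Lemma mx4_1 (R : realType) : 1%:M = mx4 1 0 0 0 0 1 0 0 0 0 1 0 0 0 0 1 :> 'M[R]_4.
Proof. by mx4tac. Qed.

Definition Lmx (R : realType) (kappa : R) : 'M[R]_4 :=
  mx4 1 0 0 0 0 kappa 0 0 0 0 kappa 0 0 0 0 kappa.
Definition Qmx (R : realType) (kappa : R) : 'M[R]_4 :=
  mx4 kappa 0 0 0 0 1 0 0 0 0 1 0 0 0 0 1.

Ltac mx4calc := rewrite ?mx4_1 ?mx4_tr ?mx4_mul ?mx4_tr ?mx4_mul; congr mx4; ring.

Lemma level_formE (R : realType) (kappa : R) x y : level_form kappa x y =
  x 0 0 * y 0 0 + kappa * (x 1 0 * y 1 0 + x 2 0 * y 2 0 + x 3 0 * y 3 0).
Proof. by rewrite /level_form sum4_neq0. Qed.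

Lemma metricE (R : realType) (kappa : R) x y : metric kappa x y =
  kappa * (x 0 0 * y 0 0) + (x 1 0 * y 1 0 + x 2 0 * y 2 0 + x 3 0 * y 3 0).
Proof. by rewrite /metric sum4_neq0. Qed.

Lemma level_form_mx (R : realType) (kappa : R) x y :
  level_form kappa x y = (x^T *m Lmx kappa *m y) 0 0.
Proof. by rewrite level_formE !(mxE, sum4, ord4E) /=; ring. Qed.

Lemma metric_mx (R : realType) (kappa : R) x y :
  metric kappa x y = (x^T *m Qmx kappa *m y) 0 0.
Proof. by rewrite metricE !(mxE, sum4, ord4E) /=; ring. Qed.

(* For kappa = 0 both forms are degenerate: the first condition makes the linear part
   orthogonal, the other two make the first row (1, 0, 0, 0). *)
Definition isoG (R : realType) (kappa : R) (g : 'M[R]_4) : Prop :=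
  [/\ g *m Qmx kappa *m g^T = Qmx kappa, g^T *m Lmx kappa *m g = Lmx kappa
    & kappa != 1 -> 0 < g 0 0].

Lemma isoG1 (R : realType) (kappa : R) : isoG kappa 1%:M.
Proof. by split; rewrite ?trmx1 ?mulmx1 ?mul1mx// mxE. Qed.

Lemma QmxQ (R : realType) (kappa : R) : kappa ^+ 2 = 1 -> Qmx kappa *m Qmx kappa = 1%:M.
Proof. by rewrite expr2 => k2; rewrite /Qmx mx4_1 mx4_mul k2; congr mx4; ring. Qed.

Lemma cauchy3 (R : realType) (a b c x y z : R) :
  (a * x + b * y + c * z) ^+ 2 <= (a ^+ 2 + b ^+ 2 + c ^+ 2) * (x ^+ 2 + y ^+ 2 + z ^+ 2).
Proof.
rewrite -subr_ge0.
suff -> : (a ^+ 2 + b ^+ 2 + c ^+ 2) * (x ^+ 2 + y ^+ 2 + z ^+ 2) -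
  (a * x + b * y + c * z) ^+ 2 = (a * y - b * x) ^+ 2 + (a * z - c * x) ^+ 2 + (b * z - c * y) ^+ 2.
  by rewrite !addr_ge0// sqr_ge0.
by ring.
Qed.

(** Reversed Cauchy-Schwarz inequality for future-pointing timelike vectors: the square of the
    spatial product is at most A B < (1 + A)(1 + B) = (a b)^2. The signs are all plus because a row
    of a Lorentz matrix is paired with a column by the matrix product. *)
Lemma timelike_pos (R : realType) (a a1 a2 a3 b b1 b2 b3 : R) :
  a ^+ 2 = 1 + (a1 ^+ 2 + a2 ^+ 2 + a3 ^+ 2) -> 0 < a ->
  b ^+ 2 = 1 + (b1 ^+ 2 + b2 ^+ 2 + b3 ^+ 2) -> 0 < b ->
  0 < a * b + a1 * b1 + a2 * b2 + a3 * b3.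
Proof.
move=> ha a0 hb b0; rewrite -!addrA (addrA (a1 * _)); have := cauchy3 a1 a2 a3 b1 b2 b3.
set A := _ + a3 ^+ 2 in ha *; set B := _ + b3 ^+ 2 in hb *; set c := _ + a3 * b3 => h.
have A0 : 0 <= A by rewrite !addr_ge0// sqr_ge0.
have B0 : 0 <= B by rewrite !addr_ge0// sqr_ge0.
have ab : 0 < a * b by rewrite mulr_gt0.
have h2 : c ^+ 2 < (a * b) ^+ 2 by apply: le_lt_trans h _; rewrite exprMn ha hb; clearbody A B; nra.
have [c0|c0] := leP 0 c; first by lra.
have : - c < a * b by rewrite -(@ltr_pXn2r _ 2)// ?nnegrE ?sqrrN//; lra.
by lra.
Qed.

(** The first row of [g] decides the sign of the first coordinate of [g *m p]. Entry (0, 0) of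
    [g *m Qmx kappa *m g^T] makes this row timelike when kappa = -1 and kills its last three entries
    when kappa = 0. *)
Lemma isoG_row0 (R : realType) (kappa : R) g : curvature kappa -> isoG kappa g -> kappa != 1 ->
  g 0 0 ^+ 2 = 1 - kappa * (g 0 1 ^+ 2 + g 0 2 ^+ 2 + g 0 3 ^+ 2) /\
  (kappa = 0 -> [/\ g 0 0 = 1, g 0 1 = 0, g 0 2 = 0 & g 0 3 = 0]).
Proof.
move=> hk [gQ gL /[swap] k1 /(_ k1) g0].
have e1 := congr1 (fun M : 'M[R]_4 => M 0 0) gQ.
have e2 := congr1 (fun M : 'M[R]_4 => M 0 0) gL.
move: e1 e2; rewrite !(mxE, sum4, ord4E) /= => e1 e2.
case: hk k1 e1 e2 => -> k1 e1 e2; first last.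
- by split; [lra|move=> /eqP; rewrite curvatureN1].
- by rewrite eqxx in k1.
have s1 := sqr_ge0 (g 0 1); have s2 := sqr_ge0 (g 0 2); have s3 := sqr_ge0 (g 0 3).
have z1 : g 0 1 = 0 by apply/eqP; rewrite -sqrf_eq0; apply/eqP; lra.
have z2 : g 0 2 = 0 by apply/eqP; rewrite -sqrf_eq0; apply/eqP; lra.
have z3 : g 0 3 = 0 by apply/eqP; rewrite -sqrf_eq0; apply/eqP; lra.
have z0 : g 0 0 = 1 by nra.
by split => // ; rewrite z0; ring.
Qed.

Lemma isoG_space_form (R : realType) (kappa : R) g p : curvature kappa -> isoG kappa g ->
  space_form kappa p -> space_form kappa (g *m p).
Proof.
move=> hk hg [p1 p0]; split.
  have [_ gL _] := hg; rewrite level_form_mx trmx_mul.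
  by rewrite -!mulmxA (mulmxA (Lmx _)) (mulmxA g^T) (mulmxA g^T) gL mulmxA -level_form_mx.
move=> k1; move: (k1) => /p0 {}p0; have := isoG_row0 hk hg k1.
have [_ _ /(_ k1) g0] := hg.
move: p1; rewrite level_formE mxE sum4.
case: hk k1 => -> k1; first last.
- by move=> p1 [h _]; apply: timelike_pos => //; lra.
- by rewrite eqxx in k1.
by move=> p1 [_ /(_ erefl) [-> -> -> ->]]; nra.
Qed.

Lemma isoGM (R : realType) (kappa : R) g h : curvature kappa ->
  isoG kappa g -> isoG kappa h -> isoG kappa (g *m h).
Proof.
move=> hk hg hh; have [gQ gL g0] := hg; have [hQ hL h0] := hh; split.
- by rewrite trmx_mul !mulmxA -2!(mulmxA g) hQ gQ.
- by rewrite trmx_mul !mulmxA -2!(mulmxA h^T) gL hL.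
move=> k1; have := isoG_row0 hk hg k1.
have e : kappa = -1 -> h 0 0 ^+ 2 = 1 + (h 1 0 ^+ 2 + h 2 0 ^+ 2 + h 3 0 ^+ 2).
  move=> kE; have := congr1 (fun M : 'M[R]_4 => M 0 0) hL.
  by rewrite !(mxE, sum4, ord4E) /= kE; lra.
rewrite mxE sum4; case: hk k1 e {hg hh gQ gL hQ hL} g0 h0 => -> k1 e g0 h0; first last.
- move=> [hh _]; apply: timelike_pos; rewrite ?e ?hh ?g0 ?h0//; ring.
- by rewrite eqxx in k1.
by move=> [_ /(_ erefl) [-> -> -> ->]]; have := h0 k1; lra.
Qed.

Lemma isoG_inv (R : realType) (kappa : R) g : curvature kappa -> isoG kappa g ->
  g \in unitmx /\ isoG kappa (invmx g).
Proof.
move=> hk hg; have [gQ gL g0] := hg.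
have [h gh hh0] : exists2 h, g *m h = 1%:M & kappa != 1 -> 0 < h 0 0.
  have [k2|k0] : kappa ^+ 2 = 1 \/ kappa = 0.
    by case: hk => ->; [right|left; ring|left; ring].
    exists (Qmx kappa *m g^T *m Qmx kappa); first by rewrite !mulmxA gQ QmxQ.
    move=> /g0 {}g0; rewrite !(mxE, sum4, ord4E) /=; nra.
  have k1 : kappa != 1 by rewrite k0 eq_sym oner_neq0.
  have [_ /(_ k0) [z0 z1 z2 z3]] := isoG_row0 hk hg k1.
  (* Affine case: [E] projects on the coordinate x_0. If [g] has linear part O and translation part
     a, then [h] is the affine map with linear part O^T and translation part - O^T a. *)
  pose E : 'M[R]_4 := mx4 1 0 0 0 0 0 0 0 0 0 0 0 0 0 0 0.
  have EL : E = 1%:M - Qmx kappa by mx4tac; rewrite ?k0 /=; ring.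
  pose h := E + Qmx kappa *m g^T *m Qmx kappa - Qmx kappa *m g^T *m Qmx kappa *m g *m E.
  have gE : E *m g *m E = E.
    have -> : E *m g = E by mx4tac; rewrite ?z0 ?z1 ?z2 ?z3 /=; ring.
    by rewrite /E; mx4calc.
  have gh : g *m h = 1%:M.
    rewrite /h mulmxBr mulmxDr !mulmxA gQ.
    have -> : Qmx kappa *m Qmx kappa = Qmx kappa by rewrite /Qmx k0; mx4calc.
    have -> : Qmx kappa = 1%:M - E by rewrite EL opprB addrC subrK.
    by rewrite !mulmxBl mul1mx gE opprB addrAC (addrC (g *m E)) subrK addrC subrK.
  clearbody h; exists h => // _; have := congr1 (fun M : 'M[R]_4 => M 0 0) gh.
  by rewrite mxE sum4 z0 z1 z2 z3 mxE /= mul1r !mul0r !addr0 => ->.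
have hg1 : h *m g = 1%:M by exact: mulmx1C.
have ug : g \in unitmx by case/mulmx1_unit: gh.
have -> : invmx g = h by rewrite -[LHS]mulmx1 -gh mulmxA mulVmx// mul1mx.
split=> //; split=> //.
  by rewrite -[X in h *m X]gQ !mulmxA hg1 mul1mx -mulmxA -trmx_mul hg1 trmx1 mulmx1.
rewrite -[X in _ *m X *m _]gL !mulmxA -trmx_mul gh trmx1 mul1mx.
by rewrite -mulmxA gh mulmx1.
Qed.

Lemma isoG_level (R : realType) (kappa : R) g x y : isoG kappa g ->
  level_form kappa (g *m x) (g *m y) = level_form kappa x y.
Proof.
move=> [_ gL _]; rewrite !level_form_mx trmx_mul.
by rewrite -!mulmxA (mulmxA (Lmx _)) (mulmxA g^T) (mulmxA g^T) gL mulmxA.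
Qed.

Lemma metric_level (R : realType) (kappa : R) x y : kappa ^+ 2 = 1 ->
  metric kappa x y = kappa * level_form kappa x y.
Proof. by rewrite metricE level_formE => k2; ring: k2. Qed.

Lemma tangent0 (R : realType) (p u : 'cV[R]_4) : space_form 0 p -> tangent 0 p u ->
  p 0 0 = 1 /\ u 0 0 = 0.
Proof.
rewrite /space_form/tangent /= !level_formE !mul0r !addr0 => -[p1 p0] pu.
have {}p0 : 0 < p 0 0 by apply: p0; rewrite eq_sym oner_neq0.
have p1' : p 0 0 = 1 by nra.
by split => //; rewrite p1' mul1r in pu.
Qed.

Lemma curvature_sqr (R : realType) (kappa : R) : curvature kappa -> kappa = 0 \/ kappa ^+ 2 = 1.
Proof. by case=> ->; [left|right; ring|right; ring]. Qed.

Lemma isoG_metric (R : realType) (kappa : R) g p u v : curvature kappa -> isoG kappa g ->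
  space_form kappa p -> tangent kappa p u -> tangent kappa p v ->
  metric kappa (g *m u) (g *m v) = metric kappa u v.
Proof.
move=> hk hg Mp Tu Tv; have [k0|k2] := curvature_sqr hk; last first.
  by rewrite !metric_level// isoG_level.
have k1 : kappa != 1 by rewrite k0 eq_sym oner_neq0.
have [ug [hQ hL h0]] := isoG_inv hk hg; have [gQ gL g0] := hg.
have QE (w : 'cV[R]_4) : w 0 0 = 0 -> Qmx kappa *m w = w :> 'cV[R]_4.
  by move=> w0; apply: colP4; rewrite !(mxE, sum4, ord4E) /= w0 ?k0; ring.
move: Mp Tu Tv; rewrite k0 => Mp Tu Tv; rewrite -k0.
have [_ u0] := tangent0 Mp Tu; have [_ v0] := tangent0 Mp Tv.
have [_ /(_ k0) [z0 z1 z2 z3]] := isoG_row0 hk hg k1.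
have gw0 (w : 'cV[R]_4) : w 0 0 = 0 -> (g *m w : 'cV[R]_4) 0 0 = 0.
  by move=> w0; rewrite mxE sum4 z1 z2 z3 w0; ring.
have Qg : Qmx kappa *m g^T = invmx g *m Qmx kappa.
  by rewrite -[in RHS]gQ -!mulmxA mulKmx.
rewrite !metric_mx -!mulmxA !QE ?gw0//.
rewrite -{1}(QE u)// !trmx_mul.
have -> : (Qmx kappa)^T = Qmx kappa by rewrite /Qmx mx4_tr.
by rewrite -!mulmxA (mulmxA (Qmx _)) Qg -mulmxA QE ?gw0// mulKmx.
Qed.

Lemma isoG_isometries (R : realType) (kappa : R) g : curvature kappa -> isoG kappa g ->
  isometries kappa g.
Proof.
move=> hk hg; have [ug hh] := isoG_inv hk hg; split; last first.
  by move=> p u v Mp Tu Tv; exact: isoG_metric Mp Tu Tv.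
apply/seteqP; split=> [_ [x Mx <-]|x Mx]; first exact: isoG_space_form.
by exists (invmx g *m x); [exact: isoG_space_form|rewrite mulKVmx].
Qed.

Lemma isoG_tangent (R : realType) (kappa : R) g p u : isoG kappa g ->
  tangent kappa p u -> tangent kappa (g *m p) (g *m u).
Proof. by rewrite /tangent /= => hg; rewrite isoG_level. Qed.

(** * Geodesics *)

Lemma level_formDl (R : realType) (k : R) x y z :
  level_form k (x + y) z = level_form k x z + level_form k y z.
Proof. by rewrite !level_formE !mxE; ring. Qed.
Lemma level_formZl (R : realType) (k a : R) x y :
  level_form k (a *: x) y = a * level_form k x y.
Proof. by rewrite !level_formE !mxE; ring. Qed.
Lemma level_formC (R : realType) (k : R) x y : level_form k x y = level_form k y x.
Proof. by rewrite !level_formE; ring. Qed.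
Lemma level_formDr (R : realType) (k : R) x y z :
  level_form k z (x + y) = level_form k z x + level_form k z y.
Proof. by rewrite ![level_form k z _]level_formC level_formDl. Qed.
Lemma level_formZr (R : realType) (k a : R) x y :
  level_form k y (a *: x) = a * level_form k y x.
Proof. by rewrite ![level_form k y _]level_formC level_formZl. Qed.
Definition levelE := (level_formDl, level_formZl, level_formDr, level_formZr).

Lemma metricDl (R : realType) (k : R) x y z :
  metric k (x + y) z = metric k x z + metric k y z.
Proof. by rewrite !metricE !mxE; ring. Qed.
Lemma metricZl (R : realType) (k a : R) x y :
  metric k (a *: x) y = a * metric k x y.
Proof. by rewrite !metricE !mxE; ring. Qed.
Lemma metricC (R : realType) (k : R) x y : metric k x y = metric k y x.
Proof. by rewrite !metricE; ring. Qed.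
Lemma metricDr (R : realType) (k : R) x y z :
  metric k z (x + y) = metric k z x + metric k z y.
Proof. by rewrite ![metric k z _]metricC metricDl. Qed.
Lemma metricZr (R : realType) (k a : R) x y :
  metric k y (a *: x) = a * metric k y x.
Proof. by rewrite ![metric k y _]metricC metricZl. Qed.
Definition metE := (metricDl, metricZl, metricDr, metricZr).

Definition unit_tangent (R : realType) (kappa : R) p v :=
  [/\ space_form kappa p, tangent kappa p v & metric kappa v v = 1].

Lemma space_form_hyp (R : realType) (p : 'cV[R]_4) : space_form (-1) p ->
  p 0 0 ^+ 2 = 1 + (p 1 0 ^+ 2 + p 2 0 ^+ 2 + p 3 0 ^+ 2) /\ 0 < p 0 0.
Proof.
rewrite /space_form /= level_formE => -[p1 p0]; split; first by lra.
by apply: p0; rewrite curvatureN1.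
Qed.

(** Tangency says that p_0 w_0 is the product of the spatial parts, so Cauchy-Schwarz gives (1 + P)
    w_0^2 <= P W, whence both claims. The first one keeps geodesics on the upper sheet. *)
Lemma tangent_hyp (R : realType) (p w : 'cV[R]_4) : space_form (-1) p -> tangent (-1) p w ->
  w 0 0 ^+ 2 <= metric (-1) w w * (p 0 0 ^+ 2 - 1) /\ 0 <= metric (-1) w w.
Proof.
move=> /space_form_hyp [p2 p0]; rewrite /tangent /= level_formE metricE => Tw.
have := cauchy3 (p 1 0) (p 2 0) (p 3 0) (w 1 0) (w 2 0) (w 3 0).
have -> : p 1 0 * w 1 0 + p 2 0 * w 2 0 + p 3 0 * w 3 0 = p 0 0 * w 0 0 by lra.
set P := _ + p 3 0 ^+ 2 in p2 *; set W := _ + w 3 0 ^+ 2.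
have P0 : 0 <= P by rewrite !addr_ge0// sqr_ge0.
have W0 : 0 <= W by rewrite !addr_ge0// sqr_ge0.
clearbody P W; rewrite exprMn p2 => h; split; first by lra.
have h2 : (1 + P) * (w 0 0 ^+ 2) <= (1 + P) * W by nra.
by rewrite ler_pM2l in h2; lra.
Qed.

Lemma tangent_definite (R : realType) (kappa : R) p w : curvature kappa ->
  space_form kappa p -> tangent kappa p w ->
  0 <= metric kappa w w /\ (metric kappa w w = 0 -> w = 0).
Proof.
move=> hk Mp Tw.
suff [h0 h] : 0 <= metric kappa w w /\ (metric kappa w w = 0 -> w 0 0 = 0).
  split=> // w0; have {}h := h w0; move: w0; rewrite metricE h mulr0 mulr0 add0r => w0.
  have s1 := sqr_ge0 (w 1 0); have s2 := sqr_ge0 (w 2 0); have s3 := sqr_ge0 (w 3 0).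
  by apply: colP4; rewrite mxE //; apply/eqP; rewrite -sqrf_eq0; apply/eqP; lra.
case: hk Mp Tw => -> Mp Tw.
- have [_ w0] := tangent0 Mp Tw; rewrite metricE w0 mul0r add0r.
  by split=> //; rewrite !addr_ge0// -expr2 sqr_ge0.
- have s0 := sqr_ge0 (w 0 0).
  have s1 := sqr_ge0 (w 1 0); have s2 := sqr_ge0 (w 2 0); have s3 := sqr_ge0 (w 3 0).
  rewrite metricE; split; first by lra.
  by move=> h; apply/eqP; rewrite -sqrf_eq0; apply/eqP; lra.
- have [h h0] := tangent_hyp Mp Tw; split=> // w0; rewrite w0 mul0r in h.
  by apply/eqP; rewrite -sqrf_eq0; apply/eqP; have := sqr_ge0 (w 0 0); lra.
Qed.

Lemma tangent_ortho0 (R : realType) (kappa : R) p w : curvature kappa ->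
  space_form kappa p -> tangent kappa p w ->
  (forall u, tangent kappa p u -> metric kappa w u = 0) -> w = 0.
Proof. by move=> hk Mp Tw h; have [_] := tangent_definite hk Mp Tw; apply; exact: h. Qed.

Lemma level_tangent (R : realType) (kappa : R) p u v : curvature kappa ->
  space_form kappa p -> tangent kappa p u -> tangent kappa p v ->
  level_form kappa u v = kappa * metric kappa u v.
Proof.
move=> hk Mp Tu Tv; have [k0|k2] := curvature_sqr hk; last first.
  by rewrite metric_level// mulrA -expr2 k2 mul1r.
move: Mp Tu Tv; rewrite k0 => Mp Tu Tv.
have [_ u0] := tangent0 Mp Tu.
by rewrite level_formE u0; ring.
Qed.

Lemma kmetric_level (R : realType) (kappa : R) u v : curvature kappa ->
  kappa * metric kappa u v = kappa ^+ 2 * level_form kappa u v.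
Proof.
move=> hk; have [->|k2] := curvature_sqr hk; first by rewrite expr2 !mul0r.
by rewrite metric_level// mulrA.
Qed.

(** Position and velocity on the geodesic of (p, v) at the parameter with kcos = c and ksin = s. On
    the hyperboloid the first coordinate stays positive because (s v_0)^2 <= s^2 (p_0^2 - 1) < c^2
    p_0^2. *)
Lemma space_form_comb (R : realType) (kappa c s : R) p v : curvature kappa ->
  unit_tangent kappa p v -> c ^+ 2 + kappa * s ^+ 2 = 1 -> (kappa != 1 -> 0 < c) ->
  unit_tangent kappa (c *: p + s *: v) (- (kappa * s) *: p + c *: v).
Proof.
move=> hk [Mp Tv v1] cs c0; have lv := level_tangent hk Mp Tv Tv.
have [lp _] := Mp; rewrite /tangent /= in Tv.
have Tv' : level_form kappa v p = 0 by rewrite level_formC.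
split; first split.
- by rewrite !levelE lp lv Tv Tv' v1; lra.
- move=> k1; have {}c0 := c0 k1; rewrite !mxE.
  case: hk k1 cs Mp Tv v1 {lv lp Tv'} => -> k1 cs Mp Tv v1; first last.
  + have [p2 p0] := space_form_hyp Mp; have [h _] := tangent_hyp Mp Tv.
    rewrite v1 mul1r in h.
    have sv : (s * v 0 0) ^+ 2 < (c * p 0 0) ^+ 2.
      have e1 : c ^+ 2 = 1 + s ^+ 2 by lra.
      rewrite !exprMn e1; have := sqr_ge0 s; set S := s ^+ 2; set V := v 0 0 ^+ 2 in h *.
      have : 0 <= V by exact: sqr_ge0.
      by set P := p 0 0 ^+ 2 in p2 h *; clearbody S V P; nra.
    have cp : 0 < c * p 0 0 by rewrite mulr_gt0.
    have [?|?] := leP 0 (s * v 0 0); first by lra.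
    suff : - (s * v 0 0) < c * p 0 0 by lra.
    by rewrite -(@ltr_pXn2r _ 2)// ?nnegrE ?sqrrN//; lra.
  + by rewrite eqxx in k1.
  + by have [-> ->] := tangent0 Mp Tv; lra.
- by rewrite /tangent /= !levelE lp lv Tv Tv' v1; ring.
- rewrite !metE v1.
  have [k0|k2] := curvature_sqr hk.
    by move: cs; rewrite k0 !mul0r oppr0 !mul0r; lra.
  rewrite !metric_level// lp Tv Tv'.
  by case: hk cs {Mp Tv v1 lv lp Tv' k2} => -> cs; lra.
Qed.

Definition geo (R : realType) (kappa : R) (p v : 'cV[R]_4) (t : R) : 'cV[R]_4 :=
  kcos kappa t *: p + ksin kappa t *: v.

Lemma is_derive_geo (R : realType) (kappa : R) p v (t : R) : curvature kappa ->
  is_derive t 1 (geo kappa p v) (geo kappa v (- kappa *: p) t).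
Proof.
move=> hk.
have h := is_deriveD_fun
  (is_derive_scalemx (is_derive_kcos t hk) (is_derive_cst p t 1))
  (is_derive_scalemx (is_derive_ksin t hk) (is_derive_cst v t 1)).
apply: (@is_derive_eq _ _ _ _ _ _ _ _ h).
rewrite /cst !scaler0 !addr0 /geo scalerA addrC; congr (_ + _ *: _).
by rewrite mulrC.
Qed.

Lemma smooth_geo (R : realType) (kappa : R) p v : curvature kappa -> smooth (geo kappa p v).
Proof.
move=> hk; pose P : set (R -> 'cV[R]_4) := [set f | exists p v, f = geo kappa p v].
apply: (@smooth_family _ _ P); last by exists p, v.
move=> _ [q [w ->]]; exists (geo kappa w (- kappa *: q)); first by exists w, (- kappa *: q).
by move=> t; exact: is_derive_geo.
Qed.

Lemma derive1_geo (R : realType) (kappa : R) p v : curvature kappa ->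
  derive1 (geo kappa p v) = geo kappa v (- kappa *: p).
Proof.
by move=> hk; apply/funext => t; apply: is_derive_derive1_eq; exact: is_derive_geo.
Qed.

Lemma geo0 (R : realType) (kappa : R) p v : curvature kappa -> geo kappa p v 0 = p.
Proof. by move=> hk; rewrite /geo kcos_0// ksin_0// scale1r scale0r addr0. Qed.

Lemma unit_tangent_geo (R : realType) (kappa t : R) p v : curvature kappa ->
  unit_tangent kappa p v ->
  unit_tangent kappa (geo kappa p v t) (geo kappa v (- kappa *: p) t).
Proof.
move=> hk hpv.
have := space_form_comb hk hpv (kcos2Dksin2 t hk) (fun k => kcos_gt0 t hk k).
by rewrite /geo scalerA addrC mulrN [ksin _ _ * kappa]mulrC [X in unit_tangent _ _ X]addrC addrC.
Qed.

Lemma unit_geodesic_geo (R : realType) (kappa : R) p v : curvature kappa ->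
  unit_tangent kappa p v -> unit_geodesic kappa (geo kappa p v).
Proof.
move=> hk hpv; have hu t := unit_tangent_geo t hk hpv.
split; [|by move=> t; have [] := hu t|by move=> t; rewrite derive1_geo//; have [] := hu t|].
  by move=> t; apply: smooth_smooth_at; exact: smooth_geo.
rewrite derive1_geo//; split.
- by move=> t; apply: smooth_smooth_at; exact: smooth_geo.
- by move=> t; have [] := hu t.
- move=> t u Tu; rewrite derive1_geo//.
  have -> : geo kappa (- kappa *: p) (- kappa *: v) t = - kappa *: geo kappa p v t.
    by rewrite /geo scalerDr !scalerA ![_ * - kappa]mulrC.
  rewrite metricZl mulNr kmetric_level//.
  by rewrite /tangent /= in Tu; rewrite Tu mulr0 oppr0.
Qed.

Lemma is_derive_form (R : realType) (A : 'M[R]_4) (x y : R -> 'cV[R]_4) dx dy (t : R) :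
  is_derive t 1 x dx -> is_derive t 1 y dy ->
  is_derive t 1 (fun t => ((x t)^T *m A *m y t) 0 0)
    ((dx^T *m A *m y t) 0 0 + ((x t)^T *m A *m dy) 0 0).
Proof.
move=> hx hy.
have h := is_derive_mulmx (is_derive_mulmx (is_derive_trmx hx) (is_derive_cst A t 1)) hy.
move/is_derive_mxP: h => /(_ 0 0) h; apply: (@is_derive_eq _ _ _ _ _ _ _ _ h).
by rewrite /cst mulmx0 addr0 mxE.
Qed.

Lemma is_derive_level (R : realType) (kappa : R) (x y : R -> 'cV[R]_4) dx dy (t : R) :
  is_derive t 1 x dx -> is_derive t 1 y dy ->
  is_derive t 1 (fun t => level_form kappa (x t) (y t))
    (level_form kappa dx (y t) + level_form kappa (x t) dy).
Proof.
move=> hx hy; have := is_derive_form (Lmx kappa) hx hy.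
by under eq_fun do rewrite -level_form_mx; rewrite -!level_form_mx.
Qed.

Lemma smooth_at_derive (R : realType) (V : normedModType R) (f : R -> V) (t : R) :
  smooth_at f t -> is_derive t 1 f (derive1 f t).
Proof. by move=> /(_ 0%N) h; exact: is_derive_derive1. Qed.

Lemma smooth_at_derive2 (R : realType) (V : normedModType R) (f : R -> V) (t : R) :
  smooth_at f t -> is_derive t 1 (derive1 f) (derive1 (derive1 f) t).
Proof. by move=> /(_ 1%N) h; exact: is_derive_derive1. Qed.

Lemma is_derive_cst_eq (R : realType) (f : R -> R) c (t d : R) :
  is_derive t 1 f d -> (forall s, f s = c) -> d = 0.
Proof.
by move=> [_ <-] /funext ->; rewrite (derive_cst c).
Qed.

(* [V' + kappa <V, gamma'> gamma] is tangent and orthogonal to the tangent space. *)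
Lemma parallel_derive (R : realType) (kappa : R) (gamma V : R -> 'cV[R]_4) (t : R) :
  curvature kappa -> unit_geodesic kappa gamma -> parallel_field kappa gamma V ->
  derive1 V t = - (kappa * metric kappa (V t) (derive1 gamma t)) *: gamma t.
Proof.
move=> hk [gs gM g1 [_ gT _]] [Vs VT Vp].
apply/eqP; rewrite -subr_eq0 scaleNr opprK; apply/eqP.
have ddV := smooth_at_derive (Vs t).
have h : level_form kappa (derive1 gamma t) (V t) + level_form kappa (gamma t) (derive1 V t) = 0.
  by apply: is_derive_cst_eq (is_derive_level kappa (smooth_at_derive (gs t)) ddV) VT.
apply: (tangent_ortho0 hk (gM t)).
  rewrite /tangent /= !levelE; have [-> _] := gM t.
  rewrite (level_tangent hk (gM t) (gT t) (VT t)) metricC in h; lra.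
move=> u Tu; rewrite metricDl Vp// metricZl add0r mulrC mulrA.
by rewrite [metric _ _ u * _]mulrC kmetric_level// /tangent /= in Tu *; rewrite Tu mulr0 mul0r.
Qed.

Lemma geodesic_derive2 (R : realType) (kappa : R) (sigma : R -> 'cV[R]_4) (t : R) :
  curvature kappa -> unit_geodesic kappa sigma ->
  derive1 (derive1 sigma) t = - kappa *: sigma t.
Proof.
move=> hk hs; have [_ _ s1 sp] := hs.
by rewrite (parallel_derive t hk hs sp) s1 mulr1.
Qed.

Lemma is_derive0_cst_mx (R : realType) m n (f : R -> 'M[R]_(m.+1, n.+1)) :
  (forall t : R, is_derive t 1 f 0) -> forall s t, f s = f t.
Proof.
move=> h s t; apply/matrixP => i j.
apply: (@is_derive_0_is_cst _ (fun x => f x i j)) => x.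
by move/is_derive_mxP: (h x) => /(_ i j); rewrite mxE.
Qed.

(** Geodesics solve the linear equation sigma'' = - kappa sigma, so their position and velocity at 0
    determine them. *)
Lemma unit_geodesicE (R : realType) (kappa : R) (sigma : R -> 'cV[R]_4) :
  curvature kappa -> unit_geodesic kappa sigma ->
  sigma = geo kappa (sigma 0) (derive1 sigma 0) /\
  unit_tangent kappa (sigma 0) (derive1 sigma 0).
Proof.
move=> hk hs; have [ss sM s1 [_ sT _]] := hs; split; last by split.
have d1 t := smooth_at_derive (ss t).
have d2 (t : R) : is_derive t 1 (derive1 sigma) (- kappa *: sigma t).
  apply: (@is_derive_eq _ _ _ _ _ _ _ _ (smooth_at_derive2 (ss t))).
  exact: geodesic_derive2.
(* Variation of constants. *)
pose a t := kcos kappa t *: sigma t + (- ksin kappa t) *: derive1 sigma t.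
pose b t := (kappa * ksin kappa t) *: sigma t + kcos kappa t *: derive1 sigma t.
have dk (t : R) : is_derive t 1 (fun t => kappa * ksin kappa t) (kappa * kcos kappa t).
  have h := is_deriveM_fun (is_derive_cst kappa t 1) (is_derive_ksin t hk).
  by apply: (@is_derive_eq _ _ _ _ _ _ _ _ h); rewrite mul0r add0r.
have da (t : R) : is_derive t 1 a 0.
  have h := is_deriveD_fun (is_derive_scalemx (is_derive_kcos t hk) (d1 t))
    (is_derive_scalemx (is_deriveN_fun (is_derive_ksin t hk)) (d2 t)).
  apply: (@is_derive_eq _ _ _ _ _ _ _ _ h).
  by apply/colP => i; rewrite !mxE; ring.
have db (t : R) : is_derive t 1 b 0.
  have h := is_deriveD_fun (is_derive_scalemx (dk t) (d1 t))
    (is_derive_scalemx (is_derive_kcos t hk) (d2 t)).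
  apply: (@is_derive_eq _ _ _ _ _ _ _ _ h).
  by apply/colP => i; rewrite !mxE; ring.
have a0 : a 0 = sigma 0 by rewrite /a kcos_0// ksin_0// oppr0 scale0r addr0 scale1r.
have b0 : b 0 = derive1 sigma 0 by rewrite /b kcos_0// ksin_0// mulr0 scale0r add0r scale1r.
apply/funext => t; rewrite /geo -a0 -b0.
rewrite (is_derive0_cst_mx da 0 t) (is_derive0_cst_mx db 0 t) /a /b.
apply/colP => i; rewrite !mxE.
have := kcos2Dksin2 t hk; set C := kcos _ _; set S := ksin _ _; move=> cs.
rewrite -[LHS]mul1r -cs; ring.
Qed.

(** * The space of oriented geodesics and Plücker coordinates *)

Definition line (R : realType) (kappa : R) p v := geod_class kappa (geo kappa p v).

Lemma geo_shift (R : realType) (kappa : R) p v t a : curvature kappa ->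
  geo kappa p v (t + a) = geo kappa (geo kappa p v a) (geo kappa v (- kappa *: p) a) t.
Proof.
move=> hk; rewrite /geo kcosD// ksinD//; apply/colP => i; rewrite !mxE; ring.
Qed.

Lemma lineP (R : realType) (kappa : R) p v tau : curvature kappa -> unit_tangent kappa p v ->
  line kappa p v tau <->
  exists a, tau = geo kappa (geo kappa p v a) (geo kappa v (- kappa *: p) a).
Proof.
move=> hk hpv; split=> [[ht [t0 e]]|[a ->]].
  exists (- t0); apply/funext => t.
  by rewrite -geo_shift// e -addrA addNr addr0.
split; first by apply: unit_geodesic_geo => //; exact: unit_tangent_geo.
by exists (- a) => t; rewrite -geo_shift// -addrA addNr addr0.
Qed.

Lemma line_geo (R : realType) (kappa : R) p v a : curvature kappa -> unit_tangent kappa p v ->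
  line kappa (geo kappa p v a) (geo kappa v (- kappa *: p) a) = line kappa p v.
Proof.
move=> hk hpv; apply/seteqP; split=> tau [ht [t0 e]]; split=> //.
  exists (t0 - a) => t; have := e (t - a).
  by rewrite -geo_shift// subrK => ->; congr tau; ring.
exists (t0 + a) => t; rewrite -geo_shift// e; congr tau; ring.
Qed.

(** Slides the base point by a point of the conic instead of a parameter: later constructions know
    the displacement only through such a pair (c, s). *)
Lemma line_comb (R : realType) (kappa c s : R) p v : curvature kappa -> unit_tangent kappa p v ->
  c ^+ 2 + kappa * s ^+ 2 = 1 -> (kappa != 1 -> 0 < c) ->
  line kappa (c *: p + s *: v) (- (kappa * s) *: p + c *: v) = line kappa p v.
Proof.
move=> hk hpv cs c0; have [a [<- <-]] := kcs_surj hk cs c0.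
rewrite -(line_geo a hk hpv) /geo scalerA; congr line.
by rewrite addrC mulrN mulrC.
Qed.

Lemma oriented_geodesicsP (R : realType) (kappa : R) l : curvature kappa ->
  oriented_geodesics kappa l <-> exists p v, unit_tangent kappa p v /\ l = line kappa p v.
Proof.
move=> hk; split=> [[sigma hs ->]|[p [v [hpv ->]]]].
  have [e h] := unit_geodesicE hk hs.
  by exists (sigma 0), (derive1 sigma 0); rewrite /line -e.
by exists (geo kappa p v) => //; exact: unit_geodesic_geo.
Qed.

Lemma mulmx_geo (R : realType) (kappa : R) (g : 'M[R]_4) p v t :
  g *m geo kappa p v t = geo kappa (g *m p) (g *m v) t.
Proof. by rewrite /geo mulmxDr -!scalemxAr. Qed.

Lemma isoG_unit_tangent (R : realType) (kappa : R) g p v : curvature kappa -> isoG kappa g ->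
  unit_tangent kappa p v -> unit_tangent kappa (g *m p) (g *m v).
Proof.
move=> hk hg [Mp Tv v1]; split; [exact: isoG_space_form|exact: isoG_tangent|].
by rewrite (isoG_metric hk hg Mp Tv Tv).
Qed.

Lemma act_line (R : realType) (kappa : R) g p v : curvature kappa -> isoG kappa g ->
  unit_tangent kappa p v -> act g (line kappa p v) = line kappa (g *m p) (g *m v).
Proof.
move=> hk hg hpv; have hgpv := isoG_unit_tangent hk hg hpv.
apply/seteqP; split=> tau.
  move=> [sigma /(lineP _ hk hpv) [a ->] <-]; apply/lineP => //; exists a.
  by apply/funext => t; rewrite !mulmx_geo -scalemxAr.
move=> /(lineP _ hk hgpv) [a ->].
exists (geo kappa (geo kappa p v a) (geo kappa v (- kappa *: p) a)).
  by apply/lineP => //; exists a.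
by apply/funext => t; rewrite !mulmx_geo -scalemxAr.
Qed.

Definition wedge (R : realType) (p v : 'cV[R]_4) : 'M[R]_4 := p *m v^T - v *m p^T.

Lemma wedge_mulmx (R : realType) (g : 'M[R]_4) (p v : 'cV[R]_4) :
  wedge (g *m p) (g *m v) = g *m wedge p v *m g^T.
Proof. by rewrite /wedge mulmxBr mulmxBl !trmx_mul !mulmxA. Qed.

Lemma wedgeE (R : realType) (p v : 'cV[R]_4) i j :
  wedge p v i j = p i 0 * v j 0 - v i 0 * p j 0.
Proof. by rewrite !mxE !big_ord1 !mxE. Qed.

(** The pair (p, v) changes by a 2 x 2 matrix of determinant kcos^2 + kappa ksin^2 = 1. *)
Lemma wedge_geo (R : realType) (kappa : R) p v a : curvature kappa ->
  wedge (geo kappa p v a) (geo kappa v (- kappa *: p) a) = wedge p v.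
Proof.
move=> hk; apply/matrixP => i j; rewrite !wedgeE !mxE.
have := kcos2Dksin2 a hk; set C := kcos _ _; set S := ksin _ _ => cs.
rewrite -[RHS]mul1r -[X in _ = X * _]cs; ring.
Qed.

(* Plücker coordinates: p ^ v does not depend on the point p chosen on the geodesic. *)
Definition plucker (R : realType) (l : set (R -> 'cV[R]_4)) : 'M[R]_4 :=
  let sigma := xget (fun=> 0) l in wedge (sigma 0) (derive1 sigma 0).

Lemma plucker_mem (R : realType) (kappa : R) l tau : curvature kappa ->
  oriented_geodesics kappa l -> l tau -> plucker l = wedge (tau 0) (derive1 tau 0).
Proof.
move=> hk /(oriented_geodesicsP _ hk) [p [v [hpv ->]]] ltau.
rewrite /plucker; case: xgetP => [sigma _|/(_ tau)]; last by case.
move: ltau => /(lineP _ hk hpv) [b ->] /(lineP _ hk hpv) [a ->].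
by rewrite !(derive1_geo _ _ hk) !(geo0 _ _ hk) (wedge_geo p v b hk) (wedge_geo p v a hk).
Qed.

Lemma line_mem (R : realType) (kappa : R) p v : curvature kappa -> unit_tangent kappa p v ->
  line kappa p v (geo kappa p v).
Proof.
move=> hk hpv; split; first exact: unit_geodesic_geo.
by exists 0 => t; rewrite addr0.
Qed.

Lemma oriented_line (R : realType) (kappa : R) p v : curvature kappa -> unit_tangent kappa p v ->
  oriented_geodesics kappa (line kappa p v).
Proof. by move=> hk hpv; apply/oriented_geodesicsP => //; exists p, v. Qed.

Lemma plucker_line (R : realType) (kappa : R) p v : curvature kappa -> unit_tangent kappa p v ->
  plucker (line kappa p v) = wedge p v.
Proof.
move=> hk hpv; rewrite (plucker_mem hk (oriented_line hk hpv) (line_mem hk hpv)).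
by rewrite derive1_geo// !geo0.
Qed.

Lemma plucker_act (R : realType) (kappa : R) (g : 'M[R]_4) l : curvature kappa ->
  oriented_geodesics kappa l -> oriented_geodesics kappa (act g l) ->
  plucker (act g l) = g *m plucker l *m g^T.
Proof.
move=> hk hl hgl; have [p [v [hpv lE]]] := (oriented_geodesicsP _ hk).1 hl.
have lm : l (geo kappa p v) by rewrite lE; exact: line_mem.
rewrite (plucker_mem hk hl lm) (derive1_geo _ _ hk) !(geo0 _ _ hk) -wedge_mulmx.
have glm : act g l (geo kappa (g *m p) (g *m v)).
  by exists (geo kappa p v) => //; apply/funext => t; rewrite mulmx_geo.
by rewrite (plucker_mem hk hgl glm) derive1_geo// !geo0.
Qed.

Lemma is_derive_sandwich (R : realType) (g : R -> 'M[R]_4) (P D : 'M[R]_4) (t : R) :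
  is_derive t 1 g D -> g t = 1%:M ->
  is_derive t 1 (fun s => g s *m P *m (g s)^T) (D *m P + P *m D^T).
Proof.
move=> hg g1.
have h := is_derive_mulmx (is_derive_mulmx hg (is_derive_cst P t 1)) (is_derive_trmx hg).
apply: (@is_derive_eq _ _ _ _ _ _ _ _ h).
by rewrite /cst g1 trmx1 mulmx0 addr0 mulmx1 mul1mx.
Qed.

Lemma is_derive_plucker (R : realType) (kappa t : R) (c : R -> set (R -> 'cV[R]_4)) g :
  curvature kappa -> (\forall s \near t, oriented_geodesics kappa (c s)) ->
  local_lift kappa c t g ->
  is_derive t 1 (fun s => plucker (c s))
    (derive1 g t *m plucker (c t) + plucker (c t) *m (derive1 g t)^T).
Proof.
move=> hk oc [g1 gs gc]; have sg := nbhs_singleton gs.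
have oct := nbhs_singleton oc.
have h := is_derive_sandwich (plucker (c t)) (smooth_at_derive sg) g1.
apply: near_eq_is_derive h; near=> s.
have [|_ cs] := near gc s => //.
rewrite cs (@plucker_act _ kappa)// -cs; by near: s.
Unshelve. all: by end_near. Qed.

(** A path in the isotropy group lifts the constant curve at [l], along which [plucker] has
    derivative zero. *)
Lemma lie_isotropy_plucker (R : realType) (kappa : R) l X : curvature kappa ->
  oriented_geodesics kappa l -> lie_algebra (isotropy kappa l) X ->
  X *m plucker l + plucker l *m X^T = 0.
Proof.
move=> hk ol [h [h1 hs hi <-]].
have lift : local_lift kappa (fun=> l) 0 h.
  by split=> //; near=> s; have [|? ?] := near hi s => //.
have o : \forall s \near (0 : R), oriented_geodesics kappa ((fun=> l) s) by near=> s.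
have d := is_derive_plucker hk o lift.
have := @derive_val _ _ _ _ _ _ _ d.
by rewrite (_ : (fun _ => _) = cst (plucker l))// derive_cst.
Unshelve. all: by end_near. Qed.

Lemma lie_algebra0 (R : realType) (kappa : R) l : curvature kappa ->
  oriented_geodesics kappa l -> lie_algebra (isotropy kappa l) 0.
Proof.
move=> hk ol; exists (fun=> 1%:M); split=> //.
- by near=> s; apply: smooth_smooth_at; exact: smooth_cst.
- near=> s; split.
    apply: connected_component_refl; apply: isoG_isometries => //; exact: isoG1.
  apply/seteqP; split=> [_ [tau lt <-]|tau lt]; first by under eq_fun do rewrite mul1mx.
  by exists tau => //; apply/funext => t; rewrite mul1mx.
- exact: derive1_cst.
Unshelve. all: by end_near. Qed.

(** Equal velocities are equal cosets: the derivatives of the two lifts differ by an element of the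
    isotropy algebra, which acts trivially on [plucker]. So a velocity determines the derivative of
    the Plücker matrix, whatever the curve and the lift. *)
Lemma velocity_plucker (R : realType) (kappa t1 t2 : R) (c1 c2 : R -> set (R -> 'cV[R]_4)) u d1 d2 :
  curvature kappa ->
  (\forall s \near t1, oriented_geodesics kappa (c1 s)) ->
  (\forall s \near t2, oriented_geodesics kappa (c2 s)) -> c1 t1 = c2 t2 ->
  velocity kappa c1 t1 u -> velocity kappa c2 t2 u ->
  is_derive t1 1 (fun s => plucker (c1 s)) d1 -> is_derive t2 1 (fun s => plucker (c2 s)) d2 ->
  d1 = d2.
Proof.
move=> hk o1 o2 cE [g1 l1 ->] [g2 l2 uE] h1 h2.
have ol := nbhs_singleton o1.
have e1 := @derive_val _ _ _ _ _ _ _ (is_derive_plucker hk o1 l1).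
have e2 := @derive_val _ _ _ _ _ _ _ (is_derive_plucker hk o2 l2).
rewrite (@derive_val _ _ _ _ _ _ _ h1) in e1; rewrite (@derive_val _ _ _ _ _ _ _ h2) in e2.
rewrite e1 e2 -cE; set P := plucker _.
have : tangent_class kappa (c2 t2) (derive1 g2 t2) (derive1 g1 t1).
  by rewrite -uE /tangent_class /= subrr; exact: lie_algebra0.
rewrite /tangent_class /= -cE => /(lie_isotropy_plucker hk ol).
rewrite -/P; clearbody P.
rewrite mulmxBl [(_ - _)^T]linearB /= mulmxBr addrACA -opprD => /eqP.
by rewrite subr_eq0 => /eqP.
Qed.

(** * Determinants and the Hodge star in dimension four *)

Lemma det2_fun (R : comNzRingType) (m : nat -> nat -> R) :
  \det (\matrix_(i < 2, j < 2) m i j) = m 0 0 * m 1 1 - m 0 1 * m 1 0.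
Proof.
rewrite (expand_det_row _ ord0) !big_ord_recl big_ord0 /cofactor !det_mx11 !mxE /= /bump /=; ring.
Qed.

Lemma det3_fun (R : comNzRingType) (m : nat -> nat -> R) :
  \det (\matrix_(i < 3, j < 3) m i j) =
    m 0 0 * (m 1 1 * m 2 2 - m 1 2 * m 2 1)
  - m 0 1 * (m 1 0 * m 2 2 - m 1 2 * m 2 0)
  + m 0 2 * (m 1 0 * m 2 1 - m 1 1 * m 2 0).
Proof.
rewrite (expand_det_row _ ord0) !big_ord_recl big_ord0 /cofactor.
have rE j : row' ord0 (col' j (\matrix_(i < 3, k < 3) m i k)) =
    \matrix_(i < 2, k < 2) m i.+1 (bump j k).
  by apply/matrixP => i k; rewrite !mxE.
rewrite !rE !(@det2_fun _ (fun a b => m a.+1 (bump _ b))) !mxE /bump /=; ring.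
Qed.

Lemma det4 (R : comNzRingType) (M : 'M[R]_4) : \det M =
    M 0 0 * (M 1 1 * (M 2 2 * M 3 3 - M 2 3 * M 3 2) - M 1 2 * (M 2 1 * M 3 3 - M 2 3 * M 3 1)
       + M 1 3 * (M 2 1 * M 3 2 - M 2 2 * M 3 1))
  - M 0 1 * (M 1 0 * (M 2 2 * M 3 3 - M 2 3 * M 3 2) - M 1 2 * (M 2 0 * M 3 3 - M 2 3 * M 3 0)
       + M 1 3 * (M 2 0 * M 3 2 - M 2 2 * M 3 0))
  + M 0 2 * (M 1 0 * (M 2 1 * M 3 3 - M 2 3 * M 3 1) - M 1 1 * (M 2 0 * M 3 3 - M 2 3 * M 3 0)
       + M 1 3 * (M 2 0 * M 3 1 - M 2 1 * M 3 0))
  - M 0 3 * (M 1 0 * (M 2 1 * M 3 2 - M 2 2 * M 3 1) - M 1 1 * (M 2 0 * M 3 2 - M 2 2 * M 3 0)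
       + M 1 2 * (M 2 0 * M 3 1 - M 2 1 * M 3 0)).
Proof.
(* [n] turns natural numbers into indices, so that the minors get the shape required by [det3_fun];
   the index 3 comes from the default value of [nth]. *)
pose n k : 'I_4 := nth 3 [:: 0; 1; 2] k.
have nE (i : 'I_4) : n i = i by case: (I4P i) => ->.
rewrite (expand_det_row _ 0) sum4 /cofactor.
have rE j : row' 0 (col' j M) = \matrix_(i < 3, k < 3) M (n i.+1) (n (bump j k)).
  by apply/matrixP => i k; rewrite !mxE -[in LHS](nE (lift _ _)) -[X in M _ X = _]nE.
rewrite !rE !(@det3_fun _ (fun a b => M (n a.+1) (n (bump _ b)))) /n /bump /=; ring.
Qed.

(** The Hodge star on 2-forms of R^4, written for antisymmetric [w]. *)
Definition star (R : realType) (w : 'M[R]_4) : 'M[R]_4 := mx4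
  0 (w 2 3) (w 3 1) (w 1 2) (w 3 2) 0 (w 0 3) (w 2 0)
  (w 1 3) (w 3 0) 0 (w 0 1) (w 2 1) (w 0 2) (w 1 0) 0.

(* Each entry of the left-hand side is a determinant whose columns are columns of [F]. *)
Lemma star_wedge_det (R : realType) (F : 'M[R]_4) :
  F^T *m star (wedge (col 1 F) (col 2 F)) *m F =
  \det F *: mx4 0 0 0 1 0 0 0 0 0 0 0 0 (-1) 0 0 0.
Proof.
have wE i j : wedge (col 1 F) (col 2 F) i j = F i 1 * F j 2 - F i 2 * F j 1.
  by rewrite wedgeE !mxE.
move: (wedge _ _) wE => w wE.
have e i j : (F^T *m star w *m F) i j =
    w 2 3 * (F 0 i * F 1 j - F 1 i * F 0 j) + w 3 1 * (F 0 i * F 2 j - F 2 i * F 0 j)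
  + w 1 2 * (F 0 i * F 3 j - F 3 i * F 0 j) + w 0 3 * (F 1 i * F 2 j - F 2 i * F 1 j)
  + w 2 0 * (F 1 i * F 3 j - F 3 i * F 1 j) + w 0 1 * (F 2 i * F 3 j - F 3 i * F 2 j).
  by rewrite !(mxE, sum4, ord4E) /= !wE; ring.
apply/matrixP => i j; rewrite e !wE det4 [RHS]mxE [mx4 _ _ _ _ _ _ _ _ _ _ _ _ _ _ _ _ _ _]mxE.
by case: (I4P i) => ->; case: (I4P j) => ->; rewrite !ord4E /=; ring.
Qed.

Definition frame (R : realType) (p u v w : 'cV[R]_4) : 'M[R]_4 :=
  \matrix_(i < 4, j < 4) nth 0 [:: p; u; v; w] j i 0.

Lemma frameE (R : realType) (p u v w : 'cV[R]_4) :
  (col 0 (frame p u v w) = p) * (col 1 (frame p u v w) = u) *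
  (col 2 (frame p u v w) = v) * (col 3 (frame p u v w) = w).
Proof. by do !split; apply/colP => i; rewrite !mxE. Qed.

(** The frame with columns p, A, v, B is orthogonal of determinant 1, so [star_wedge_det] transports
    star (e_1 ^ e_2) = e_0 ^ e_3 to it. Hence A ^ v + alpha p ^ B is self-dual for alpha = 1 and
    anti-self-dual for alpha = -1. *)
Lemma star_wedge (R : realType) (p A v B : 'cV[R]_4) :
  unit_tangent 1 p v -> tangent 1 p A -> metric 1 A A = 1 -> metric 1 A v = 0 ->
  is_cross 1 p A v B -> star (wedge A v) = wedge p B.
Proof.
move=> [[pp _] pv vv] pA AA Av [pB BB BA Bv dF].
have ml x y : metric 1 x y = level_form 1 x y by rewrite metric_level ?mul1r ?expr1n.
rewrite /tangent/= !ml -/(frame p A v B) in pp pv vv pA AA Av pB BB BA Bv dF.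
set F := frame _ _ _ _ in dF.
have FF : F^T *m F = 1%:M.
  have FE i j : (F^T *m F) i j = level_form 1 (col i F) (col j F).
    by rewrite level_formE !mxE sum4 !mxE; ring.
  apply/matrixP => i j; rewrite FE.
  by case: (I4P i) => ->; case: (I4P j) => ->; rewrite !frameE mxE /=
    ?pp ?pv ?vv ?pA ?AA ?Av ?pB ?BB ?BA ?Bv// level_formC.
have d1 : \det F = 1.
  have := congr1 determinant FF; rewrite det_mulmx det_tr det1 => d2; nra.
have := star_wedge_det F; rewrite !frameE d1 scale1r => e.
have F2 : F *m F^T = 1%:M by exact: mulmx1C.
have -> : star (wedge A v) = F *m (F^T *m star (wedge A v) *m F) *m F^T.
  by rewrite !mulmxA F2 mul1mx -mulmxA F2 mulmx1.
rewrite e; have -> : p = F *m delta_mx 0 0 by rewrite -colE frameE.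
have -> : B = F *m delta_mx 3 0 by rewrite -colE frameE.
rewrite wedge_mulmx; congr (_ *m _ *m _).
apply/matrixP => i j; rewrite wedgeE !mxE.
by case: (I4P i) => ->; case: (I4P j) => ->; rewrite /=; ring.
Qed.

(** * The invariants of admissible curves when alpha ^ 2 = kappa *)

Lemma is_derive_wedge (R : realType) (x y : R -> 'cV[R]_4) dx dy (t : R) :
  is_derive t 1 x dx -> is_derive t 1 y dy ->
  is_derive t 1 (fun s => wedge (x s) (y s)) (wedge dx (y t) + wedge (x t) dy).
Proof.
move=> hx hy.
have h := is_deriveD_fun (is_derive_mulmx hx (is_derive_trmx hy))
  (is_deriveN_fun (is_derive_mulmx hy (is_derive_trmx hx))).
apply: (@is_derive_eq _ _ _ _ _ _ _ _ h).
by rewrite /wedge opprD [- _ - _]addrC addrACA.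
Qed.

Lemma wedgeZr (R : realType) (a : R) (x y : 'cV[R]_4) : wedge x (a *: y) = a *: wedge x y.
Proof. by rewrite /wedge linearZ /= -scalemxAr -scalemxAl scalerBr. Qed.

Lemma is_derive_cosM (R : realType) (a t : R) :
  is_derive t 1 (fun s => cos (a * s)) (- sin (a * t) * a).
Proof.
have h := is_derive1_fun_affine (b := 0) (is_derive_cos (a * t + 0)).
by under eq_fun do rewrite -[a * _]addr0; rewrite -[a * t]addr0.
Qed.

Lemma is_derive_sinM (R : realType) (a t : R) :
  is_derive t 1 (fun s => sin (a * s)) (cos (a * t) * a).
Proof.
have h := is_derive1_fun_affine (b := 0) (is_derive_sin (a * t + 0)).
by under eq_fun do rewrite -[a * _]addr0; rewrite -[a * t]addr0.
Qed.

Lemma helicoidal_plucker (R : realType) (kappa alpha : R) l p A Gamma : curvature kappa ->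
  helicoidal kappa alpha l p A Gamma -> exists v B,
  [/\ unit_tangent kappa p v, l = line kappa p v,
      [/\ tangent kappa p A, metric kappa A A = 1, metric kappa A v = 0 & is_cross kappa p A v B],
      Gamma 0 = l /\ (forall t, oriented_geodesics kappa (Gamma t))
    & is_derive (0 : R) 1 (fun t => plucker (Gamma t)) (wedge A v + alpha *: wedge p B)].
Proof.
move=> hk [sigma [gamma [V [B [phi [[hs -> s0] [TA AA As] [hg g0 gA] [hV V0 hB cr] hphi]]]]]].
have [sE hpv] := unit_geodesicE hk hs; rewrite s0 in sE hpv.
set v := derive1 sigma 0 in sE hpv V0 As cr *.
exists v, (B 0); have GE t : oriented_geodesics kappa (Gamma t).
  by have [ph _ _ ->] := hphi t; exists (phi^~ t).
split=> //.
- by rewrite {1}sE.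
- split=> //; have [ph p0 pd ->] := hphi 0.
  have [e _] := unit_geodesicE hk ph.
  rewrite p0 g0 pd mulr0 cos0 sin0 scale1r scale0r addr0 V0 in e.
  by rewrite e sE.
have [_ _ BA _ _] := cr.
(* Both fields have zero derivative in R^4 at 0, since v and B are orthogonal to A; besides the
   motion of the base point, only the rotation of speed alpha contributes. *)
have dV : derive1 V 0 = 0.
  by rewrite (parallel_derive 0 hk hg hV) gA V0 metricC As mulr0 oppr0 scale0r.
have dB : derive1 B 0 = 0.
  by rewrite (parallel_derive 0 hk hg hB) gA BA mulr0 oppr0 scale0r.
have [gs _ _ _] := hg; have [Vs _ _] := hV; have [Bs _ _] := hB.
have h1 := is_deriveD_fun
  (is_derive_scalemx (is_derive_cosM alpha 0) (smooth_at_derive (Vs 0)))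
  (is_derive_scalemx (is_derive_sinM alpha 0) (smooth_at_derive (Bs 0))).
have h := is_derive_wedge (smooth_at_derive (gs 0)) h1.
rewrite dV dB !mulr0 cos0 sin0 !scaler0 !scale0r !addr0 oppr0 mul0r scale0r add0r
  mul1r scale1r V0 gA g0 wedgeZr in h.
apply: near_eq_is_derive h; near=> t.
have [ph p0 pd Gt] := hphi t.
have lm : Gamma t (phi^~ t) by rewrite Gt; split=> //; exists 0 => s; rewrite addr0.
by rewrite (plucker_mem hk (GE t) lm) p0 pd.
Unshelve. all: by end_near. Qed.

Inductive cyclic_triple : 'I_4 -> 'I_4 -> 'I_4 -> Prop :=
| Cyclic123 : cyclic_triple 1 2 3
| Cyclic231 : cyclic_triple 2 3 1
| Cyclic312 : cyclic_triple 3 1 2.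

Definition invariant_coord (R : realType) (alpha : R) (i j k : 'I_4) (P : 'M[R]_4) : R :=
  P 0 i - alpha * P j k.

(** For kappa = 0, alpha vanishes and so do the coordinates 0 of A and v. For kappa = 1 the matrix
    is A ^ v + alpha star (A ^ v) with alpha^2 = 1. No real alpha has square -1. *)
Lemma invariant_coord_fiber (R : realType) (kappa alpha : R) p v A B i j k :
  curvature kappa -> alpha ^+ 2 = kappa -> cyclic_triple i j k ->
  unit_tangent kappa p v -> tangent kappa p A -> metric kappa A A = 1 ->
  metric kappa A v = 0 -> is_cross kappa p A v B ->
  invariant_coord alpha i j k (wedge A v + alpha *: wedge p B) = 0.
Proof.
move=> hk a2 ijk hpv TA AA Av cr; rewrite /invariant_coord.
case: hk a2 hpv TA AA Av cr => -> a2 hpv TA AA Av cr.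
- have [Mp Tv _] := hpv; have [_ v0] := tangent0 Mp Tv; have [_ A0] := tangent0 Mp TA.
  move/eqP: a2; rewrite sqrf_eq0 => /eqP ->.
  by rewrite !mxE !big_ord1 !mxE v0 A0; ring.
- have e := star_wedge hpv TA AA Av cr.
  have {}e m n : wedge p B m n = star (wedge A v) m n by rewrite e.
  move: (wedge A v) (wedge p B) e => W P PE.
  by case: ijk; rewrite !mxE !PE !mxE !ord4E /=; ring: a2.
- by have := sqr_ge0 alpha; rewrite a2 => h; exfalso; lra.
Qed.

Lemma is_derive_invariant_coord (R : realType) (alpha : R) i j k (P : R -> 'M[R]_4) D (t : R) :
  is_derive t 1 P D ->
  is_derive t 1 (fun s => invariant_coord alpha i j k (P s)) (invariant_coord alpha i j k D).
Proof.
move=> /is_derive_mxP hP.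
have h := is_deriveD_fun (hP 0 i)
  (is_deriveN_fun (is_deriveM_fun (is_derive_cst alpha t 1) (hP j k))).
by apply: (@is_derive_eq _ _ _ _ _ _ _ _ h); rewrite /invariant_coord /cst; ring.
Qed.

Lemma near_itv_oo (R : realType) (a b : \bar R) (t : R) : (a < t%:E < b)%E ->
  \forall s \near t, (a < s%:E < b)%E.
Proof.
move=> /andP[at_ tb].
have h1 : nbhs t [set r : R | (r%:E < b)%E].
  by apply: open_nbhs_nbhs; split; [exact: open_ereal_lt|].
have h2 : nbhs t [set r : R | (a < r%:E)%E].
  by apply: open_nbhs_nbhs; split; [exact: open_ereal_gt|].
near=> s; apply/andP; split; [near: s; exact: h2|near: s; exact: h1].
Unshelve. all: by end_near. Qed.

Lemma derive0_cst_itv (R : realType) (a b : \bar R) (f : R -> R) :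
  (forall t : R, (a < t%:E < b)%E -> is_derive t 1 f 0) ->
  forall s t : R, (a < s%:E < b)%E -> (a < t%:E < b)%E -> f s = f t.
Proof.
move=> df s t; wlog st : s t / s <= t => [h|] hs ht.
  by have [/h|/ltW/h] := leP s t; [exact|move=> ->].
have itv x : x \in `[s, t] -> (a < x%:E < b)%E.
  rewrite in_itv /= => /andP[sx xt]; move: hs ht => /andP[h1 h2] /andP[h3 h4].
  by rewrite (lt_le_trans h1) ?lee_fin//= (le_lt_trans _ h4)// lee_fin.
have [||c _] := @MVT_segment R f (fun=> 0) s t st.
- by move=> x xst; apply: df; apply: itv; exact: subset_itv_oo_cc xst.
- apply: derivable_within_continuous => x xst.
  by apply: ex_derive; apply: df; exact: itv.
by rewrite mul0r => /eqP; rewrite subr_eq0 => /eqP.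
Qed.

Lemma admissible_invariant (R : realType) (kappa alpha : R) a b c i j k :
  curvature kappa -> alpha ^+ 2 = kappa -> cyclic_triple i j k ->
  admissible kappa alpha a b c ->
  forall s t : R, (a < s%:E < b)%E -> (a < t%:E < b)%E ->
  invariant_coord alpha i j k (plucker (c s)) = invariant_coord alpha i j k (plucker (c t)).
Proof.
move=> hk a2 ijk [cs cv].
apply: (derive0_cst_itv (f := fun t => invariant_coord alpha i j k (plucker (c t)))) => t hab.
have oc : \forall s \near t, oriented_geodesics kappa (c s).
  by near=> s; apply: (cs s _).1; near: s; exact: near_itv_oo.
have [u ut [p [A [Gamma [hG uG]]]]] := cv t hab.
have [v [B [hpv lE [TA AA Av cr] [G0 GE] dG]]] := helicoidal_plucker hk hG.
have [g lift _] := (ut).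
have dc := is_derive_plucker hk oc lift.
have oG : \forall s \near (0 : R), oriented_geodesics kappa (Gamma s) by near=> s.
(* The velocity of [c] at [t] is that of some helicoidal curve at 0, whose Plücker derivative is
   explicit. *)
have e := velocity_plucker hk oc oG (esym G0) ut uG dc dG.
rewrite e in dc; apply: (@is_derive_eq _ _ _ _ _ _ _ _ (is_derive_invariant_coord alpha i j k dc)).
exact: (invariant_coord_fiber hk).
Unshelve. all: by end_near. Qed.

Lemma piecewise_admissible_invariant (R : realType) (kappa alpha : R) a b c i j k :
  curvature kappa -> alpha ^+ 2 = kappa -> cyclic_triple i j k ->
  piecewise_admissible kappa alpha a b c ->
  invariant_coord alpha i j k (plucker (c a)) = invariant_coord alpha i j k (plucker (c b)).
Proof.
move=> hk a2 ijk [n [x [<- <- xlt pc]]].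
suff h m : (m <= n)%N -> invariant_coord alpha i j k (plucker (c (x 0%N))) =
  invariant_coord alpha i j k (plucker (c (x m))) by exact: h.
elim: m => // m ih mn; rewrite ih 1?ltnW//.
have [a' [b' [c' [h1 h2 adm cE]]]] := pc _ mn.
have xm := xlt _ mn.
rewrite !cE ?lexx ?(ltW xm)//; apply: (admissible_invariant hk a2 ijk adm).
  by rewrite h1 (lt_trans _ h2)// lte_fin.
by rewrite h2 (lt_trans h1)// lte_fin.
Qed.

(** * One-parameter groups and helicoidal curves *)

Definition block (R : realType) (kappa c s c' s' : R) : 'M[R]_4 :=
  mx4 c (- (kappa * s)) 0 0 s c 0 0 0 0 c' (- s') 0 0 s' c'.

(* If the columns of F are p, A, v, B, those of F *m screw t th are obtained by parallel
   transport along gamma_A from time 0 to t and a rotation of v and B by th. *)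
Definition screw (R : realType) (kappa t th : R) : 'M[R]_4 :=
  block kappa (kcos kappa t) (ksin kappa t) (cos th) (sin th).

Definition screw_gen (R : realType) (kappa x y : R) : 'M[R]_4 := block kappa 0 x 0 y.

(** The rotation e_1 -> e_2 -> e_3 -> e_1; conjugating [block] by it replaces the axis e_1 by the
    other two. *)
Definition cycle3 (R : realType) : 'M[R]_4 :=
  mx4 1 0 0 0 0 0 0 1 0 1 0 0 0 0 1 0.

Lemma block_mul (R : realType) (k a b c d a' b' c' d' : R) :
  block k a b c d *m block k a' b' c' d' =
  block k (a * a' - k * (b * b')) (b * a' + a * b') (c * c' - d * d') (d * c' + c * d').
Proof. by rewrite ?/block ?/cycle3; mx4calc. Qed.

Lemma block1 (R : realType) (k : R) : block k 1 0 1 0 = 1%:M.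
Proof. by rewrite ?/block ?/cycle3; mx4calc. Qed.

Lemma screwD (R : realType) (k t th t' th' : R) : curvature k ->
  screw k (t + t') (th + th') = screw k t th *m screw k t' th'.
Proof.
by move=> hk; rewrite /screw block_mul kcosD// ksinD// cosD sinD.
Qed.

Lemma screw0 (R : realType) (k : R) : curvature k -> screw k 0 0 = 1%:M.
Proof. by move=> hk; rewrite /screw kcos_0// ksin_0// cos0 sin0 block1. Qed.

Lemma isoG_block (R : realType) (k c s c' s' : R) : 
  c ^+ 2 + k * s ^+ 2 = 1 -> (k != 1 -> 0 < c) -> c' ^+ 2 + s' ^+ 2 = 1 ->
  isoG k (block k c s c' s').
Proof.
move=> cs c0 cs'.
have inv : block k c s c' s' *m block k c (- s) c' (- s') = 1%:M.
  by rewrite block_mul -(block1 k); congr block; first [ring|rewrite -cs; ring|rewrite -cs'; ring].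
have inv' := mulmx1C inv; split.
- have e : Qmx k *m (block k c s c' s')^T = block k c (- s) c' (- s') *m Qmx k.
    by rewrite /block ?/Qmx ?/Lmx; mx4calc.
  by rewrite -mulmxA e mulmxA inv mul1mx.
- have e : (block k c s c' s')^T *m Lmx k = Lmx k *m block k c (- s) c' (- s').
    by rewrite /block ?/Qmx ?/Lmx; mx4calc.
  by rewrite e -mulmxA inv' mulmx1.
- by move=> /c0; rewrite mxE.
Qed.

(* The matrices [frame p A v B] with p a point and A, v, B a positively oriented
   orthonormal basis of its tangent space. *)
Definition frm (R : realType) (k : R) (F : 'M[R]_4) : Prop := isoG k F /\ 0 < \det F.

Lemma frm_block (R : realType) (k c s c' s' : R) : 
  c ^+ 2 + k * s ^+ 2 = 1 -> (k != 1 -> 0 < c) -> c' ^+ 2 + s' ^+ 2 = 1 ->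
  frm k (block k c s c' s').
Proof.
move=> cs c0 cs'; split; first exact: isoG_block.
rewrite det4 !mxE !ord4E /=.
suff -> : forall x, x = (c ^+ 2 + k * s ^+ 2) * (c' ^+ 2 + s' ^+ 2) -> 0 < x.
- by [].
- by ring.
- by move=> x ->; rewrite cs cs' mulr1.
Qed.

Lemma frm_screw (R : realType) (k t th : R) : curvature k -> frm k (screw k t th).
Proof.
move=> hk; apply: frm_block; [exact: kcos2Dksin2|exact: kcos_gt0|exact: cos2Dsin2].
Qed.

Lemma cycle3_tr (R : realType) : cycle3 R *m (cycle3 R)^T = 1%:M.
Proof. by rewrite ?/block ?/cycle3; mx4calc. Qed.

Lemma cycle3_inv (R : realType) : invmx (cycle3 R) = (cycle3 R)^T.
Proof.
have u : cycle3 R \in unitmx by case/mulmx1_unit: (cycle3_tr R).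
by apply: (can_inj (mulKmx u)); rewrite mulmxV// cycle3_tr.
Qed.

Lemma frm_cycle3 (R : realType) (k : R) : frm k (cycle3 R).
Proof.
split; last by rewrite det4 !mxE !ord4E /=; lra.
by split; [rewrite /cycle3 /Qmx; mx4calc|rewrite /cycle3 /Lmx; mx4calc|rewrite mxE /= ltr01].
Qed.

Lemma frmM (R : realType) (k : R) F G : curvature k -> frm k F -> frm k G -> frm k (F *m G).
Proof.
move=> hk [hF dF] [hG dG]; split; first exact: isoGM.
by rewrite det_mulmx mulr_gt0.
Qed.

Lemma frmV (R : realType) (k : R) F : curvature k -> frm k F -> frm k (invmx F).
Proof.
move=> hk [hF dF]; have [_ hV] := isoG_inv hk hF; split=> //.
by rewrite det_inv invr_gt0.
Qed.

Lemma frm_unit (R : realType) (k : R) F : curvature k -> frm k F -> F \in unitmx.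
Proof. by move=> hk [hF _]; have [] := isoG_inv hk hF. Qed.

Lemma smooth_block (R : realType) (k : R) (c s c' s' : R -> R) :
  smooth c -> smooth s -> smooth c' -> smooth s' ->
  smooth (fun t => block k (c t) (s t) (c' t) (s' t)).
Proof.
move=> hc hs hc' hs'; apply/smooth_mxP => i j.
have sN (a : R) (f : R -> R) : smooth f -> smooth (fun t => - (a * f t)).
  move=> hf; under eq_fun do rewrite -mulNr.
  by apply: smoothM => //; exact: smooth_cst.
have s1 : smooth (fun t => - s' t) by have := sN 1 _ hs'; under eq_fun do rewrite mul1r.
have s2 := sN k _ hs.
under eq_fun do rewrite mxE.
by case: (I4P i) => ->; case: (I4P j) => ->; rewrite !ord4E /=; auto; exact: smooth_cst.
Qed.

Lemma smooth_screw (R : realType) (k a b c d : R) : curvature k ->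
  smooth (fun t => screw k (a * t + b) (c * t + d)).
Proof.
move=> hk; have [hc hs] := smooth_kcs hk.
by apply: smooth_block; apply: smooth_affine => //; [exact: smooth_cos|exact: smooth_sin].
Qed.

Lemma derive_block (R : realType) (k t dc ds dc' ds' : R) (c s c' s' : R -> R) :
  is_derive t 1 c dc -> is_derive t 1 s ds -> is_derive t 1 c' dc' -> is_derive t 1 s' ds' ->
  is_derive t 1 (fun t => block k (c t) (s t) (c' t) (s' t)) (block k dc ds dc' ds').
Proof.
move=> hc hs hc' hs'; apply/is_derive_mxP => i j.
have h0 : is_derive t 1 (fun=> 0 : R) 0 by exact: is_derive_cst.
have h1 := is_deriveN_fun hs'.
have h2 := is_deriveM_fun (is_derive_cst k t 1) hs.
have {h2} h2 : is_derive t 1 (fun s0 => - (k * s s0)) (- (k * ds)).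
  by apply: is_deriveN_fun; apply: (@is_derive_eq _ _ _ _ _ _ _ _ h2); rewrite mul0r add0r.
under eq_fun do rewrite mxE; rewrite mxE.
by case: (I4P i) => ->; case: (I4P j) => ->; rewrite !ord4E /=.
Qed.

Lemma is_derive_screw (R : realType) (k a b c d t : R) : curvature k ->
  a * t + b = 0 -> c * t + d = 0 ->
  is_derive t 1 (fun t => screw k (a * t + b) (c * t + d)) (screw_gen k a c).
Proof.
move=> hk ab cd.
have hc := is_derive1_fun_affine (is_derive_kcos (a * t + b) hk).
have hs := is_derive1_fun_affine (is_derive_ksin (a * t + b) hk).
have hc' := is_derive1_fun_affine (is_derive_cos (c * t + d)).
have hs' := is_derive1_fun_affine (is_derive_sin (c * t + d)).
apply: (@is_derive_eq _ _ _ _ _ _ _ _ (derive_block k hc hs hc' hs')).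
rewrite ab cd kcos_0// ksin_0// sin0 cos0 /screw_gen; congr block; ring.
Qed.

Lemma smooth_mulmxl (R : realType) m n p (A : 'M[R]_(m.+1, n.+1)) (M : R -> 'M[R]_(n.+1, p.+1)) :
  smooth M -> smooth (fun t => A *m M t).
Proof. by move=> hM; apply: smooth_mulmx => //; exact: smooth_cst. Qed.

Lemma smooth_mulmxr (R : realType) m n p (A : 'M[R]_(n.+1, p.+1)) (M : R -> 'M[R]_(m.+1, n.+1)) :
  smooth M -> smooth (fun t => M t *m A).
Proof. by move=> hM; apply: smooth_mulmx => //; exact: smooth_cst. Qed.

Lemma is_derive_conj (R : realType) m n p q (A : 'M[R]_(m.+1, n.+1)) (B : 'M[R]_(p.+1, q.+1))
    (M : R -> 'M[R]_(n.+1, p.+1)) D (t : R) :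
  is_derive t 1 M D -> is_derive t 1 (fun t => A *m M t *m B) (A *m D *m B).
Proof.
move=> hM.
have h := is_derive_mulmx (is_derive_mulmx (is_derive_cst A t 1) hM) (is_derive_cst B t 1).
by apply: (@is_derive_eq _ _ _ _ _ _ _ _ h); rewrite /cst mul0mx add0r mulmx0 addr0.
Qed.

(** Apart from the identity itself, elements of [isometries0] are always produced in this way, from
    a path through 1 whose image is connected; the component is never described by equations. *)
Lemma isometries0_path (R : realType) (k : R) (h : R -> 'M[R]_4) (t0 : R) : curvature k ->
  smooth h -> h t0 = 1%:M -> (forall t, isoG k (h t)) -> forall t, isometries0 k (h t).
Proof.
move=> hk sh h0 hG t.
apply: (@connected_component_max _ _ (range h)); last by exists t.
- by exists t0.
- by move=> _ [s _ <-]; exact: isoG_isometries.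
apply: connected_continuous_connected.
  by apply/connected_intervalP.
apply: continuous_subspaceT => s.
apply/differentiable_continuous/derivable1_diffP.
by have [+ _] := sh 0%N; exact.
Qed.

Definition lineF (R : realType) (k : R) (F : 'M[R]_4) := line k (col 0 F) (col 2 F).

Lemma col_mulmx (R : realType) (F G : 'M[R]_4) j : col j (F *m G) = F *m col j G.
Proof. by rewrite !colE mulmxA. Qed.

(** The columns of [F] are the images, under the isometry [F], of the standard frame at e_0. *)
Lemma isoG_cols (R : realType) (k : R) F : curvature k -> isoG k F ->
  [/\ space_form k (col 0 F), tangent k (col 0 F) (col 1 F),
      tangent k (col 0 F) (col 2 F) & tangent k (col 0 F) (col 3 F)] /\
  [/\ metric k (col 1 F) (col 1 F) = 1, metric k (col 2 F) (col 2 F) = 1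
    & metric k (col 3 F) (col 3 F) = 1] /\
  [/\ metric k (col 1 F) (col 2 F) = 0, metric k (col 3 F) (col 1 F) = 0
    & metric k (col 3 F) (col 2 F) = 0].
Proof.
move=> hk hF; pose e (j : 'I_4) : 'cV[R]_4 := delta_mx j 0.
have M0 : space_form k (e 0).
  by split=> [|_]; rewrite ?level_formE !mxE /= ?ltr01//; ring.
have T j : j != 0 -> tangent k (e 0) (e j).
  by rewrite /tangent /= level_formE; case: (I4P j) => -> // _; rewrite !mxE /=; ring.
have m (i j : 'I_4) : i != 0 -> j != 0 -> metric k (e i) (e j) = (i == j)%:R.
  by rewrite metricE; case: (I4P i) => ->; case: (I4P j) => -> // _ _; rewrite !mxE /=; ring.
rewrite !colE -/(e 0) -/(e 1) -/(e 2) -/(e 3).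
split; [|split].
- by split; [exact: isoG_space_form|apply: isoG_tangent => //; exact: T..].
- by split; rewrite (isoG_metric hk hF M0) ?m//; exact: T.
- by split; rewrite (isoG_metric hk hF M0) ?m//; exact: T.
Qed.

Lemma frm_unit_tangent (R : realType) (k : R) F : curvature k -> isoG k F ->
  unit_tangent k (col 0 F) (col 2 F).
Proof. by move=> hk /(isoG_cols hk) [[? _ ? _] [[_ ? _] _]]. Qed.

Lemma frm_cross (R : realType) (k : R) F : curvature k -> frm k F ->
  is_cross k (col 0 F) (col 1 F) (col 2 F) (col 3 F).
Proof.
move=> hk [hF dF]; have [[_ _ _ ?] [[_ _ ?] [_ ? ?]]] := isoG_cols hk hF; split=> //.
rewrite (_ : \matrix_(_, _) _ = F)//.
by apply/matrixP => i j; rewrite mxE; case: (I4P j) => ->; rewrite /= mxE.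
Qed.

Lemma col_screw (R : realType) (k t th : R) (F : 'M[R]_4) :
  (col 0 (F *m screw k t th) = kcos k t *: col 0 F + ksin k t *: col 1 F) *
  (col 1 (F *m screw k t th) = - (k * ksin k t) *: col 0 F + kcos k t *: col 1 F) *
  (col 2 (F *m screw k t th) = cos th *: col 2 F + sin th *: col 3 F) *
  (col 3 (F *m screw k t th) = - sin th *: col 2 F + cos th *: col 3 F).
Proof. by do !split; apply/colP => i; rewrite !mxE sum4 !mxE !ord4E /=; ring. Qed.

Lemma act_lineF (R : realType) (k : R) g F : curvature k -> isoG k g -> isoG k F ->
  act g (lineF k F) = lineF k (g *m F).
Proof.
move=> hk hg hF; rewrite /lineF act_line//; first by rewrite !col_mulmx.
exact: frm_unit_tangent.
Qed.

Lemma helicoidal_lineF (R : realType) (k alpha : R) F : curvature k -> frm k F ->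
  helicoidal k alpha (lineF k F) (col 0 F) (col 1 F)
    (fun t => lineF k (F *m screw k t (alpha * t))).
Proof.
move=> hk fF; have [hF _] := fF.
have [[M0 T1 T2 T3] [[m11 m22 m33] [m12 m31 m32]]] := isoG_cols hk hF.
(* The geodesic of A stays in the span of p and A, so a tangent vector at p orthogonal to A, such as
   v or B, is parallel along it when kept constant in R^4. *)
have par (w : 'cV[R]_4) : tangent k (col 0 F) w -> metric k (col 1 F) w = 0 ->
    parallel_field k (geo k (col 0 F) (col 1 F)) (fun=> w).
  move=> Tw mw; split.
  - by move=> t; apply: smooth_smooth_at; exact: smooth_cst.
  - move=> t; rewrite /tangent /= /geo !levelE (level_tangent hk M0 T1 Tw) mw.
    by move: Tw; rewrite /tangent /= => ->; ring.
  - by move=> t u _; rewrite (derive1_cst w) metricE !mxE; ring.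
exists (geo k (col 0 F) (col 2 F)), (geo k (col 0 F) (col 1 F)), (fun=> col 2 F), (fun=> col 3 F).
exists (fun s t =>
  geo k (col 0 (F *m screw k t (alpha * t))) (col 2 (F *m screw k t (alpha * t))) s).
have d2 : derive1 (geo k (col 0 F) (col 2 F)) 0 = col 2 F.
  by rewrite (derive1_geo _ _ hk) (geo0 _ _ hk).
split.
- by split; [apply: unit_geodesic_geo => //; exact: frm_unit_tangent| |rewrite (geo0 _ _ hk)].
- by rewrite d2; split.
- split; [by apply: unit_geodesic_geo|exact: geo0|].
  by rewrite (derive1_geo _ _ hk) (geo0 _ _ hk).
- rewrite d2; split=> //; [exact: par|by apply: par => //; rewrite metricC|exact: frm_cross].
- move=> t; set G := F *m screw k t (alpha * t).
  have hG : isoG k G by have [] := frmM hk fF (frm_screw t (alpha * t) hk).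
  have hu := frm_unit_tangent hk hG.
  split=> //; first exact: unit_geodesic_geo.
    by rewrite (geo0 _ _ hk) /G col_screw.
  by rewrite (derive1_geo _ _ hk) (geo0 _ _ hk) /G col_screw.
Qed.

(** Since [screw] is a one-parameter group, the arc is moved from its position at t by the
    isometries [G *m screw k (s - t) (alpha * (s - t)) *m invmx G], acting on the left. The origin
    [t0] is there for concatenating arcs. *)
Lemma helix_lift (R : realType) (k alpha t0 t : R) F : curvature k -> frm k F ->
  let c s := lineF k (F *m screw k (s - t0) (alpha * (s - t0))) in
  let G := F *m screw k (t - t0) (alpha * (t - t0)) in
  exists2 g, local_lift k c t g & derive1 g t = G *m screw_gen k 1 alpha *m invmx G.
Proof.
move=> hk fF c G.
have fG : frm k G by apply: frmM => //; exact: frm_screw.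
have uG := frm_unit hk fG; have [hG _] := fG; have [hG' _] := frmV hk fG.
pose g s := G *m screw k (1 * s + (- t)) (alpha * s + - (alpha * t)) *m invmx G.
have sg : smooth g.
  by apply: smooth_mulmxr; apply: smooth_mulmxl; exact: smooth_screw.
have g1 : g t = 1%:M by rewrite /g mul1r !subrr screw0// mulmx1 mulmxV.
have hg s : isoG k (g s).
  have [hS _] := frm_screw (1 * s + - t) (alpha * s + - (alpha * t)) hk.
  by apply: isoGM => //; exact: isoGM.
exists g.
  split=> //; near=> s; first exact: smooth_smooth_at.
  split; first exact: (isometries0_path hk sg g1 hg).
  rewrite /c -/G act_lineF// /g mulmxKV// /G -mulmxA -screwD//.
  have -> : t - t0 + (1 * s - t) = s - t0 by ring.
  by have -> : alpha * (t - t0) + (alpha * s - alpha * t) = alpha * (s - t0) by ring.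
apply: is_derive_derive1_eq; apply: is_derive_conj.
by apply: is_derive_screw => //; rewrite ?mul1r subrr.
Unshelve. all: by end_near. Qed.

Lemma control_fiber_lineF (R : realType) (k alpha : R) F : curvature k -> frm k F ->
  control_fiber k alpha (lineF k F)
    (tangent_class k (lineF k F) (F *m screw_gen k 1 alpha *m invmx F)).
Proof.
move=> hk fF; have := helix_lift alpha 0 0 hk fF.
rewrite subrr mulr0 screw0// mulmx1 /= => -[g lg dg].
exists (col 0 F), (col 1 F), (fun t => lineF k (F *m screw k t (alpha * t))).
split; first exact: helicoidal_lineF.
have cE : (fun t => lineF k (F *m screw k t (alpha * t))) =
  (fun s => lineF k (F *m screw k (s - 0) (alpha * (s - 0)))).
  by apply/funext => s; rewrite subr0.
by rewrite cE; exists g => //; rewrite subrr mulr0 screw0// mulmx1 dg.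
Qed.

(** At each time the arc is again a helicoidal curve issued from the frame reached at that time, so
    its velocity lies in the control fiber there. *)
Lemma admissible_helix (R : realType) (k alpha t0 : R) F : curvature k -> frm k F ->
  admissible k alpha -oo%E +oo%E
    (fun s => lineF k (F *m screw k (s - t0) (alpha * (s - t0)))).
Proof.
move=> hk fF; have fG t : frm k (F *m screw k (t - t0) (alpha * (t - t0))).
  by apply: frmM => //; exact: frm_screw.
split=> t _; have [g lg dg] := helix_lift alpha t0 t hk fF.
  by split; [apply: oriented_line => //; apply: frm_unit_tangent => //; case: (fG t)|exists g].
eexists; last exact: control_fiber_lineF.
by exists g => //; rewrite dg.
Qed.

(** * Reachability along helicoidal curves *)

(* Right multiplication by [stab] moves the frame along and around its geodesic. *)
Definition stab (R : realType) (k c s c' s' : R) : 'M[R]_4 :=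
  mx4 c 0 (- (k * s)) 0 0 c' 0 s' s 0 c 0 0 (- s') 0 c'.

Lemma frm_stab (R : realType) (k c s c' s' : R) : curvature k ->
  c ^+ 2 + k * s ^+ 2 = 1 -> (k != 1 -> 0 < c) -> c' ^+ 2 + s' ^+ 2 = 1 ->
  frm k (stab k c s c' s').
Proof.
move=> hk cs c0 cs'.
have -> : stab k c s c' s' = cycle3 R *m block k c s c' s' *m invmx (cycle3 R).
  by rewrite cycle3_inv /cycle3 /block /stab; mx4calc.
apply: frmM => //; first by apply: frmM => //; [exact: frm_cycle3|exact: frm_block].
by apply: frmV => //; exact: frm_cycle3.
Qed.

Lemma col_mulmx4 (R : realType) (F M : 'M[R]_4) j :
  col j (F *m M) = M 0 j *: col 0 F + M 1 j *: col 1 F + M 2 j *: col 2 F + M 3 j *: col 3 F.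
Proof.
apply/colP => i; rewrite !mxE sum4.
by rewrite [F i 0 * _]mulrC [F i 1 * _]mulrC [F i 2 * _]mulrC [F i 3 * _]mulrC.
Qed.

Lemma mx4_col (R : realType) (a00 a01 a02 a03 a10 a11 a12 a13 a20 a21 a22 a23 a30 a31 a32 a33 : R)
    (F : 'M[R]_4) :
  let M := mx4 a00 a01 a02 a03 a10 a11 a12 a13 a20 a21 a22 a23 a30 a31 a32 a33 in
  (col 0 (F *m M) = a00 *: col 0 F + a10 *: col 1 F + a20 *: col 2 F + a30 *: col 3 F) *
  (col 2 (F *m M) = a02 *: col 0 F + a12 *: col 1 F + a22 *: col 2 F + a32 *: col 3 F).
Proof. by move=> M; split; rewrite col_mulmx4 /M !mxE. Qed.

Lemma lineF_comb (R : realType) (k c s : R) F G : curvature k -> isoG k G ->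
  c ^+ 2 + k * s ^+ 2 = 1 -> (k != 1 -> 0 < c) ->
  col 0 F = c *: col 0 G + s *: col 2 G -> col 2 F = - (k * s) *: col 0 G + c *: col 2 G ->
  lineF k F = lineF k G.
Proof.
move=> hk hG cs c0 e0 e2; rewrite /lineF e0 e2 line_comb//.
exact: frm_unit_tangent.
Qed.

Lemma lineF_stab (R : realType) (k c s c' s' : R) F : curvature k -> isoG k F ->
  c ^+ 2 + k * s ^+ 2 = 1 -> (k != 1 -> 0 < c) ->
  lineF k (F *m stab k c s c' s') = lineF k F.
Proof.
move=> hk hF cs c0; apply: lineF_comb cs c0 _ _ => //;
  by rewrite /stab mx4_col !scale0r !addr0.
Qed.

(** Only positive times are allowed, because the pieces of a curve are run forwards; symmetry and
    reflexivity have to be proved. *)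
Inductive hreach (R : realType) (k alpha : R) :
    set (R -> 'cV[R]_4) -> set (R -> 'cV[R]_4) -> Prop :=
| hreach_step F t : frm k F -> 0 < t ->
    hreach k alpha (lineF k F) (lineF k (F *m screw k t (alpha * t)))
| hreach_trans l2 l1 l3 : hreach k alpha l1 l2 -> hreach k alpha l2 l3 -> hreach k alpha l1 l3.

(** The half-turn [N] about the geodesic changes the signs of A and B and keeps the geodesic:
    running the arc of (A, B) backwards is running the arc of (- A, - B) forwards. *)
Lemma hreach_stepN (R : realType) (k alpha t : R) F : curvature k -> frm k F -> t < 0 ->
  hreach k alpha (lineF k F) (lineF k (F *m screw k t (alpha * t))).
Proof.
move=> hk fF t0; have h11 : 1 ^+ 2 + k * 0 ^+ 2 = 1 :> R by ring.
have h01 : k != 1 -> 0 < 1 :> R by rewrite ltr01.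
pose N := stab k 1 0 (-1) 0.
have fN : frm k N by apply: frm_stab => //; ring.
have e : screw k t (alpha * t) *m N = N *m screw k (- t) (alpha * - t).
  rewrite /screw mulrN kcosN// ksinN// cosN sinN /N /stab /block; mx4calc.
have [hF _] := fF; have hG : isoG k (F *m screw k t (alpha * t)).
  by apply: isoGM => //; case: (frm_screw t (alpha * t) hk).
rewrite -(lineF_stab (-1) 0 hk hF h11 h01) -(lineF_stab (-1) 0 hk hG h11 h01).
rewrite -mulmxA e mulmxA; apply: hreach_step; first exact: frmM.
by rewrite oppr_gt0.
Qed.

Lemma hreach_step_any (R : realType) (k alpha t : R) F : curvature k -> frm k F -> t != 0 ->
  hreach k alpha (lineF k F) (lineF k (F *m screw k t (alpha * t))).
Proof.
move=> hk fF; rewrite neq_lt => /orP[t0|t0]; first exact: hreach_stepN.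
exact: hreach_step.
Qed.

Lemma hreach_sym (R : realType) (k alpha : R) l1 l2 : curvature k ->
  hreach k alpha l1 l2 -> hreach k alpha l2 l1.
Proof.
move=> hk; elim=> [F t fF t0|m1 m2 m3 _ h1 _ h2]; last exact: hreach_trans h2 h1.
have fG : frm k (F *m screw k t (alpha * t)) by apply: frmM => //; exact: frm_screw.
have := @hreach_stepN _ k alpha (- t) _ hk fG; rewrite oppr_lt0 => /(_ t0).
by rewrite -mulmxA -screwD// mulrN !subrr screw0// mulmx1.
Qed.

(** There is no empty path, as curves live on intervals with a < b; an arc is followed and then
    undone. *)
Lemma hreach_refl (R : realType) (k alpha : R) F : curvature k -> frm k F ->
  hreach k alpha (lineF k F) (lineF k F).
Proof.
move=> hk fF; have h := hreach_step alpha fF (@ltr01 R).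
exact: hreach_trans h (hreach_sym hk h).
Qed.

(** The added arc is part of a helix that is admissible on the whole line, which provides the larger
    open interval demanded of a piece; at b the two definitions give the same geodesic. *)
Lemma piecewise_admissible_step (R : realType) (k alpha a b t : R) c F : curvature k -> frm k F ->
  0 < t -> c b = lineF k F -> a < b -> piecewise_admissible k alpha a b c ->
  exists c', [/\ piecewise_admissible k alpha a (b + t) c', c' a = c a
    & c' (b + t) = lineF k (F *m screw k t (alpha * t))].
Proof.
move=> hk fF t0 cb ab [n [x [x0 xn xlt pc]]].
pose h s := lineF k (F *m screw k (s - b) (alpha * (s - b))).
exists (fun s => if s <= b then c s else h s); split; first last.
- by rewrite gerDl leNgt t0 /= /h [b + t]addrC addrK.
- by rewrite ltW.
exists n.+1, (fun i => if (i <= n)%N then x i else b + t); split=> //.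
- by rewrite ltnn.
- move=> i; rewrite ltnS => ile; rewrite ile; case: ltnP => [/xlt//|ni].
  have -> : i = n by apply/eqP; rewrite eqn_leq ile ni.
  by rewrite xn ltrDl.
move=> i; rewrite ltnS => ile; rewrite ile; case: ltnP => [lin|ni].
  have [a' [b' [c' [h1 h2 adm cE]]]] := pc _ lin.
  exists a', b', c'; split=> // s sx; rewrite ifT ?cE//.
  have xmono m : (m <= n)%N -> (i.+1 <= m)%N -> x i.+1 <= x m.
    elim: m => // m ih mn; rewrite leq_eqVlt => /orP[/eqP -> //|im].
    by apply: le_trans (ih (ltnW mn) im) (ltW (xlt _ mn)).
  by move/andP: sx => [_ /le_trans]; apply; rewrite -xn xmono.
have -> : i = n by apply/eqP; rewrite eqn_leq ile ni.
rewrite xn; exists -oo%E, +oo%E, h; split=> //; [exact: ltNyr|exact: ltry| |].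
  exact: admissible_helix.
move=> s /andP[bs _]; case: ifPn => // sb.
have -> : s = b by apply/eqP; rewrite eq_le bs sb.
by rewrite cb /h subrr mulr0 screw0// mulmx1.
Qed.

Lemma piecewise_admissible_helix (R : realType) (k alpha t : R) F : curvature k -> frm k F ->
  0 < t ->
  piecewise_admissible k alpha 0 t (fun s => lineF k (F *m screw k s (alpha * s))).
Proof.
move=> hk fF t0; exists 1%N, (fun i => if i is 0%N then 0 else t).
split=> // i; rewrite ltnS leqn0 => /eqP -> //.
exists -oo%E, +oo%E, (fun s => lineF k (F *m screw k (s - 0) (alpha * (s - 0)))).
split; [exact: ltNyr|exact: ltry|exact: admissible_helix|].
by move=> s _; rewrite subr0.
Qed.

Lemma hreach_piecewise (R : realType) (k alpha : R) l1 l2 : curvature k ->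
  hreach k alpha l1 l2 ->
  exists (a b : R) c, [/\ a < b, piecewise_admissible k alpha a b c, c a = l1 & c b = l2].
Proof.
move=> hk h; pose reach l l' := exists (a b : R) c,
  [/\ a < b, piecewise_admissible k alpha a b c, c a = l & c b = l'].
(* A curve is only ever extended by one arc at its end, so the induction carries an arbitrary
   starting geodesic [l0]; the case [l0 = l1] stands for a curve not yet begun. *)
suff : forall l0, l0 = l1 \/ reach l0 l1 -> reach l0 l2 by move=> /(_ l1); apply; left.
elim: h => [F t fF t0 l0|m1 m2 m3 _ h1 _ h2 l0 hl0]; last by apply: h2; right; exact: h1.
move=> [->|[a [b [c [ab pc <- cb]]]]].
  exists 0, t, (fun s => lineF k (F *m screw k s (alpha * s))).
  by split=> //; [exact: piecewise_admissible_helix|rewrite mulr0 screw0// mulmx1].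
have [c' [pc' c'a c'b]] := piecewise_admissible_step hk fF t0 cb ab pc.
exists a, (b + t), c'; split=> //; lra.
Qed.

(** * Turning a geodesic about one of its points *)

Definition tline (R : realType) (k : R) (Q : 'M[R]_4) (x y : R) :=
  line k (col 0 Q) (x *: col 1 Q + y *: col 3 Q).

(** The entries of [M] are coordinates in the frame [Q]. The pair (c, s) slides the base point of
    the geodesic to [col 0 Q]; the two lists of equations express the new point and the new
    velocity. *)
Lemma lineF_tline (R : realType) (k c s x y : R) (Q : 'M[R]_4)
    (a00 a01 a02 a03 a10 a11 a12 a13 a20 a21 a22 a23 a30 a31 a32 a33 : R) : curvature k ->
  let M := mx4 a00 a01 a02 a03 a10 a11 a12 a13 a20 a21 a22 a23 a30 a31 a32 a33 in
  isoG k (Q *m M) -> c ^+ 2 + k * s ^+ 2 = 1 -> (k != 1 -> 0 < c) ->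
  [/\ c * a00 + s * a02 = 1, c * a10 + s * a12 = 0, c * a20 + s * a22 = 0
    & c * a30 + s * a32 = 0] ->
  [/\ - (k * s) * a00 + c * a02 = 0, - (k * s) * a10 + c * a12 = x,
      - (k * s) * a20 + c * a22 = 0 & - (k * s) * a30 + c * a32 = y] ->
  lineF k (Q *m M) = tline k Q x y.
Proof.
move=> hk M hM cs c0 [e1 e2 e3 e4] [e5 e6 e7 e8].
rewrite /lineF -(line_comb hk (frm_unit_tangent hk hM) cs c0) /M !mx4_col.
rewrite !scalerDr !scalerA; congr line; apply/colP => i; rewrite !mxE.
- apply: (@eq_trans _ _ ((c * a00 + s * a02) * Q i 0 + (c * a10 + s * a12) * Q i 1 +
    (c * a20 + s * a22) * Q i 2 + (c * a30 + s * a32) * Q i 3)); first by ring.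
  by rewrite e1 e2 e3 e4; ring.
- apply: (@eq_trans _ _ ((- (k * s) * a00 + c * a02) * Q i 0 + (- (k * s) * a10 + c * a12) * Q i 1 +
    (- (k * s) * a20 + c * a22) * Q i 2 + (- (k * s) * a30 + c * a32) * Q i 3)); first by ring.
  by rewrite e5 e6 e7 e8; ring.
Qed.

(** The two geodesics are mirror images about the direction [col 3 Q], so joining them amounts to a
    small turn about a point. One bound [x0] for all frames makes the turns iterable. *)
Definition turnable (R : realType) (k alpha : R) : Prop := exists2 x0 : R, 0 < x0 &
  forall Q x y, frm k Q -> x ^+ 2 + y ^+ 2 = 1 -> 0 < y -> `|x| <= x0 ->
    hreach k alpha (tline k Q x y) (tline k Q (- x) y).

Lemma pyth_half (R : realType) (x : R) : `|x| <= 2^-1 ->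
  exists2 b, 0 < b & b ^+ 2 + x ^+ 2 = 1.
Proof.
rewrite ler_norml => xh; have h : 0 < 1 - x ^+ 2 by nra.
by exists (Num.sqrt (1 - x ^+ 2)); rewrite ?sqrtr_gt0// sqr_sqrtr ?ltW// subrK.
Qed.

Lemma norm_div_half (R : realType) (C x : R) : 0 < C -> `|x| <= C / 2 -> `|x / C| <= 2^-1.
Proof.
by move=> C0 h; rewrite normrM normfV (gtr0_norm C0) ler_pdivrMr// mulrC.
Qed.

(* The two helicoidal arcs start at the common perpendicular geodesic, along the unit
   vectors at angle +-beta (b = cos beta, d = sin beta) from the bisector; after a quarter
   turn they end on coplanar geodesics, which meet at the point [col 0 Q]. *)
Lemma turnable_quarter (R : realType) (k alpha t : R) : curvature k ->
  t != 0 -> cos (alpha * t) = 0 -> sin (alpha * t) = 1 -> 0 < kcos k t -> turnable k alpha.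
Proof.
move=> hk t0 ct st C0; set C := kcos k t in C0; set S := ksin k t.
have hC' : C ^+ 2 + k * S ^+ 2 = 1 by exact: kcos2Dksin2.
have hC : C ^+ 2 = 1 - k * S ^+ 2 by rewrite -hC'; ring.
(* With x = C d this bound gives |d| <= 1/2, so that b = sqrt (1 - d^2) is positive. *)
exists (C / 2); first by rewrite divr_gt0.
move=> Q x y fQ xy y0 xC.
have [b b0] := pyth_half (norm_div_half C0 xC); set d := x / C => hb'.
have xE : x = C * d by rewrite /d mulrC divfK// gt_eqF.
have hb : b ^+ 2 = 1 - d ^+ 2 by rewrite -hb'; ring.
clearbody d; rewrite xE in xy *; clear xC xE x.
(* The arcs will start on the geodesic of [col 0 Q] and [col 1 Q], where kcos = C b / y and ksin = -
   S / y; [hi] amounts to saying that this pair lies on the conic. *)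
pose i := y^-1; have iy : i * y = 1 by rewrite mulVf// gt_eqF.
have i0 : 0 < i by rewrite invr_gt0.
have yE : y = i * (b ^+ 2 + k * S ^+ 2 * d ^+ 2).
  have : y ^+ 2 = b ^+ 2 + k * S ^+ 2 * d ^+ 2.
    by rewrite hb -[LHS](addKr ((C * d) ^+ 2)) xy; ring: hC.
  by move=> <-; rewrite expr2 mulrA iy mul1r.
have hi : i ^+ 2 * k * S ^+ 2 * d ^+ 2 = 1 - i ^+ 2 + i ^+ 2 * d ^+ 2.
  by have := iy; rewrite {1}yE hb => <-; ring.
clearbody i.
(* The starting geodesic does not involve e, so e = d and e = - d give two arcs leaving the same
   geodesic. *)
have key (e : R) : e ^+ 2 = d ^+ 2 ->
    hreach k alpha (lineF k (Q *m block k (C * b * i) (- (S * i)) 1 0)) (tline k Q (C * e) y).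
  move=> ed; have hbe : b ^+ 2 + e ^+ 2 = 1 by rewrite ed.
  rewrite -ed in hb hi yE.
  have one : 1 ^+ 2 + k * 0 ^+ 2 = 1 :> R by ring.
  have p1 : k != 1 -> 0 < 1 :> R by rewrite ltr01.
  have fB : frm k (Q *m block k (C * b * i) (- (S * i)) 1 0).
    apply: frmM => //; apply: frm_block; [|by rewrite !mulr_gt0|ring].
    transitivity (i ^+ 2 - i ^+ 2 * e ^+ 2 + i ^+ 2 * k * S ^+ 2 * e ^+ 2); first by ring: hC hb.
    by rewrite hi; ring.
  have [hB _] := fB.
  rewrite -(lineF_stab b e hk hB one p1).
  have fG : frm k (Q *m block k (C * b * i) (- (S * i)) 1 0 *m stab k 1 0 b e).
    by apply: frmM => //; exact: frm_stab.
  have := hreach_step_any alpha hk fG t0; rewrite /screw ct st -/C -/S.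
  have fL : frm k (block k C S 0 1) by apply: frm_block => //; ring.
  have [hL _] := frmM hk fG fL.
  suff -> : lineF k (Q *m block k (C * b * i) (- (S * i)) 1 0 *m stab k 1 0 b e *m block k C S 0 1)
    = tline k Q (C * e) y by [].
  move: hL; rewrite -!mulmxA /block /stab !mx4_mul => hL.
  apply: (lineF_tline (c := b * i) (s := S * e * i)) => //.
  - transitivity (i ^+ 2 - i ^+ 2 * e ^+ 2 + i ^+ 2 * k * S ^+ 2 * e ^+ 2); first by ring: hb.
    by rewrite hi; ring.
  - by rewrite mulr_gt0.
  - have e0 : i ^+ 2 - i ^+ 2 * e ^+ 2 + i ^+ 2 * k * S ^+ 2 * e ^+ 2 = 1 by rewrite hi; ring.
    by split; [apply: etrans e0|..]; ring: hb hC.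
  - have e0 : i ^+ 2 - i ^+ 2 * e ^+ 2 + i ^+ 2 * k * S ^+ 2 * e ^+ 2 = 1 by rewrite hi; ring.
    split; rewrite ?yE; [by ring: hC hb| |by ring|by ring].
    by rewrite -[RHS]mul1r -[X in _ = X * _]e0; ring: hb hC.
apply: hreach_trans (hreach_sym hk (key d erefl)) _.
by have := key (- d) (sqrrN d); rewrite mulrN.
Qed.

(* On the sphere, after a quarter of a great circle all the arcs issued from the
   translates of a geodesic meet at its pole. *)
Lemma turnable_pole (R : realType) (alpha : R) : -1 < alpha < 1 -> turnable 1 alpha.
Proof.
move=> a1; have hk := @curvature1 R; pose t : R := pi / 2.
have t0 : t != 0 by rewrite gt_eqF// divr_gt0// pi_gt0.
have ct : cos t = 0 by exact: cos_pihalf.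
have st : sin t = 1 by exact: sin_pihalf.
set C := cos (alpha * t); set S := sin (alpha * t).
have C0 : 0 < C.
  by rewrite /C /t; apply: cos_gt0_pihalf; have := @pi_gt0 R; nra.
have hC' : C ^+ 2 + S ^+ 2 = 1 by exact: cos2Dsin2.
have hC : C ^+ 2 = 1 - S ^+ 2 by rewrite -hC'; ring.
exists (C / 2); first by rewrite divr_gt0.
move=> Q x y fQ xy y0 xC.
have [b b0] := pyth_half (norm_div_half C0 xC); set d := x / C => hb'.
have xE : x = C * d by rewrite /d mulrC divfK// gt_eqF.
have hb : b ^+ 2 = 1 - d ^+ 2 by rewrite -hb'; ring.
clearbody d; rewrite xE in xy *; clear xC xE x.
pose i := y^-1; have iy : i * y = 1 by rewrite mulVf// gt_eqF.
have yy : y ^+ 2 = C ^+ 2 * b ^+ 2 + S ^+ 2.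
  by rewrite hb -[LHS](addKr ((C * d) ^+ 2)) xy; ring: hC.
have yE : y = i * (C ^+ 2 * b ^+ 2 + S ^+ 2).
  by rewrite -yy expr2 mulrA iy mul1r.
have hi : i ^+ 2 * (C ^+ 2 * b ^+ 2 + S ^+ 2) = 1.
  by rewrite -yy -exprMn iy expr1n.
have iC : (i * S) ^+ 2 + (i * (C * b)) ^+ 2 = 1 by rewrite -hi; ring.
clearbody i.
have n1 (P : Prop) : (1 : R) != 1 -> P by rewrite eqxx.
(* Here [stab] slides the base point by an arc of cosine b and sine e and keeps A = [col 0 Q], the
   pole reached after a quarter circle. The angular part (S / y, C b / y) of the starting frame puts
   the final velocity in the plane of [col 1 Q] and [col 3 Q]. *)
have key (e : R) : e ^+ 2 = d ^+ 2 ->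
    hreach 1 alpha (lineF 1 (Q *m block 1 0 (-1) (i * S) (i * (C * b)))) (tline 1 Q (C * e) y).
  move=> ed; rewrite -ed in hb' hb.
  have one : 1 ^+ 2 + 0 ^+ 2 = 1 :> R by ring.
  have fB : frm 1 (Q *m block 1 0 (-1) (i * S) (i * (C * b))).
    by apply: frmM => //; apply: frm_block => //; [ring|exact: n1].
  have [hB _] := fB.
  have hb1 : b ^+ 2 + 1 * e ^+ 2 = 1 by rewrite mul1r.
  rewrite -(lineF_stab 1 0 hk hB hb1 (n1 _)).
  have fG : frm 1 (Q *m block 1 0 (-1) (i * S) (i * (C * b)) *m stab 1 b e 1 0).
    by apply: frmM => //; apply: frm_stab => //; exact: n1.
  have := hreach_step_any alpha hk fG t0; rewrite /screw kcos1E ksin1E ct st -/C -/S.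
  have fL : frm 1 (block 1 0 1 C S) by apply: frm_block => //; [ring|exact: n1].
  have [hL _] := frmM hk fG fL.
  suff -> : lineF 1 (Q *m block 1 0 (-1) (i * S) (i * (C * b)) *m stab 1 b e 1 0 *m block 1 0 1 C S)
    = tline 1 Q (C * e) y by [].
  move: hL; rewrite -!mulmxA /block /stab !mx4_mul => hL.
  apply: (lineF_tline (c := 1) (s := 0)) => //; [by ring|by split; ring|].
  by split; rewrite ?yE; ring.
apply: hreach_trans (hreach_sym hk (key d erefl)) _.
by have := key (- d) (sqrrN d); rewrite mulrN.
Qed.

(** With alpha = 0 the geodesic is pushed without rotation inside a hyperbolic plane. Pushed for
    time 1 from the points at distance beta on either side of a midpoint, it gives two geodesics
    that meet on the perpendicular at the midpoint. Each closes a Lambert quadrilateral with acute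
    angle phi, where cos phi = sinh 1 sinh beta; so d = x / S is sinh beta up to sign and a is cosh
    beta. *)
Lemma turnable_hyperbolic (R : realType) : turnable (-1 : R) 0.
Proof.
have hk : curvature (-1 : R) by apply: Or33.
set C := kcos (-1 : R) 1; set S := ksin (-1 : R) 1.
have hC' : C ^+ 2 + -1 * S ^+ 2 = 1 by exact: kcos2Dksin2.
have hC : C ^+ 2 = 1 + S ^+ 2 by rewrite -hC'; ring.
have C0 : 0 < C by apply: kcos_gt0 => //; rewrite curvatureN1.
have S0 : 0 < S by rewrite /S ksinN1E divr_gt0// subr_gt0 ltr_expR; lra.
exists 1 => // Q x y fQ xy y0 _; pose d := x / S.
have xE : x = - S * - d by rewrite /d mulrNN mulrC divfK// gt_eqF.
have a0 : 0 < 1 + d ^+ 2 by have := sqr_ge0 d; lra.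
pose a := Num.sqrt (1 + d ^+ 2).
have ha : a ^+ 2 = 1 + d ^+ 2 by rewrite /a sqr_sqrtr// ltW.
have {}a0 : 0 < a by rewrite sqrtr_gt0.
clearbody d a; rewrite xE in xy *; clear xE x.
pose i := y^-1; have iy : i * y = 1 by rewrite mulVf// gt_eqF.
have i0 : 0 < i by rewrite invr_gt0.
have yy : y ^+ 2 = 1 - S ^+ 2 * d ^+ 2 by rewrite -xy; ring.
have yE : y = i * (1 - S ^+ 2 * d ^+ 2) by rewrite -yy expr2 mulrA iy mul1r.
have hi : i ^+ 2 * (1 - S ^+ 2 * d ^+ 2) = 1 by rewrite -yy -exprMn iy expr1n.
clearbody i.
have p1 : (-1 : R) != 1 -> 0 < 1 :> R by rewrite ltr01.
have key (e : R) : e ^+ 2 = d ^+ 2 ->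
    hreach (-1) 0 (lineF (-1) (Q *m block (-1) (C * i) (- (a * S * i)) 0 1))
      (tline (-1) Q (- S * e) y).
  move=> ed; rewrite -ed in hi ha yE.
  have fB : frm (-1) (Q *m block (-1) (C * i) (- (a * S * i)) 0 1).
    apply: frmM => //; apply: frm_block; [|by rewrite mulr_gt0|ring].
    by apply: etrans hi; ring: hC ha.
  have [hB _] := fB.
  have hae : a ^+ 2 + -1 * e ^+ 2 = 1 by rewrite ha; ring.
  rewrite -(lineF_stab 1 0 hk hB hae (fun=> a0)).
  have fG : frm (-1) (Q *m block (-1) (C * i) (- (a * S * i)) 0 1 *m stab (-1) a e 1 0).
    by apply: frmM => //; apply: frm_stab => //; ring.
  have := hreach_step_any 0 hk fG (oner_neq0 R); rewrite /screw mul0r cos0 sin0 -/C -/S.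
  have fL : frm (-1) (block (-1) C S 1 0) by apply: frm_block => //; ring.
  have [hL _] := frmM hk fG fL.
  suff -> : lineF (-1) (Q *m block (-1) (C * i) (- (a * S * i)) 0 1 *m stab (-1) a e 1 0
      *m block (-1) C S 1 0) = tline (-1) Q (- S * e) y by [].
  move: hL; rewrite -!mulmxA /block /stab !mx4_mul => hL.
  apply: (lineF_tline (c := a * i) (s := - (C * e * i))) => //.
  - by apply: etrans hi; ring: hC ha.
  - by rewrite mulr_gt0.
  - by split; [apply: etrans hi|..]; ring: hC ha.
  - split; rewrite ?yE; [by ring: hC ha| |by ring: hC ha|by ring: hC ha].
    by rewrite -[RHS]mul1r -[X in _ = X * _]hi; ring: hC ha.
apply: hreach_trans (hreach_sym hk (key (- d) (sqrrN d))) _.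
by have := key d erefl; rewrite !mulrN !opprK.
Qed.

(** When alpha is nonzero a quarter turn takes the time pi / (2 alpha). On the sphere
    [turnable_quarter] wants the cosine of this time to be positive, which |alpha| > 1 ensures. The
    sphere with |alpha| < 1 and the hyperbolic space with alpha = 0 have their own constructions. *)
Lemma turnable_neq (R : realType) (k alpha : R) : curvature k -> alpha ^+ 2 <> k ->
  turnable k alpha.
Proof.
move=> hk ak; have [[k1 a1]|] := pselect (k = 1 /\ -1 < alpha < 1).
  by rewrite k1; exact: turnable_pole.
have [[-> ->] _|n1 n2] := pselect (k = -1 /\ alpha = 0); first exact: turnable_hyperbolic.
have a0 : alpha != 0.
  apply/eqP => a0; move: ak n1 n2; rewrite a0 expr0n /=; case: hk => -> ak n1 n2; first exact: ak.
  - by apply: n2; split=> //; rewrite ltrN10 ltr01.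
  - exact: n1.
have at_ : alpha * (pi / 2 / alpha) = pi / 2 by rewrite mulrC divfK.
apply: (@turnable_quarter _ k alpha (pi / 2 / alpha)) => //.
- by apply: mulf_neq0; [rewrite gt_eqF// divr_gt0 ?pi_gt0|rewrite invr_eq0].
- by rewrite at_ cos_pihalf.
- by rewrite at_ sin_pihalf.
- case: hk ak n1 n2 => -> ak n1 n2; rewrite ?kcos0E ?ltr01//; last first.
    by apply: kcos_gt0; [exact: Or33|rewrite curvatureN1].
  have a1 : 1 < alpha \/ alpha < -1.
    have [?|h1] := ltP 1 alpha; [by left|right].
    have [//|h2] := ltP alpha (-1); exfalso.
    have [e|e1] := eqVneq alpha 1; first by apply: ak; rewrite e; ring.
    have [e|e2] := eqVneq alpha (-1); first by apply: ak; rewrite e; ring.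
    by apply: n2; split=> //; rewrite !lt_neqAle h1 h2 e1 eq_sym e2.
  rewrite kcos1E; apply: cos_gt0_pihalf.
  have p0 : 0 < pi / 2 :> R by rewrite divr_gt0// pi_gt0.
  set h := pi / 2 in p0 *; case: a1 => a1.
    have : 0 < h / alpha by rewrite divr_gt0//; lra.
    have : h / alpha < h by rewrite ltr_pdivrMr; nra.
    by move=> ? ?; apply/andP; split; lra.
  have : 0 < h / - alpha by rewrite divr_gt0//; lra.
  have : h / - alpha < h by rewrite ltr_pdivrMr; nra.
  by rewrite invrN mulrN => ? ?; apply/andP; split; lra.
Qed.

Lemma small_angle (R : realType) (x0 : R) : 0 < x0 ->
  exists2 d, 0 < d & forall a : R, `|a| < d -> `|sin a| <= x0 /\ 0 < cos a.
Proof.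
move=> x00; have hs := @continuous_sin R 0; have hc := @continuous_cos R 0.
move/cvgrPdist_lt: hs => /(_ x0 x00); rewrite sin0 => hs.
move/cvgrPdist_lt: hc => /(_ 1 ltr01); rewrite cos0 => hc.
have : \forall a \near (0 : R), `|sin a| <= x0 /\ 0 < cos a.
  near=> a; split.
    by have := near hs a; rewrite sub0r normrN => h; apply: ltW; apply: h.
  have : `|1 - cos a| < 1 by near: a.
  by rewrite ltr_norml => /andP[]; lra.
move=> /nbhs_ballP[d /= d0 hd]; exists d => // a ad; apply: hd.
by rewrite /ball /= sub0r normrN.
Unshelve. all: by end_near. Qed.

(* The planes spanned by columns 2 and 3 and by columns 1 and 3 are exchanged, so that
   the turn of the geodesic [col 2 Q] appears as a symmetric turn about [col 3]. *)
Lemma hreach_small_turn (R : realType) (k alpha x0 a : R) Q : curvature k ->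
  (forall Q x y, frm k Q -> x ^+ 2 + y ^+ 2 = 1 -> 0 < y -> `|x| <= x0 ->
    hreach k alpha (tline k Q x y) (tline k Q (- x) y)) ->
  frm k Q -> `|sin a| <= x0 -> 0 < cos a ->
  hreach k alpha (lineF k Q) (lineF k (Q *m screw k 0 (2 * a))).
Proof.
move=> hk ht fQ sa ca.
pose M : 'M[R]_4 := mx4 1 0 0 0 0 0 (-1) 0 0 0 0 1 0 (-1) 0 0.
have fM : frm k M.
  split; last by rewrite det4 !mxE !ord4E /=; lra.
  by split; [rewrite /M /Qmx; mx4calc|rewrite /M /Lmx; mx4calc|rewrite mxE /= ltr01].
have fQ' : frm k (Q *m (screw k 0 a *m M)).
  by apply: frmM => //; apply: frmM => //; exact: frm_screw.
have cs : cos a ^+ 2 + sin a ^+ 2 = 1 by exact: cos2Dsin2.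
have := ht _ (sin a) (cos a) fQ'; rewrite addrC cs => /(_ erefl ca sa).
have cE x : x *: col 1 (Q *m (screw k 0 a *m M)) + cos a *: col 3 (Q *m (screw k 0 a *m M)) =
    (x * sin a + cos a ^+ 2) *: col 2 Q + (cos a * sin a - x * cos a) *: col 3 Q.
  rewrite /screw /block /M mx4_mul !col_mulmx4 !mxE !ord4E /=.
  by apply/colP => i; rewrite !mxE; ring.
rewrite /tline !cE.
have -> : col 0 (Q *m (screw k 0 a *m M)) = col 0 Q.
  rewrite /screw /block /M mx4_mul !col_mulmx4 !mxE !ord4E /= kcos_0// ksin_0//.
  by apply/colP => i; rewrite !mxE; ring.
rewrite /lineF !col_screw kcos_0// ksin_0// scale1r scale0r addr0.
rewrite [2 * a]mulr_natl cos_mulr2n sin_mulr2n.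
have c2 : cos a ^+ 2 = 1 - sin a ^+ 2 by rewrite -cs; ring.
have -> : (sin a * sin a + cos a ^+ 2) *: col 2 Q +
    (cos a * sin a - sin a * cos a) *: col 3 Q = col 2 Q.
  by apply/colP => i; rewrite !mxE; ring: c2.
suff -> : (- sin a * sin a + cos a ^+ 2) *: col 2 Q + (cos a * sin a - - sin a * cos a) *: col 3 Q =
  (cos a ^+ 2 *+ 2 - 1) *: col 2 Q + (cos a * sin a) *+ 2 *: col 3 Q by [].
by apply/colP => i; rewrite !mxE; ring: c2.
Qed.

(** The turn is cut into n equal small ones, n coming from the Archimedean property; since
    [hreach_small_turn] turns by 2 a, one takes a = th / (2 n). *)
Lemma hreach_turn (R : realType) (k alpha th : R) Q : curvature k -> turnable k alpha ->
  frm k Q -> hreach k alpha (lineF k Q) (lineF k (Q *m screw k 0 th)).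
Proof.
move=> hk [x0 x00 ht] fQ; have [d d0 hd] := small_angle x00.
set n := Num.bound (`|th| / d).
have nth : `|th| / d < n%:R by apply: archi_boundP; rewrite divr_ge0// ltW.
have n0 : 0 < n%:R :> R by apply: le_lt_trans nth; rewrite divr_ge0// ltW.
pose a := th / n%:R / 2; have ad : `|a| < d.
  rewrite /a !normrM !normfV (gtr0_norm n0) (ger0_norm (ler0n _ 2)).
  rewrite ltr_pdivrMr// in nth; rewrite -mulrA -invfM ltr_pdivrMr ?mulr_gt0//.
  by have := mulr_gt0 n0 d0; lra.
have [sa ca] := hd a ad.
suff h m : hreach k alpha (lineF k Q) (lineF k (Q *m screw k 0 (m%:R * (2 * a)))).
  have := h n; suff -> : n%:R * (2 * a) = th by [].
  by rewrite /a; field; rewrite gt_eqF.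
elim: m => [|m ih]; first by rewrite mul0r screw0// mulmx1; exact: hreach_refl.
apply: hreach_trans ih _.
have fQ' : frm k (Q *m screw k 0 (m%:R * (2 * a))) by apply: frmM => //; exact: frm_screw.
have := hreach_small_turn hk ht fQ' sa ca.
by rewrite -mulmxA -screwD// addr0 -[m.+1%:R]natr1 [(m%:R + 1) * _]mulrDl [1 * (2 * a)]mul1r.
Qed.

(** * From turns to all geodesics *)

Definition connecting (R : realType) (k alpha : R) (G : 'M[R]_4) : Prop :=
  frm k G /\ forall Q, frm k Q -> hreach k alpha (lineF k Q) (lineF k (Q *m G)).

Lemma circle_angle (R : realType) (c s : R) : c ^+ 2 + s ^+ 2 = 1 ->
  exists th, cos th = c /\ sin th = s.
Proof.
move=> cs; have [|//|a] := kcs_surj (@curvature1 R) (c := c) (s := s).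
- by rewrite mul1r.
- by rewrite eqxx.
- by rewrite kcos1E ksin1E => h; exists a.
Qed.

Lemma polar2 (R : realType) (a b : R) : exists r c s,
  [/\ a = r * c, b = r * s, c ^+ 2 + s ^+ 2 = 1, 0 <= r & r ^+ 2 = a ^+ 2 + b ^+ 2].
Proof.
have h : 0 <= a ^+ 2 + b ^+ 2 by rewrite addr_ge0// sqr_ge0.
set r := Num.sqrt (a ^+ 2 + b ^+ 2).
have r2 : r ^+ 2 = a ^+ 2 + b ^+ 2 by rewrite sqr_sqrtr.
have r0 : 0 <= r by exact: sqrtr_ge0.
clearbody r; have [e|rn0] := eqVneq r 0.
  move: r2; rewrite e expr0n /= => r2; have a2 := sqr_ge0 a; have b2 := sqr_ge0 b.
  have -> : a = 0 by apply/eqP; rewrite -sqrf_eq0; apply/eqP; lra.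
  have -> : b = 0 by apply/eqP; rewrite -sqrf_eq0; apply/eqP; lra.
  by exists 0, 1, 0; split=> //; ring.
exists r, (a / r), (b / r); split=> //; try (by rewrite mulrC divfK).
by rewrite !exprMn -mulrDl -r2 exprVn divff// sqrf_eq0.
Qed.

(** Spherical coordinates: (c, a) = r (u, v) and (b, r) = (cos th, sin th). The factor
    [screw k 0 th] rotates the plane of coordinates 2 and 3, and [stab k 1 0 u v] that of
    coordinates 1 and 3. *)
Lemma rotation_exists (R : realType) (k : R) (P : set 'M[R]_4) (a b c : R) : curvature k ->
  (forall F G, P F -> P G -> P (F *m G)) ->
  (forall th, P (screw k 0 th)) ->
  (forall c s c' s', c ^+ 2 + k * s ^+ 2 = 1 -> (k != 1 -> 0 < c) -> c' ^+ 2 + s' ^+ 2 = 1 ->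
    P (stab k c s c' s')) ->
  a ^+ 2 + b ^+ 2 + c ^+ 2 = 1 ->
  exists2 F, P F & col 0 F = col4 1 0 0 0 /\ col 2 F = col4 0 a b c.
Proof.
move=> hk PM Psc Pst abc.
have [r [u [v [cE aE uv r0 r2]]]] := polar2 c a.
have [th [cth sth]] : exists th, cos th = b /\ sin th = r.
  by apply: circle_angle; rewrite r2 -abc; ring.
exists (stab k 1 0 u v *m screw k 0 th).
  by apply: PM => //; apply: Pst => //; ring.
rewrite /stab /screw /block mx4_mul kcos_0// ksin_0// cth sth; split.
  by apply: colP4; rewrite !mxE !ord4E /=; ring.
by apply: colP4; rewrite !mxE !ord4E /= ?cE ?aE; ring.
Qed.

(** [P] is abstract because the construction serves twice: with [frm] it equips every geodesic with
    a frame, and with [connecting] it shows that every geodesic is reached from that of the identity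
    frame. *)
Lemma frame_exists (R : realType) (k : R) (P : set 'M[R]_4) p v : curvature k ->
  (forall F G, P F -> P G -> P (F *m G)) -> (forall F, P F -> isoG k F) ->
  (forall th, P (screw k 0 th)) ->
  (forall c s c' s', c ^+ 2 + k * s ^+ 2 = 1 -> (k != 1 -> 0 < c) -> c' ^+ 2 + s' ^+ 2 = 1 ->
    P (stab k c s c' s')) ->
  unit_tangent k p v -> exists2 F, P F & col 0 F = p /\ col 2 F = v.
Proof.
move=> hk PM PG Psc Pst hpv; have [[Mp p0] Tv v1] := hpv.
(* p = (p_0, r n) with n a unit vector: [F1] aims the geodesic of e_0 at n, [stab] slides it to p,
   and [F2] then adjusts the velocity. *)
have [r [n1 [n2 [n3 [r0 n123 p1 p2 p3]]]]] : exists r n1 n2 n3,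
    [/\ 0 <= r, n1 ^+ 2 + n2 ^+ 2 + n3 ^+ 2 = 1, p 1 0 = r * n1, p 2 0 = r * n2 & p 3 0 = r * n3].
  have [r1 [c1 [s1 [e1 e2 cs1 r10 r12]]]] := polar2 (p 1 0) (p 2 0).
  have [r [c2 [s2 [e3 e4 cs2 r0 r2]]]] := polar2 r1 (p 3 0).
  exists r, (c2 * c1), (c2 * s1), s2; split=> //.
  - by rewrite -cs2 -[c2 ^+ 2]mulr1 -cs1; ring.
  - by rewrite e1 e3 mulrA.
  - by rewrite e2 e3 mulrA.
have [F1 PF1 [F10 F12]] := rotation_exists hk PM Psc Pst n123.
have cr : p 0 0 ^+ 2 + k * r ^+ 2 = 1.
  rewrite level_formE p1 p2 p3 in Mp; rewrite -[RHS]Mp -[r ^+ 2]mulr1 -n123; ring.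
pose G := F1 *m stab k (p 0 0) r 1 0.
have PG1 : P G by apply: PM => //; apply: Pst => //; ring.
have G0 : col 0 G = p.
  rewrite /G /stab mx4_col F10 F12.
  by apply: colP4; rewrite !mxE !ord4E /= ?p1 ?p2 ?p3; ring.
have hG := PG _ PG1; have [uG hV] := isoG_inv hk hG.
pose w := invmx G *m v; have wE : G *m w = v by rewrite mulKVmx.
have e0 : invmx G *m p = col4 1 0 0 0.
  rewrite -G0 -col_mulmx mulVmx//; apply: colP4; by rewrite !mxE.
have [_ Tw w1] := isoG_unit_tangent hk hV hpv; rewrite -/w e0 in Tw w1.
clearbody w.
have w0 : w 0 0 = 0.
  by move: Tw; rewrite /tangent /= level_formE !mxE !ord4E /= => <-; ring.
have ww : w 1 0 ^+ 2 + w 2 0 ^+ 2 + w 3 0 ^+ 2 = 1 by rewrite -w1 metricE w0; ring.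
have [F2 PF2 [F20 F22]] := rotation_exists hk PM Psc Pst ww.
exists (G *m F2); first exact: PM.
rewrite !col_mulmx F20 F22; split.
  by rewrite -e0 mulKVmx.
by rewrite -[RHS]wE; congr (_ *m _); apply: colP4; rewrite !mxE.
Qed.

Lemma frm_exists (R : realType) (k : R) l : curvature k -> oriented_geodesics k l ->
  exists2 F, frm k F & l = lineF k F.
Proof.
move=> hk /(oriented_geodesicsP _ hk) [p [v [hpv ->]]].
have [| | | |F fF [F0 F2]] := frame_exists (P := frm k) hk _ _ _ _ hpv.
- by move=> F G; exact: frmM.
- by move=> F [].
- by move=> th; exact: frm_screw.
- by move=> *; exact: frm_stab.
- by exists F => //; rewrite /lineF F0 F2.
Qed.

(** The quantification over all frames in [connecting] is what makes it multiplicative: the second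
    move starts from [Q *m F]. *)
Lemma connectingM (R : realType) (k alpha : R) F G : curvature k ->
  connecting k alpha F -> connecting k alpha G -> connecting k alpha (F *m G).
Proof.
move=> hk [fF hF] [fG hG]; split; first exact: frmM.
move=> Q fQ; rewrite mulmxA; apply: hreach_trans (hF _ fQ) _.
by apply: hG; exact: frmM.
Qed.

Lemma hreach_all (R : realType) (k alpha : R) l1 l2 : curvature k -> alpha ^+ 2 <> k ->
  oriented_geodesics k l1 -> oriented_geodesics k l2 -> hreach k alpha l1 l2.
Proof.
move=> hk ak.
suff h l : oriented_geodesics k l -> hreach k alpha (lineF k 1%:M) l.
  by move=> h1 h2; apply: hreach_trans (h _ h2); apply: hreach_sym => //; exact: h.
move=> /(oriented_geodesicsP _ hk) [p [v [hpv ->]]].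
have [| | | |F [fF hF] [F0 F2]] := frame_exists (P := connecting k alpha) hk _ _ _ _ hpv.
- by move=> F G; exact: connectingM.
- by move=> F [[]].
- move=> th; split; first exact: frm_screw.
  by move=> Q fQ; apply: hreach_turn => //; exact: turnable_neq.
- move=> c s c' s' cs c0 cs'; split; first exact: frm_stab.
  by move=> Q fQ; rewrite lineF_stab//; [exact: hreach_refl|case: fQ].
- have f1 : frm k 1%:M by rewrite -(screw0 hk); exact: frm_screw.
  by have := hF _ f1; rewrite mul1mx /lineF F0 F2.
Qed.

(** * The Lie algebras of the isometry group and of the isotropy groups *)

Definition lieG (R : realType) (k : R) (X : 'M[R]_4) : Prop :=
  X *m Qmx k + Qmx k *m X^T = 0 /\ X^T *m Lmx k + Lmx k *m X = 0.

(** The x_i are infinitesimal displacements of e_0 along the three axes, the y_i infinitesimal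
    rotations about them. *)
Definition lie_mx (R : realType) (k x1 x2 x3 y1 y2 y3 : R) : 'M[R]_4 := mx4
  0 (- (k * x1)) (- (k * x2)) (- (k * x3))
  x1 0 (- y3) y2 x2 y3 0 (- y1) x3 (- y2) y1 0.

Lemma mx4_add (R : realType) (a00 a01 a02 a03 a10 a11 a12 a13 a20 a21 a22 a23 a30 a31 a32 a33
    b00 b01 b02 b03 b10 b11 b12 b13 b20 b21 b22 b23 b30 b31 b32 b33 : R) :
  mx4 a00 a01 a02 a03 a10 a11 a12 a13 a20 a21 a22 a23 a30 a31 a32 a33 +
  mx4 b00 b01 b02 b03 b10 b11 b12 b13 b20 b21 b22 b23 b30 b31 b32 b33 =
  mx4 (a00 + b00) (a01 + b01) (a02 + b02) (a03 + b03)
      (a10 + b10) (a11 + b11) (a12 + b12) (a13 + b13)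
      (a20 + b20) (a21 + b21) (a22 + b22) (a23 + b23)
      (a30 + b30) (a31 + b31) (a32 + b32) (a33 + b33).
Proof. by mx4tac. Qed.

Lemma mx4_scale (R : realType)
    (c a00 a01 a02 a03 a10 a11 a12 a13 a20 a21 a22 a23 a30 a31 a32 a33 : R) :
  c *: mx4 a00 a01 a02 a03 a10 a11 a12 a13 a20 a21 a22 a23 a30 a31 a32 a33 =
  mx4 (c * a00) (c * a01) (c * a02) (c * a03) (c * a10) (c * a11) (c * a12) (c * a13)
      (c * a20) (c * a21) (c * a22) (c * a23) (c * a30) (c * a31) (c * a32) (c * a33).
Proof. by mx4tac. Qed.

Lemma mx4_0 (R : realType) : 0 = mx4 0 0 0 0 0 0 0 0 0 0 0 0 0 0 0 0 :> 'M[R]_4.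
Proof. by mx4tac. Qed.

Lemma mx4_eta (R : realType) (M : 'M[R]_4) : M = mx4
  (M 0 0) (M 0 1) (M 0 2) (M 0 3) (M 1 0) (M 1 1) (M 1 2) (M 1 3)
  (M 2 0) (M 2 1) (M 2 2) (M 2 3) (M 3 0) (M 3 1) (M 3 2) (M 3 3).
Proof. by mx4tac. Qed.

Lemma lie_mx_lieG (R : realType) (k x1 x2 x3 y1 y2 y3 : R) : lieG k (lie_mx k x1 x2 x3 y1 y2 y3).
Proof.
by split; rewrite /lie_mx /Qmx /Lmx mx4_tr !mx4_mul mx4_add mx4_0; congr mx4; ring.
Qed.

Lemma lieG_lie_mx (R : realType) (k : R) X : lieG k X ->
  X = lie_mx k (X 1 0) (X 2 0) (X 3 0) (X 3 2) (X 1 3) (X 2 1).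
Proof.
move=> [hQ hL]; have q i j := congr1 (fun M : 'M[R]_4 => M i j) hQ.
have l00 := congr1 (fun M : 'M[R]_4 => M 0 0) hL.
move: l00 (q 1 0) (q 2 0) (q 3 0) (q 1 1) (q 2 2) (q 3 3) (q 1 2) (q 2 3) (q 3 1) => {hQ hL q}.
rewrite [X]mx4_eta /Qmx /Lmx !mx4_tr !mx4_mul !mx4_add !mxE !ord4E /=.
move=> ? ? ? ? ? ? ? ? ? ?; rewrite /lie_mx; congr mx4; lra.
Qed.

Lemma lieG_conj (R : realType) (k : R) F X : curvature k -> isoG k F -> lieG k X ->
  lieG k (F *m X *m invmx F).
Proof.
move=> hk hF [hQ hL]; have [uF [VQ VL _]] := isoG_inv hk hF; have [FQ FL _] := hF.
have e1 : invmx F *m Qmx k = Qmx k *m F^T by rewrite -[in LHS]FQ -!mulmxA mulKmx.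
have e2 : Lmx k *m F = (invmx F)^T *m Lmx k.
  by rewrite -[in RHS]FL !mulmxA -trmx_mul mulmxV// trmx1 mul1mx.
have e1' : Qmx k *m (invmx F)^T = F *m Qmx k.
  by rewrite -[in LHS]FQ -!mulmxA -trmx_mul mulVmx// trmx1 mulmx1.
have e2' : F^T *m Lmx k = Lmx k *m invmx F.
  by rewrite -[in RHS]FL -!mulmxA mulmxV// mulmx1.
split.
  rewrite !trmx_mul -!mulmxA e1 (mulmxA (Qmx k)) e1' -!mulmxA -mulmxDr !mulmxA -mulmxDl.
  by rewrite hQ mul0mx mulmx0.
rewrite !trmx_mul -!mulmxA e2' (mulmxA (Lmx k)) e2 -!mulmxA -mulmxDr !mulmxA -mulmxDl.
by rewrite hL mul0mx mulmx0.
Qed.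

Lemma is_derive_near_cst (R : realType) (f : R -> R) c (t d : R) :
  is_derive t 1 f d -> (\forall s \near t, f s = c) -> d = 0.
Proof.
move=> [_ <-] fc; rewrite (@near_eq_derive _ _ _ f (cst c) t 1)// derive_cst//.
Qed.

(** Isometries are known only by their effect on points and tangent vectors, so X is tested on
    these: pairs of tangent vectors at e_0 make the spatial block antisymmetric, and points on the
    geodesics from e_0 tie the first row to the first column. *)
Lemma lie_isometries0_lieG (R : realType) (k : R) X : curvature k ->
  lie_algebra (isometries0 k) X -> lieG k X.
Proof.
move=> hk [h [h1 hs hi hX]].
have dh := smooth_at_derive (nbhs_singleton hs); rewrite hX in dh.
have dv (v : 'cV[R]_4) : is_derive (0 : R) 1 (fun s => h s *m v) (X *m v).
  have e := is_derive_mulmx dh (is_derive_cst v (0 : R) 1).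
  by apply: (@is_derive_eq _ _ _ _ _ _ _ _ e); rewrite /cst mulmx0 addr0.
have hi' : \forall s \near (0 : R), isometries k (h s).
  near=> s; have : isometries0 k (h s) by near: s.
  exact: connected_component_sub.
have lev p : space_form k p -> level_form k (X *m p) p = 0.
  move=> Mp; have e := is_derive_form (Lmx k) (dv p) (dv p).
  have : \forall s \near (0 : R), ((h s *m p)^T *m Lmx k *m (h s *m p)) 0 0 = 1.
    near=> s; rewrite -level_form_mx; have [him _] : isometries k (h s) by near: s.
    have : space_form k (h s *m p) by rewrite -him; exists p.
    by case.
  move/(is_derive_near_cst e); rewrite h1 mul1mx -!level_form_mx (level_formC k p); lra.
pose e (j : 'I_4) : 'cV[R]_4 := delta_mx j 0.
have M0 : space_form k (e 0).
  by split=> [|_]; rewrite ?level_formE !mxE /= ?ltr01//; ring.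
have met i j : i != 0 -> j != 0 -> X i j + X j i = 0.
  have T n : n != 0 -> tangent k (e 0) (e n).
    by rewrite /tangent /= level_formE; case: (I4P n) => -> // _; rewrite !mxE /=; ring.
  move=> i0 j0; have d := is_derive_form (Qmx k) (dv (e i)) (dv (e j)).
  have : \forall s \near (0 : R), ((h s *m e i)^T *m Qmx k *m (h s *m e j)) 0 0 =
      metric k (e i) (e j).
    near=> s; rewrite -metric_mx; have [_ him] : isometries k (h s) by near: s.
    by apply: him M0 (T _ i0) (T _ j0).
  move/(is_derive_near_cst d); rewrite h1 !mul1mx -!metric_mx -!colE !metricE.
  by move: i0 j0; case: (I4P i) => ->; case: (I4P j) => -> // _ _; rewrite !mxE /=; lra.
have X0 : X 0 0 = 0.
  by have := lev _ M0; rewrite -colE level_formE !mxE /=; lra.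
(* A rational point of each conic with c s nonzero: the relation obtained at c e_0 + s e_i is to be
   divided by c s. *)
have [c [s [cs c0 s0]]] : exists c s : R, [/\ c ^+ 2 + k * s ^+ 2 = 1, 0 < c & 0 < s].
  by case: hk => ->; [exists 1, 1|exists (3 / 5), (4 / 5)|exists (5 / 3), (4 / 3)]; split; lra.
have Xi i : i != 0 -> X 0 i = - (k * X i 0).
  move=> i0; have Mp : space_form k (c *: e 0 + s *: e i).
    split=> [|_]; move: i0; case: (I4P i) => -> // _; rewrite ?level_formE !mxE /=.
    - by apply: etrans cs; ring.
    - by apply: etrans cs; ring.
    - by apply: etrans cs; ring.
    - by rewrite mulr1 mulr0 addr0.
    - by rewrite mulr1 mulr0 addr0.
    - by rewrite mulr1 mulr0 addr0.
  have Xii : X i i = 0 by have := met i i i0 i0; lra.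
  have := lev _ Mp; rewrite mulmxDr -!scalemxAr -!colE !levelE !level_formE.
  have : c * s != 0 by rewrite mulf_neq0 ?gt_eqF.
  move: Xii i0; case: (I4P i) => -> // Xii _ csn; rewrite !mxE /= X0 Xii => E;
    apply: (mulfI csn); lra.
have -> : X = lie_mx k (X 1 0) (X 2 0) (X 3 0) (X 3 2) (X 1 3) (X 2 1); last exact: lie_mx_lieG.
rewrite /lie_mx {1}[X]mx4_eta X0 !Xi//.
by congr mx4; rewrite ?opprK//;
  move: (met 1 1 isT isT) (met 2 2 isT isT) (met 3 3 isT isT)
    (met 1 2 isT isT) (met 2 3 isT isT) (met 3 1 isT isT); lra.
Unshelve. all: by end_near. Qed.

Lemma lie_path (R : realType) (k : R) (h : R -> 'M[R]_4) X : curvature k ->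
  smooth h -> h 0 = 1%:M -> (forall t, isoG k (h t)) -> is_derive (0 : R) 1 h X ->
  lie_algebra (isometries0 k) X.
Proof.
move=> hk sh h0 hG dX; exists h; split=> //.
- by near=> s; exact: smooth_smooth_at.
- by near=> s; exact: (isometries0_path hk sh h0 hG).
- exact: is_derive_derive1_eq.
Unshelve. all: by end_near. Qed.

Lemma smooth_screw0 (R : realType) (k x y : R) : curvature k ->
  smooth (fun t => screw k (x * t) (y * t)).
Proof.
move=> hk; have := smooth_screw x 0 y 0 hk.
by under eq_fun do rewrite !addr0.
Qed.

Lemma is_derive_screw0 (R : realType) (k x y : R) : curvature k ->
  is_derive (0 : R) 1 (fun t => screw k (x * t) (y * t)) (screw_gen k x y).
Proof.
move=> hk; have := @is_derive_screw _ k x 0 y 0 0 hk; rewrite !mulr0 addr0 => /(_ erefl erefl).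
by under eq_fun do rewrite !addr0.
Qed.

(** Each axis has a one-parameter group carrying its pair (x_i, y_i); the product of the three
    starts at 1 with derivative the sum of the generators. *)
Lemma lieG_lie_isometries0 (R : realType) (k : R) X : curvature k ->
  lieG k X -> lie_algebra (isometries0 k) X.
Proof.
move=> hk /lieG_lie_mx ->; move: (X 1 0) (X 2 0) (X 3 0) (X 3 2) (X 1 3) (X 2 1).
move=> x1 x2 x3 y1 y2 y3 {X}.
set c := cycle3 R; have cc : c *m c^T = 1%:M by exact: cycle3_tr.
have cc' : c^T *m c = 1%:M by exact: mulmx1C.
have [hc _] := frm_cycle3 k; have [_ hc'] := isoG_inv hk hc; rewrite cycle3_inv in hc'.
have hs x y : isoG k (screw k x y) by case: (frm_screw x y hk).
pose h t := screw k (x1 * t) (y1 * t) *m (c *m screw k (x2 * t) (y2 * t) *m c^T)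
  *m (c^T *m screw k (x3 * t) (y3 * t) *m c).
apply: (@lie_path _ k h) => //.
- have s := smooth_screw0 _ _ hk.
  by apply: smooth_mulmx; [apply: smooth_mulmx => //|];
    apply: smooth_mulmxr; apply: smooth_mulmxl.
- by rewrite /h !mulr0 screw0// !mulmx1 cc cc' !mulmx1.
- by move=> t; do !apply: isoGM.
- have d1 := is_derive_screw0 x1 y1 hk.
  have d2 := is_derive_conj c c^T (is_derive_screw0 x2 y2 hk).
  have d3 := is_derive_conj c^T c (is_derive_screw0 x3 y3 hk).
  have d := is_derive_mulmx (is_derive_mulmx d1 d2) d3.
  apply: (@is_derive_eq _ _ _ _ _ _ _ _ d).
  rewrite !mulr0 screw0// !mulmx1 cc cc' !mul1mx !mulmx1.
  rewrite /c /cycle3 /screw_gen /block mx4_tr !mx4_mul !mx4_add /lie_mx.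
  by congr mx4; ring.
Qed.

Lemma plucker_lineF (R : realType) (k : R) F : curvature k -> isoG k F ->
  plucker (lineF k F) = F *m wedge (delta_mx 0 0) (delta_mx 2 0) *m F^T.
Proof.
move=> hk hF; rewrite /lineF (plucker_line hk (frm_unit_tangent hk hF)) !colE.
by rewrite wedge_mulmx.
Qed.

Lemma wedge02 (R : realType) : wedge (delta_mx 0 0) (delta_mx 2 0) =
  mx4 0 0 1 0 0 0 0 0 (-1) 0 0 0 0 0 0 0 :> 'M[R]_4.
Proof.
apply/matrixP => i j; rewrite wedgeE !mxE.
by case: (I4P i) => ->; case: (I4P j) => ->; rewrite !ord4E /=; ring.
Qed.

Lemma conj_sandwich (R : realType) (F Y P : 'M[R]_4) : F \in unitmx ->
  F *m Y *m invmx F *m (F *m P *m F^T) + F *m P *m F^T *m (F *m Y *m invmx F)^T =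
  F *m (Y *m P + P *m Y^T) *m F^T.
Proof.
move=> uF; have FV : F^T *m (invmx F)^T = 1%:M by rewrite -trmx_mul mulVmx// trmx1.
rewrite mulmxDr mulmxDl; congr (_ + _).
  by rewrite -!mulmxA (mulmxA (invmx F)) mulVmx// mul1mx.
by rewrite !trmx_mul -!mulmxA (mulmxA F^T) FV mul1mx.
Qed.

Lemma sandwich_eq0 (R : realType) (F M : 'M[R]_4) : F \in unitmx -> F *m M *m F^T = 0 -> M = 0.
Proof.
move=> uF; have uF' : F^T \in unitmx by rewrite unitmx_tr.
move=> h; rewrite -[M](mulKmx uF) -[F *m M](mulmxK uF') h.
by rewrite mul0mx mulmx0.
Qed.

(** For the converse, conjugation by [F] reduces to the geodesic of e_0 and e_2. Annihilating e_0 ^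
    e_2 leaves only x2 and y2, the translation along this geodesic and the rotation about it, which
    integrate to [stab]. *)
Lemma lie_isotropyP (R : realType) (k : R) F X : curvature k -> frm k F ->
  lie_algebra (isotropy k (lineF k F)) X <->
  lieG k X /\ X *m plucker (lineF k F) + plucker (lineF k F) *m X^T = 0.
Proof.
move=> hk fF; have [hF _] := fF; have ol : oriented_geodesics k (lineF k F).
  by apply: oriented_line => //; exact: frm_unit_tangent.
split=> [hX|[gX]].
  split; last exact: lie_isotropy_plucker hX.
  apply: lie_isometries0_lieG => //; move: hX => [h [h1 hs hi hX]]; exists h; split=> //.
  by near=> s; have [|] := near hi s.
have [uF hV] := isoG_inv hk hF.
have gY := lieG_conj hk hV gX; rewrite invmxK in gY.
set Y := invmx F *m X *m F in gY; have XE : X = F *m Y *m invmx F.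
  by rewrite /Y !mulmxA mulmxV// mul1mx mulmxK.
rewrite plucker_lineF// {1 2}XE conj_sandwich// => /(sandwich_eq0 uF) hP.
move: hP; rewrite [Y](lieG_lie_mx gY) XE [Y](lieG_lie_mx gY).
move: (Y 1 0) (Y 2 0) (Y 3 0) (Y 3 2) (Y 1 3) (Y 2 1) => x1 x2 x3 y1 y2 y3.
rewrite wedge02 /lie_mx mx4_tr !mx4_mul !mx4_add => hP.
have h i j := congr1 (fun M : 'M[R]_4 => M i j) hP.
have := h 0 1; have := h 0 3; have := h 1 2; have := h 2 3; rewrite !mxE !ord4E /= => h1 h2 h3 h4.
have -> : x1 = 0 by lra.
have -> : x3 = 0 by lra.
have -> : y1 = 0 by lra.
have -> : y3 = 0 by lra.
pose H t :=
  F *m stab k (kcos k (x2 * t)) (ksin k (x2 * t)) (cos (y2 * t)) (sin (y2 * t)) *m invmx F.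
have sE t : stab k (kcos k (x2 * t)) (ksin k (x2 * t)) (cos (y2 * t)) (sin (y2 * t)) =
    cycle3 R *m screw k (x2 * t) (y2 * t) *m (cycle3 R)^T.
  by rewrite /cycle3 /screw /block /stab; mx4calc.
have HE : H = fun t => F *m (cycle3 R *m screw k (x2 * t) (y2 * t) *m (cycle3 R)^T) *m invmx F.
  by apply/funext => t; rewrite /H sE.
have sH : smooth H.
  rewrite HE; apply: smooth_mulmxr; apply: smooth_mulmxl; apply: smooth_mulmxr.
  by apply: smooth_mulmxl; exact: smooth_screw0.
have fS t : frm k (stab k (kcos k (x2 * t)) (ksin k (x2 * t)) (cos (y2 * t)) (sin (y2 * t))).
  by apply: frm_stab => //; [exact: kcos2Dksin2|exact: kcos_gt0|exact: cos2Dsin2].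
have hH t : isoG k (H t).
  by apply: isoGM => //; apply: isoGM => //; case: (fS t).
have H0 : H 0 = 1%:M.
  by rewrite HE !mulr0 screw0// mulmx1 cycle3_tr mulmx1 mulmxV.
exists H; split=> //.
- by near=> s; exact: smooth_smooth_at.
- near=> s; split; first exact: (isometries0_path hk sH H0 hH).
  rewrite act_lineF// /H mulmxKV// lineF_stab//; [exact: kcos2Dksin2|exact: kcos_gt0].
- apply: is_derive_derive1_eq; rewrite HE.
  have d := is_derive_conj F (invmx F)
    (is_derive_conj (cycle3 R) (cycle3 R)^T (is_derive_screw0 x2 y2 hk)).
  apply: (@is_derive_eq _ _ _ _ _ _ _ _ d); congr (_ *m _ *m _).
  rewrite /cycle3 /screw_gen /block mx4_tr !mx4_mul; congr mx4; ring.
Unshelve. all: by end_near. Qed.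

Lemma lieG_lin (R : realType) (k a b : R) X Y : lieG k X -> lieG k Y -> lieG k (a *: X + b *: Y).
Proof.
move=> [h1 h2] [h3 h4]; split.
  rewrite linearD !linearZ /= mulmxDl mulmxDr addrACA -!scalemxAl -!scalemxAr -!scalerDr.
  by rewrite h1 h3 !scaler0 addr0.
rewrite linearD !linearZ /= mulmxDl mulmxDr addrACA -!scalemxAl -!scalemxAr -!scalerDr.
by rewrite h2 h4 !scaler0 addr0.
Qed.

Lemma derivation_lin (R : realType) (a b : R) (P X Y : 'M[R]_4) :
  (a *: X + b *: Y) *m P + P *m (a *: X + b *: Y)^T =
  a *: (X *m P + P *m X^T) + b *: (Y *m P + P *m Y^T).
Proof.
have -> : (a *: X + b *: Y)^T = a *: X^T + b *: Y^T by rewrite linearD !linearZ.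
by rewrite mulmxDl mulmxDr addrACA -!scalemxAl -!scalemxAr -!scalerDr.
Qed.

(** The definition by curves does not show that the isotropy algebra is a vector space; the linear
    description of [lie_isotropyP] does. *)
Lemma tangent_class_add (R : realType) (k : R) F X Z : curvature k -> frm k F ->
  lie_algebra (isotropy k (lineF k F)) Z ->
  tangent_class k (lineF k F) (X + Z) = tangent_class k (lineF k F) X.
Proof.
move=> hk fF /(lie_isotropyP _ hk fF) [gZ hZ]; apply/seteqP.
set P := plucker _ in hZ.
have add W V : lieG k W -> W *m P + P *m W^T = 0 -> lieG k V -> V *m P + P *m V^T = 0 -> forall a,
    lieG k (W + a *: V) /\ (W + a *: V) *m P + P *m (W + a *: V)^T = 0.
  move=> gW hW gV hV a; rewrite -[W]scale1r; split; first exact: lieG_lin.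
  by rewrite derivation_lin hW hV !scaler0 addr0.
split=> Y; rewrite /tangent_class /= => /(lie_isotropyP _ hk fF) [gY hY];
  apply/(lie_isotropyP _ hk fF).
  have := add _ _ gY hY gZ hZ 1; rewrite scale1r.
  by have -> : Y - (X + Z) + Z = Y - X by rewrite opprD addrA subrK.
have := add _ _ gY hY gZ hZ (-1); rewrite scaleN1r.
by have -> : Y - X - Z = Y - (X + Z) by rewrite opprD addrA.
Qed.

Lemma control_fiber_tangent (R : realType) (k alpha : R) l : curvature k ->
  control_fiber k alpha l `<=` tangent_geod k l.
Proof.
move=> hk u [p [A [Gamma [hG [g [g1 gs gi] uE]]]]].
have [v [B [_ _ _ [G0 _] _]]] := helicoidal_plucker hk hG.
rewrite uE G0; exists (derive1 g 0) => //; exists g; split=> //.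
by near=> s; have [|] := near gi s.
Unshelve. all: by end_near. Qed.

(** [stab] moves p along the geodesic and A about it, so a single geodesic carries a two-parameter
    family of velocities, which the frame [F] turns into conjugates of one generator. *)
Lemma control_fiber_stab (R : realType) (k alpha c s c' s' : R) F : curvature k -> frm k F ->
  c ^+ 2 + k * s ^+ 2 = 1 -> (k != 1 -> 0 < c) -> c' ^+ 2 + s' ^+ 2 = 1 ->
  control_fiber k alpha (lineF k F) (tangent_class k (lineF k F)
    (F *m (stab k c s c' s' *m screw_gen k 1 alpha *m stab k c (- s) c' (- s')) *m invmx F)).
Proof.
move=> hk fF cs c0 cs'; have fN := frm_stab hk cs c0 cs'; have [hF _] := fF.
have fFN := frmM hk fF fN; have uN := frm_unit hk fN; have uF := frm_unit hk fF.
have := control_fiber_lineF alpha hk fFN; rewrite lineF_stab//.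
have inv : stab k c s c' s' *m stab k c (- s) c' (- s') = 1%:M.
  rewrite /stab mx4_mul mx4_1; congr mx4; first [ring|rewrite -cs; ring|rewrite -cs'; ring].
have -> : invmx (F *m stab k c s c' s') = stab k c (- s) c' (- s') *m invmx F.
  have uFN := frm_unit hk fFN; apply: (can_inj (mulKmx uFN)).
  by rewrite mulmxV// !mulmxA -(mulmxA F) inv mulmx1 mulmxV.
by rewrite !mulmxA.
Qed.

Lemma substantial_lineF (R : realType) (k alpha : R) F : curvature k -> alpha ^+ 2 <> k ->
  frm k F -> substantial k (lineF k F) (control_fiber k alpha (lineF k F)).
Proof.
move=> hk ak fF; split; first exact: control_fiber_tangent.
move=> [W [[_ Wt Waff] Wne fW]]; apply: Wne; apply/seteqP; split=> // u [X hX <-].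
have [hF _] := fF; have [uF hV] := isoG_inv hk hF.
set l := lineF k F in Wt Waff fW *.
pose cF Y := F *m Y *m invmx F.
have cFD a b Y Z : cF (a *: Y + b *: Z) = a *: cF Y + b *: cF Z.
  by rewrite /cF mulmxDr mulmxDl -!scalemxAr -!scalemxAl.
pose inW Y := lieG k Y /\ W (tangent_class k l (cF Y)).
have aff r Y Z : inW Y -> inW Z -> inW ((1 - r) *: Y + r *: Z).
  move=> [gY wY] [gZ wZ]; split; first exact: lieG_lin.
  by rewrite cFD; apply: Waff => //; apply: lieG_lie_isometries0 => //; exact: lieG_conj.
have fib c s c' s' : c ^+ 2 + k * s ^+ 2 = 1 -> (k != 1 -> 0 < c) -> c' ^+ 2 + s' ^+ 2 = 1 ->
    lieG k (stab k c s c' s' *m screw_gen k 1 alpha *m stab k c (- s) c' (- s')) ->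
    inW (stab k c s c' s' *m screw_gen k 1 alpha *m stab k c (- s) c' (- s')).
  by move=> cs c0 cs' g; split=> //; apply: fW; exact: control_fiber_stab.
have one : 1 ^+ 2 + k * 0 ^+ 2 = 1 :> R by ring.
have p1 : k != 1 -> 0 < 1 :> R by rewrite ltr01.
have fibE c s c' s' : stab k c s c' s' *m screw_gen k 1 alpha *m stab k c (- s) c' (- s') =
    lie_mx k (c * c' - alpha * s * s') 0 (- (c * s') - alpha * s * c')
      (alpha * c * c' - k * s * s') 0 (- (alpha * c * s') - k * s * c').
  by rewrite /stab /screw_gen /block /lie_mx; mx4calc.
have {}fib c s c' s' : c ^+ 2 + k * s ^+ 2 = 1 -> (k != 1 -> 0 < c) -> c' ^+ 2 + s' ^+ 2 = 1 ->
    inW (lie_mx k (c * c' - alpha * s * s') 0 (- (c * s') - alpha * s * c')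
      (alpha * c * c' - k * s * s') 0 (- (alpha * c * s') - k * s * c')).
  move=> cs c0 cs'; have := fib _ _ _ _ cs c0 cs'; rewrite fibE; apply.
  exact: lie_mx_lieG.
(* A and - A have opposite velocities, whose midpoint is 0: [W] is therefore a linear subspace. *)
have W0 : inW 0.
  have h1 := fib 1 0 1 0 one p1; have h2 := fib 1 0 (-1) 0 one p1.
  have := aff 2^-1 _ _ (h1 _) (h2 _).
  suff -> : forall A B, A = - B -> (1 - 2^-1) *: A + 2^-1 *: B = 0 :> 'M[R]_4.
  - by apply; ring.
  - by rewrite -scaleN1r /lie_mx mx4_scale; congr mx4; ring.
  - move=> A B ->; rewrite scalerN -scaleNr -scalerDl (_ : _ + _ = 0) ?scale0r//; lra.
have scl a Y : inW Y -> inW (a *: Y).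
  by move=> hY; have := aff a _ _ W0 hY; rewrite scaler0 add0r.
have sum Y Z : inW Y -> inW Z -> inW (Y + Z).
  move=> hY hZ; have := aff 2^-1 _ _ (scl 2 _ hY) (scl 2 _ hZ).
  by rewrite !scalerA mulVf ?pnatr_eq0// (_ : (1 - 2^-1) * 2 = 1) ?scale1r//; field.
(* These two coordinates span the isotropy algebra, so they do not affect the class. *)
have iso x y Y : inW Y -> inW (Y + lie_mx k 0 x 0 0 y 0).
  move=> [gY wY]; have gZ := lie_mx_lieG k 0 x 0 0 y 0; split.
    by have := lieG_lin 1 1 gY gZ; rewrite !scale1r.
  rewrite -[Y]scale1r -[lie_mx _ _ _ _ _ _ _]scale1r cFD !scale1r /l tangent_class_add//.
  apply/(lie_isotropyP _ hk fF); split; first exact: lieG_conj.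
  rewrite plucker_lineF// /cF; set Z := lie_mx _ _ _ _ _ _ _; set P := wedge _ _.
  have e : Z *m P + P *m Z^T = 0.
    by rewrite /Z /P wedge02 /lie_mx mx4_tr !mx4_mul mx4_add mx4_0; congr mx4; ring.
  by rewrite conj_sandwich// e mulmx0 mul0mx.
(* A displacement along the geodesic with s nonzero: rotating A alone only yields combinations of
   [U1] and [U3] below. *)
have [c [s [cs c0 s0]]] : exists c s : R, [/\ c ^+ 2 + k * s ^+ 2 = 1, k != 1 -> 0 < c & s != 0].
  by case: hk => ->; [exists 1, 1|exists (3 / 5), (4 / 5)|exists (5 / 3), (4 / 3)];
    (split; [lra|move=> _; lra|by apply/eqP; lra]).
have D0 : alpha ^+ 2 - k != 0 by rewrite subr_eq0; apply/eqP.
have h11 : 1 ^+ 2 + 0 ^+ 2 = 1 :> R by ring.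
have h10 : 0 ^+ 2 + 1 ^+ 2 = 1 :> R by ring.
have U1 := fib 1 0 1 0 one p1 h11.
have U3 := fib 1 0 0 1 one p1 h10.
have V1 := fib c s 1 0 cs c0 h11.
have V2 := fib c s 0 1 cs c0 h10.
have gX := lieG_conj hk hV (lie_isometries0_lieG hk hX); rewrite invmxK in gX.
set Y := invmx F *m X *m F in gX.
have -> : X = cF Y by rewrite /cF /Y !mulmxA mulmxV// mul1mx mulmxK.
suff [] : inW Y by [].
rewrite [Y](lieG_lie_mx gX).
move: (Y 1 0) (Y 2 0) (Y 3 0) (Y 3 2) (Y 1 3) (Y 2 1) => x1 x2 x3 y1 y2 y3.
(* V2 + alpha s U1 - c U3 has y1 = s (alpha^2 - kappa) as its only nonzero coordinate, and V1 - c U1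
   - alpha s U3 has y3 with the same value; hence the denominators. *)
pose b := (y1 - alpha * x1) / (s * (alpha ^+ 2 - k)).
pose b' := (y3 - alpha * x3) / (s * (alpha ^+ 2 - k)).
have y1E : y1 = alpha * x1 + b * (s * (alpha ^+ 2 - k)) by rewrite /b; field; rewrite D0 s0.
have y3E : y3 = alpha * x3 + b' * (s * (alpha ^+ 2 - k)) by rewrite /b'; field; rewrite D0 s0.
clearbody b b'; rewrite y1E y3E.
have := iso x2 y2 _ (sum _ _
  (sum _ _ (scl (x1 + alpha * s * b - b' * c) _ U1) (scl b _ V2))
  (sum _ _ (scl (- x3 - alpha * s * b' - b * c) _ U3) (scl b' _ V1))).
rewrite /lie_mx !mx4_scale !mx4_add.
suff e (M N : 'M[R]_4) : M = N -> inW M -> inW N by apply: e; congr mx4; ring.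
by move=> ->.
Qed.

(** When alpha^2 = kappa, the vanishing of the invariants of the Plücker derivative cuts out a
    proper subspace that contains the fiber; the geodesic of the identity frame serves as
    witness. *)
Lemma substantial_neq (R : realType) (k alpha : R) : curvature k ->
  (forall l, oriented_geodesics k l -> substantial k l (control_fiber k alpha l)) ->
  alpha ^+ 2 <> k.
Proof.
move=> hk hs a2; pose l : set (R -> 'cV[R]_4) := lineF k 1%:M.
have f1 : frm k (1%:M : 'M[R]_4) by rewrite -(screw0 hk); exact: frm_screw.
have [h1 _] := f1.
have ol : oriented_geodesics k l by apply: oriented_line => //; exact: frm_unit_tangent.
have [_] := hs l ol; apply.
pose dP (X : 'M[R]_4) := X *m plucker l + plucker l *m X^T.
pose inv X := forall i j n, cyclic_triple i j n -> invariant_coord alpha i j n (dP X) = 0.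
have dPD a b X Y : dP (a *: X + b *: Y) = a *: dP X + b *: dP Y.
  exact: derivation_lin.
have icD a b i j n (M N : 'M[R]_4) : invariant_coord alpha i j n (a *: M + b *: N) =
    a * invariant_coord alpha i j n M + b * invariant_coord alpha i j n N.
  by rewrite /invariant_coord !mxE; ring.
have invD a b X Y : inv X -> inv Y -> inv (a *: X + b *: Y).
  by move=> hX hY i j n c; rewrite dPD icD (hX _ _ _ c) (hY _ _ _ c); ring.
pose W : set (set 'M[R]_4) := [set u | exists X, [/\ lieG k X, inv X & u = tangent_class k l X]].
(* [inv] depends only on the class, because the isotropy algebra annihilates [plucker]. *)
have inv_class X Y : tangent_class k l X = tangent_class k l Y -> inv Y -> inv X.
  move=> XY hY i j n c; have : tangent_class k l X X.
    by rewrite /tangent_class /= subrr; exact: lie_algebra0.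
  rewrite XY => /(lie_isotropyP _ hk f1) [_].
  rewrite -/l -/(dP _) -scaleN1r -[X in dP (X + _)]scale1r dPD.
  move=> e; have := congr1 (invariant_coord alpha i j n) e; rewrite icD (hY _ _ _ c).
  have -> : invariant_coord alpha i j n 0 = 0 by rewrite /invariant_coord !mxE; ring.
  lra.
exists W; split.
- split.
  + exists (tangent_class k l 0), 0; split=> //.
      by split; rewrite ?trmx0 ?mul0mx ?mulmx0 addr0.
    by move=> i j n _; rewrite /dP trmx0 mul0mx mulmx0 addr0 /invariant_coord !mxE; ring.
  + by move=> u [X [gX _ ->]]; exists X => //; exact: lieG_lie_isometries0.
  + move=> X Y r hX hY [X' [_ iX XX']] [Y' [_ iY YY']].
    exists ((1 - r) *: X + r *: Y); split=> //.
      by apply: lieG_lin; exact: lie_isometries0_lieG.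
    by apply: invD; [exact: inv_class XX' iX|exact: inv_class YY' iY].
(* The rotation about e_1 sends e_0 ^ e_2 towards e_0 ^ e_3, so the invariant of the triple (3, 1,
   2) has derivative 1. *)
- move=> WE; pose X : 'M[R]_4 := lie_mx k 0 0 0 1 0 0.
  have : tangent_geod k l (tangent_class k l X).
    by exists X => //; apply: lieG_lie_isometries0 => //; exact: lie_mx_lieG.
  rewrite -WE => -[X' [_ iX XX']]; have := inv_class _ _ XX' iX _ _ _ Cyclic312.
  rewrite /dP /l plucker_lineF// mul1mx trmx1 mulmx1 wedge02 /X /lie_mx mx4_tr !mx4_mul mx4_add.
  by rewrite /invariant_coord !mxE !ord4E /=; lra.
- move=> u fu; have [p [A [Gamma [hG [g lg uE]]]]] := fu.
  have [v [B [hpv lE [TA AA Av cr] [G0 GE] dG]]] := helicoidal_plucker hk hG.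
  exists (derive1 g 0); split; last by rewrite uE G0.
    apply: lie_isometries0_lieG => //; have [g1 gs gi] := lg; exists g; split=> //.
    by near=> s; have [|] := near gi s.
  move=> i j n c.
  have oG : \forall s \near (0 : R), oriented_geodesics k (Gamma s) by near=> s.
  have e := @derive_val _ _ _ _ _ _ _ (is_derive_plucker hk oG lg).
  rewrite (@derive_val _ _ _ _ _ _ _ dG) G0 in e.
  by rewrite /dP -e; exact: (invariant_coord_fiber hk a2 c).
Unshelve. all: by end_near. Qed.

(** * Parallel lines, Hopf fibrations and the theorem *)

Lemma controllable_neq (R : realType) (k alpha : R) : curvature k ->
  controllable k alpha -> alpha ^+ 2 <> k.
Proof.
move=> hk hc a2; have f1 : frm k (1%:M : 'M[R]_4) by rewrite -(screw0 hk); exact: frm_screw.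
have fc := frm_cycle3 k; have [h1 _] := f1; have [h2 _] := fc.
have o (F : 'M[R]_4) : isoG k F -> oriented_geodesics k (lineF k F).
  by move=> hF; apply: oriented_line => //; exact: frm_unit_tangent.
(* The two geodesics pass through e_0 with velocities e_2 and e_3; the invariant of the triple (2,
   3, 1) separates them. *)
have [a [b [c [_ pc ca cb]]]] := hc _ _ (o _ h1) (o _ h2).
have := piecewise_admissible_invariant hk a2 Cyclic231 pc.
rewrite ca cb !plucker_lineF// mul1mx trmx1 mulmx1 wedge02 /cycle3 mx4_tr !mx4_mul.
by rewrite /invariant_coord !mxE !ord4E /=; lra.
Qed.

Lemma oriented_mem (R : realType) (k : R) l sigma : curvature k ->
  oriented_geodesics k l -> l sigma -> unit_geodesic k sigma.
Proof. by move=> hk [tau _ ->] []. Qed.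

Lemma admissible_parallel (R : realType) (a b : \bar R) c :
  admissible (0 : R) 0 a b c -> forall s t : R, (a < s%:E < b)%E -> (a < t%:E < b)%E ->
  parallel_lines (c s) (c t).
Proof.
have hk : curvature (0 : R) by exact: Or31.
move=> adm s t hs ht sigma tau cs ct; exists 1; rewrite scale1r.
have [os _] := adm.1 s hs; have [ot _] := adm.1 t ht.
have inv i j n (ijn : cyclic_triple i j n) :=
  admissible_invariant hk (expr0n _ 2) ijn adm hs ht.
(* With alpha = 0 the last two indices do not matter, hence the dummy 0 0. As p_0 = 1 and v_0 = 0,
   the invariant is the coordinate i of the velocity. *)
have dir l f i : oriented_geodesics 0 l -> l f -> derive1 f 0 0 0 = 0 /\
    invariant_coord (0 : R) i 0 0 (plucker l) = derive1 f 0 i 0.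
  move=> ol lf; have [_ [M0 T0 _]] := unit_geodesicE hk (oriented_mem hk ol lf).
  have [p0 v0] := tangent0 M0 T0; split=> //.
  by rewrite (plucker_mem hk ol lf) /invariant_coord wedgeE p0 v0; ring.
have icE i j n (P : 'M[R]_4) : invariant_coord 0 i j n P = invariant_coord 0 i 0 0 P.
  by rewrite /invariant_coord; ring.
have eq i j n : cyclic_triple i j n -> derive1 tau 0 i 0 = derive1 sigma 0 i 0.
  move=> /inv; rewrite !icE; have [_ ->] := dir _ _ i os cs.
  by have [_ ->] := dir _ _ i ot ct.
apply: colP4.
- by have [-> _] := dir _ _ 0 os cs; have [-> _] := dir _ _ 0 ot ct.
- exact: eq Cyclic123.
- exact: eq Cyclic231.
- exact: eq Cyclic312.
Qed.

(** * Complex structures and Hopf fibrations *)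

Definition imx (R : realType) : 'M[R]_4 := mx4 0 (-1) 0 0 1 0 0 0 0 0 0 (-1) 0 0 1 0.

Lemma mul_iE (R : realType) (x : 'cV[R]_4) : mul_i x = imx R *m x.
Proof. by apply: colP4; rewrite !mxE sum4 !mxE !ord4E /=; ring. Qed.

Lemma standard_hopf_line (R : realType) (q : 'cV[R]_4) :
  unit_tangent 1 q (mul_i q) -> standard_hopf (line 1 q (mul_i q)).
Proof.
have hk := @curvature1 R; move=> hq; have [Mq Tq q1] := hq.
exists (geo 1 q (mul_i q)), [set x | exists a b : R, x = a *: q + b *: mul_i q]; split=> //.
- exact: unit_geodesic_geo.
- exists q => //; apply/eqP => q0; have [+ _] := Mq.
  by rewrite q0 level_formE !mxE; lra.
- apply/seteqP; split=> [_ [t _ <-]|x [Mx [a [b xE]]]].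
    split; first by have [] := unit_tangent_geo t hk hq.
    by exists (kcos 1 t), (kcos 1 t * 0 + ksin 1 t); rewrite mulr0 add0r.
  have ml u v : metric 1 u v = level_form 1 u v by rewrite metric_level ?mul1r ?expr1n.
  have ab : a ^+ 2 + b ^+ 2 = 1.
    have [+ _] := Mx; rewrite xE !levelE (level_formC 1 (mul_i q) q).
    have [-> _] := Mq; move: Tq; rewrite /tangent /= => ->; rewrite -ml q1; lra.
  have [th [cth sth]] := circle_angle ab.
  by exists th => //; rewrite /geo kcos1E ksin1E cth sth xE.
- by rewrite (derive1_geo _ _ hk) !(geo0 _ _ hk).
Qed.

(* The (anti-)self-dual part of p ^ v: for alpha = 1 or -1 it is the opposite of the
   complex structure whose complex lines cut the Hopf fibration through the geodesic. *)
Definition dual_part (R : realType) (alpha : R) (P : 'M[R]_4) : 'M[R]_4 := P - alpha *: star P.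

(** By orthonormality p ^ v sends p to - v and v to p, whereas star (p ^ v) is carried by the
    orthogonal plane and kills both. *)
Lemma dual_part_vec (R : realType) (alpha : R) (p v : 'cV[R]_4) :
  unit_tangent 1 p v -> dual_part alpha (wedge p v) *m p = - v /\
  dual_part alpha (wedge p v) *m v = p.
Proof.
move=> [[pp _] pv vv].
have ml x y : metric 1 x y = level_form 1 x y by rewrite metric_level ?mul1r ?expr1n.
rewrite ml in vv; rewrite /tangent /= in pv.
have gen (W : 'M[R]_4) (x : 'cV[R]_4) : star W *m x = 0 -> dual_part alpha W *m x = W *m x.
  by move=> h; rewrite /dual_part mulmxBl -scalemxAl h scaler0 subr0.
have := @wedgeE _ p v; move: (wedge p v) => W WE.
have Wx x : W *m x = level_form 1 v x *: p - level_form 1 p x *: v.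
  by apply: colP4; rewrite mxE sum4 !WE !level_formE !mxE; ring.
have s (x : 'cV[R]_4) : x = p \/ x = v -> star W *m x = 0.
  by move=> [->|->]; apply: colP4; rewrite mxE sum4 /star !mxE !ord4E /= !WE; ring.
rewrite !gen ?Wx; [|by apply: s; right|by apply: s; left].
by rewrite pp vv (level_formC 1 v p) pv !scale0r !scale1r subr0 sub0r.
Qed.

(** For alpha = 1 or -1, the imaginary quaternions acting on R^4 by multiplication on one side, the
    side depending on alpha. *)
Definition quat (R : realType) (alpha a b c : R) : 'M[R]_4 := mx4
  0 a b c (- a) 0 (- (alpha * c)) (alpha * b) (- b) (alpha * c) 0 (- (alpha * a))
  (- c) (- (alpha * b)) (alpha * a) 0.

Lemma dual_part_quat (R : realType) (alpha : R) (p v : 'cV[R]_4) : alpha ^+ 2 = 1 ->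
  let ic i j k := invariant_coord alpha i j k (wedge p v) in
  dual_part alpha (wedge p v) = quat alpha (ic 1 2 3) (ic 2 3 1) (ic 3 1 2).
Proof.
move=> a2 ic; rewrite /quat /ic /invariant_coord.
have wv m n : wedge p v m n = - wedge p v n m by rewrite !wedgeE; ring.
have w0 m : wedge p v m m = 0 by rewrite wedgeE; ring.
move: (wedge p v) wv w0 => P wv w0; rewrite /dual_part.
apply/matrixP => i j; rewrite !mxE.
by case: (I4P i) => ->; case: (I4P j) => ->; rewrite !ord4E /= ?w0 ?(wv 1 0) ?(wv 2 0) ?(wv 3 0)
  ?(wv 2 1) ?(wv 3 2) ?(wv 1 3); ring: a2.
Qed.

Lemma quat_sqr (R : realType) (alpha a b c : R) : alpha ^+ 2 = 1 ->
  quat alpha a b c *m quat alpha a b c = - (a ^+ 2 + b ^+ 2 + c ^+ 2) *: 1%:M.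
Proof. by move=> a2; rewrite /quat mx4_1 mx4_mul mx4_scale; congr mx4; ring: a2. Qed.

Lemma quat_tr (R : realType) (alpha a b c : R) : (quat alpha a b c)^T = - quat alpha a b c.
Proof. by rewrite /quat mx4_tr -[RHS]scaleN1r mx4_scale; congr mx4; ring. Qed.

(** The invariants determine [K], so all the geodesics of the curve satisfy v = K p for the same
    [K]. The basis p, K p, A, K A is orthonormal and conjugates [K] to multiplication by i; its
    orientation depends on the sign of alpha, so orientation-reversing isometries do occur. *)
Lemma admissible_hopf (R : realType) (alpha : R) (a b : \bar R) c : alpha ^+ 2 = 1 ->
  admissible 1 alpha a b c ->
  exists2 F, hopf_fibration F & forall t : R, (a < t%:E < b)%E -> F (c t).
Proof.
move=> a2 adm; have hk := @curvature1 R.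
have [[t0 ht0]|nt] := pselect (exists t : R, (a < t%:E < b)%E); last first.
  (* On an empty interval any Hopf fibration will do. *)
  exists (act 1%:M @` (@standard_hopf R)); last by move=> t ht; case: nt; exists t.
  by exists 1%:M => //; apply: isoG_isometries => //; exact: isoG1.
have [F [fF FE]] : exists F, frm 1 F /\ c t0 = lineF 1 F.
  by have [F fF FE] := frm_exists hk (adm.1 t0 ht0).1; exists F.
have [hF _] := fF; have [[M0 T1 T2 T3] [[m11 m22 m33] [m12 m31 m32]]] := isoG_cols hk hF.
set p := col 0 F in M0 T1 T2 T3; set v := col 2 F in T2 m22 m12 m32.
set A := col 1 F in T1 m11 m12 m31.
have ml x y : metric 1 x y = level_form 1 x y by rewrite metric_level ?mul1r ?expr1n.
have hpv : unit_tangent 1 p v by [].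
pose K := - dual_part alpha (wedge p v).
have [Jp Jv] := dual_part_vec alpha hpv.
have Kp : K *m p = v by rewrite /K mulNmx Jp opprK.
have Kv : K *m v = - p by rewrite /K mulNmx Jv.
(* By [quat_sqr] the square of [K] is scalar, and K (K p) = - p identifies the scalar. *)
have [K2 KT] : K *m K = - 1%:M /\ K^T = - K.
  rewrite /K dual_part_quat//; set x := invariant_coord _ _ _ _ _.
  set y := invariant_coord _ _ _ _ _; set z := invariant_coord _ _ _ _ _.
  have e : K *m (K *m p) = - (x ^+ 2 + y ^+ 2 + z ^+ 2) *: p.
    rewrite mulmxA /K dual_part_quat// mulNmx mulmxN opprK quat_sqr//.
    by rewrite -scalemxAl mul1mx.
  have n1 : x ^+ 2 + y ^+ 2 + z ^+ 2 = 1.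
    have := congr1 (level_form 1 p) e; rewrite Kp Kv level_formZr -scaleN1r level_formZr.
    by have [-> _] := M0; lra.
  split; last by rewrite linearN /= quat_tr.
  by rewrite mulNmx mulmxN opprK quat_sqr// n1 scaleN1r.
have KK x y : level_form 1 (K *m x) y = - level_form 1 x (K *m y).
  have dot (u w : 'cV[R]_4) : level_form 1 u w = (u^T *m w) 0 0.
    by rewrite level_formE mxE sum4 !mxE; ring.
  by rewrite !dot trmx_mul KT mulmxN mulNmx mulmxA mxE.
pose g := frame p v A (K *m A).
have gK : g *m imx R = K *m g.
  have cg M N : (forall j, col j M = col j N) -> M = N :> 'M[R]_4.
    move=> h; apply/matrixP => i j.
    by have := congr1 (fun u : 'cV[R]_4 => u i 0) (h j); rewrite !mxE.
  have KKA : K *m (K *m A) = - A by rewrite mulmxA K2 mulNmx mul1mx.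
  apply: cg => j; rewrite [RHS]col_mulmx col_mulmx4.
  by case: (I4P j) => ->; rewrite !frameE /imx !mxE !ord4E /= !scale0r ?scale1r ?scaleN1r
    ?addr0 ?add0r.
have gg : g^T *m g = 1%:M.
  have gE i j : (g^T *m g) i j = level_form 1 (col i g) (col j g).
    by rewrite level_formE !mxE sum4 !mxE; ring.
  have [pp _] := M0; rewrite !ml in m11 m22 m33 m12; rewrite /tangent /= in T1 T2.
  have Av : level_form 1 A v = 0 by [].
  have Ap : level_form 1 A p = 0 by rewrite level_formC.
  have vp : level_form 1 v p = 0 by rewrite level_formC.
  have e1 : level_form 1 (K *m A) p = 0 by rewrite KK Kp Av oppr0.
  have e2 : level_form 1 (K *m A) v = 0.
    by rewrite KK Kv -[- p]scaleN1r level_formZr Ap mulr0 oppr0.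
  have e3 : level_form 1 (K *m A) A = 0.
    by have := KK A A; rewrite (level_formC 1 A (K *m A)); lra.
  have e4 : level_form 1 (K *m A) (K *m A) = 1.
    by rewrite KK mulmxA K2 mulNmx mul1mx -[- A]scaleN1r level_formZr m11; ring.
  apply/matrixP => i j; rewrite gE.
  by case: (I4P i) => ->; case: (I4P j) => ->; rewrite !frameE mxE /=
    ?pp ?T1 ?T2 ?m11 ?m22 ?Av ?Ap ?vp ?e1 ?e2 ?e3 ?e4// level_formC.
have gg' : g *m g^T = 1%:M by exact: mulmx1C.
have QE : Qmx (1 : R) = 1%:M by rewrite mx4_1.
have LE : Lmx (1 : R) = 1%:M by rewrite mx4_1.
have hg : isoG 1 g by split; rewrite ?QE ?LE ?mulmx1// eqxx.
have hg' : isoG 1 g^T by split; rewrite ?QE ?LE ?mulmx1 ?trmxK// eqxx.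
exists (act g @` (@standard_hopf R)); first by exists g => //; exact: isoG_isometries.
move=> t ht; have [q [w [hqw cE]]] := (oriented_geodesicsP _ hk).1 (adm.1 t ht).1.
have Kq : K *m q = w.
  have inv i j n (ijn : cyclic_triple i j n) := admissible_invariant hk a2 ijn adm ht ht0.
  rewrite cE FE /lineF !plucker_line// -/p -/v in inv.
  have e : dual_part alpha (wedge q w) = dual_part alpha (wedge p v).
    by rewrite !dual_part_quat// (inv _ _ _ Cyclic123) (inv _ _ _ Cyclic231) (inv _ _ _ Cyclic312).
  by have [+ _] := dual_part_vec alpha hqw; rewrite e /K mulNmx => ->; rewrite opprK.
have wE : mul_i (g^T *m q) = g^T *m w.
  by rewrite mul_iE -Kq -[RHS]mulmx1 -[LHS]mul1mx -[in LHS]gg -!mulmxA (mulmxA g) gK -!mulmxA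
    (mulmxA g g^T) gg' mul1mx mulmx1.
have hq' := isoG_unit_tangent hk hg' hqw; rewrite -wE in hq'.
exists (line 1 (g^T *m q) (mul_i (g^T *m q))); first exact: standard_hopf_line.
by rewrite act_line// wE !mulmxA gg' !mul1mx.
Qed.

Theorem theorem8 (R : realType) (alpha kappa : R)
    (hkappa : [\/ kappa = 0, kappa = 1 | kappa = -1]) :
  [/\ controllable kappa alpha <-> alpha ^+ 2 <> kappa,
      alpha ^+ 2 <> kappa <->
        (forall l, oriented_geodesics kappa l ->
           substantial kappa l (control_fiber kappa alpha l)),
      kappa = 0 -> alpha = 0 ->
        forall (a b : \bar R) (c : R -> set (R -> 'cV[R]_4)),
        admissible kappa alpha a b c ->
        forall s t : R, (a < s%:E < b)%E -> (a < t%:E < b)%E ->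
        parallel_lines (c s) (c t)
    & kappa = 1 -> alpha = 1 \/ alpha = -1 ->
        forall (a b : \bar R) (c : R -> set (R -> 'cV[R]_4)),
        admissible kappa alpha a b c ->
        exists2 F, hopf_fibration F
          & forall t : R, (a < t%:E < b)%E -> F (c t)].
Proof.
split.
- split=> [|ak l1 l2 h1 h2]; first exact: controllable_neq.
  by apply: hreach_piecewise => //; exact: hreach_all.
- split=> [ak l hl|]; last exact: substantial_neq.
  by have [F fF ->] := frm_exists hkappa hl; exact: substantial_lineF.
- by move=> -> -> a b c; exact: admissible_parallel.
- move=> -> ha a b c; apply: admissible_hopf.
  by case: ha => ->; ring.
Qed.
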